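(* Let $(T_{\boldsymbol s})_{\boldsymbol s\succeq\boldsymbol 0}$ be a $k$-parameter strongly continuous semigroup on $\mathfrak B_b(\mathbb R^d)$ associated to a $k$-parameter homogeneous Markov process $\boldsymbol X(\boldsymbol s)$, with marginal generators $\mathcal G^{(1)},\dots,\mathcal G^{(k)}$. Let $\boldsymbol S(t)$ be a $k$-dimensional additive subordinator independent of $\boldsymbol X$ with time-$t$ characteristic function $$\mathbb E\big[e^{i\boldsymbol\xi\cdot\boldsymbol S(t)}\big]=\exp\Big\{i\boldsymbol c(t)\cdot\boldsymbol\xi+\int_{\mathbb R^k_+\setminus\{\boldsymbol 0\}}\big(e^{i\boldsymbol s\cdot\boldsymbol\xi}-1\big)\,\nu(t,d\boldsymbol s)\Big\},\qquad\boldsymbol\xi\in\mathbb R^k,$$ where $\boldsymbol c(t)\in\mathbb R^k_+$ is the time-dependent drift and $\nu(t,\cdot)$ a time-dependent Lévy measure, such that, with the finite measures $\nu_F(t,A)=\int_A(\|\boldsymbol s\|\wedge1)\nu(t,d\boldsymbol s)$: the left and right limits of each $c_j$ exist and are finite at every $t\ge0$; the left and right limits of $\nu_F(t,\cdot)$ converge weakly to a finite measure at every $t\ge0$; and $c_j$, $j=1,\dots,k$, and $\nu_F(t,\cdot)$ are right continuous in $t$ with only finitely many points of discontinuity. Let $\boldsymbol Y(t)=\boldsymbol X(\boldsymbol S(t))$, let $\mathcal G_t$ be its right generator, given by $$\mathcal G_tf=\sum_{j=1}^kc_j(t)\mathcal G^{(j)}f+\int_{\mathbb R^k_+\setminus\{\boldsymbol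 0\}}(T_{\boldsymbol s}f-f)\,\nu(t,d\boldsymbol s),\qquad f\in\bigcap_{j=1}^kD(\mathcal G^{(j)}),$$ and let $$\hat\mu^{\boldsymbol Y}_{t_1,t_2}(\boldsymbol x,\boldsymbol\xi)=\mathbb E\big[e^{i\boldsymbol\xi\cdot(\boldsymbol Y(t_2)-\boldsymbol Y(t_1))}\,\big|\,\boldsymbol Y(t_1)=\boldsymbol x\big],\qquad 0\le t_1\le t_2,\ \boldsymbol x,\boldsymbol\xi\in\mathbb R^d.$$ Then the right generator $\mathcal G_t$ has, for $f\in\mathcal S(\mathbb R^d)\cap\bigcap_{j=1}^kD(\mathcal G^{(j)})$, the representation $$\mathcal G_tf(\boldsymbol x)=-(2\pi)^{-d/2}\int_{\mathbb R^d}e^{i\boldsymbol x\cdot\boldsymbol\xi}\,q(t,\boldsymbol x,\boldsymbol\xi)\,\hat f(\boldsymbol\xi)\,d\boldsymbol\xi,$$ with symbol $$q(t,\boldsymbol x,\boldsymbol\xi)=-\frac{d}{dt}\hat\mu^{\boldsymbol Y}_{s,t}(\boldsymbol x,\boldsymbol\xi)\Big|_{s=t},$$ that is continuous and negative definite (as a function of $\boldsymbol\xi$).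
   Context: $\mathfrak B_b(\mathbb R^d)$ is the Banach space of bounded Borel functions $\mathbb R^d\to\mathbb R$ with the supremum norm; $\mathcal S(\mathbb R^d)$ is the Schwartz space; $\hat f(\boldsymbol\xi)=(2\pi)^{-d/2}\int_{\mathbb R^d}e^{-i\boldsymbol x\cdot\boldsymbol\xi}f(\boldsymbol x)d\boldsymbol x$. On $\mathbb R^k$, $\boldsymbol s\preceq\boldsymbol t$ means $s_j\le t_j$ for all $j$; $\boldsymbol e_1,\dots,\boldsymbol e_k$ is the canonical basis of $\mathbb R^k$. The derivative in the definition of $q$ is $\frac{d}{dt}\hat\mu^{\boldsymbol Y}_{s,t}(\boldsymbol x,\boldsymbol\xi)\big|_{s=t}=\lim_{h\to0+}h^{-1}\big(\hat\mu^{\boldsymbol Y}_{t,t+h}(\boldsymbol x,\boldsymbol\xi)-1\big)$. A function $q:\mathbb R^d\to\mathbb C$ is negative definite if for all $n$, $\boldsymbol\xi_1,\dots,\boldsymbol\xi_n\in\mathbb R^d$ the matrix $\big(q(\boldsymbol\xi_l)+\overline{q(\boldsymbol\xi_m)}-q(\boldsymbol\xi_l-\boldsymbol\xi_m)\big)_{l,m}$ is positive semidefinite Hermitian. A $k$-parameter filtration is a family $(\mathcal F_{\boldsymbol s})_{\boldsymbol s\in\mathbb R^k_+}$ of sub-$\sigma$-algebras with $\mathcal F_{\boldsymbol s}\subseteq\mathcal F_{\boldsymbol t}$ for $\boldsymbol s\preceq\boldsymbol t$; it is commuting (w.r.t. $P$) if for all $\boldsymbol s,\boldsymbol t$ and bounded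 $\mathcal F_{\boldsymbol t}$-measurable $Z$, $E[Z\mid\mathcal F_{\boldsymbol s}]=E[Z\mid\mathcal F_{\boldsymbol s\wedge\boldsymbol t}]$ a.s. A $k$-parameter $\mathbb R^d$-valued process $(\boldsymbol X(\boldsymbol s))_{\boldsymbol s\in\mathbb R^k_+}$ is a homogeneous Markov process if there are a $k$-parameter filtration $(\mathcal F_{\boldsymbol s})$ and operators $(T_{\boldsymbol s})_{\boldsymbol s\succeq\boldsymbol 0}$ such that for every $\boldsymbol x\in\mathbb R^d$ there is a probability measure $\mathbb P_{\boldsymbol x}$ with: (a) $\boldsymbol X$ is adapted; (b) trajectories are $\mathbb P_{\boldsymbol x}$-a.s. càdlàg in the partial order; (c) each $\mathcal F_{\boldsymbol s}$ is $\mathbb P_{\boldsymbol x}$-complete and the filtration is commuting w.r.t. all $\mathbb P_{\boldsymbol x}$; (d) $\mathbb E_{\boldsymbol x}[f(\boldsymbol X(\boldsymbol s+\boldsymbol t))\mid\mathcal F_{\boldsymbol s}]=T_{\boldsymbol t}f(\boldsymbol X(\boldsymbol s))$ for $f\in\mathfrak B_b(\mathbb R^d)$; (e) $\mathbb P_{\boldsymbol x}(\boldsymbol X(\boldsymbol 0)=\boldsymbol x)=1$. The associated semigroup is $T_{\boldsymbol s}f(\boldsymbol x)=\mathbb E_{\boldsymbol x}[f(\boldsymbol X(\boldsymbol s))]$; $\mathcal G^{(j)}$, with domain $D(\mathcal G^{(j)})$, is the generator of the strongly continuous one-parameter semigroup $T^{(j)}_s=T_{s\boldsymbol e_j}$.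 A $k$-dimensional additive subordinator is an $\mathbb R^k_+$-valued process started at $\boldsymbol 0$, increasing in each component, with independent (not necessarily stationary) increments and continuous in probability; $\pi_{t_1,t_2}$ denotes the law of $\boldsymbol S(t_2)-\boldsymbol S(t_1)$. $\boldsymbol Y$ is a time-inhomogeneous Markov process with evolution $T_{t_1,t_2}f=\int_{\mathbb R^k_+}T_{\boldsymbol s}f\,\pi_{t_1,t_2}(d\boldsymbol s)$ and transition probabilities $\int_{\mathbb R^k_+}\mathbb P_{\boldsymbol x}(\boldsymbol X(\boldsymbol s)\in d\boldsymbol y)\,\pi_{t_1,t_2}(d\boldsymbol s)$, which are used to define conditional expectations given $\boldsymbol Y(t_1)=\boldsymbol x$. Its right generator is $\mathcal G_tf=\lim_{h\to0+}h^{-1}(T_{t,t+h}f-f)$. *)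

(* Defs.v *)
From HB Require Import structures.
From mathcomp Require Import all_boot all_order all_algebra.
From mathcomp Require Import all_classical all_reals all_analysis.
From mathcomp Require Import measurable_realfun complex.
Set Implicit Arguments.
Unset Strict Implicit.
Unset Printing Implicit Defensive.
Import Order.TTheory GRing.Theory Num.Theory numFieldNormedType.Exports.
Local Open Scope classical_set_scope.
Local Open Scope ring_scope.

Section borel_rV.
Context {R : realType} (n : nat).

Let borel_setC (A : set 'rV[R]_n) : <<s open >> A -> <<s open >> (~` A).
Proof. exact: sigma_algebraC. Qed.

HB.instance Definition _ := @isMeasurable.Build default_measure_display
  'rV[R]_n <<s open >> (@sigma_algebra0 _ setT open) borel_setC
  (@sigma_algebra_bigcup _ setT open).

End borel_rV.

Section borel_rV_lemmas.
Context {R : realType}.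

Lemma measurable_rV_coord n (i : 'I_n) :
  measurable_fun [set: 'rV[R]_n] (fun v : 'rV[R]_n => v ord0 i).
Proof.
apply: (measurability _ (RGenOInfty.measurableE R)).
move=> _ [_ [a ->] <-]; rewrite setTI.
apply: sub_sigma_algebra.
apply: open_comp; last exact: interval_open.
by move=> v _; exact: coord_continuous.
Qed.

Lemma measurable_fun_rV d (T : measurableType d) n (f : T -> 'rV[R]_n) :
  (forall i, measurable_fun setT (fun x => f x ord0 i)) ->
  measurable_fun setT f.
Proof.
move=> mf; apply: (@measurability _ _ _ _ setT f open) => //.
move=> _ [U oU <-]; rewrite setTI.
pose box (p : 'rV[rat]_n * nat) : set 'rV[R]_n :=
  [set v | forall i, ball (ratr (p.1 ord0 i) : R) (p.2.+1%:R^-1) (v ord0 i)].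
pose F p := if `[< box p `<=` U >] then f @^-1` box p else set0.
have -> : f @^-1` U = \bigcup_p F p.
  apply/seteqP; split=> [x /= Ufx|x [p _]]; last first.
    by rewrite /F; case: asboolP => // sU; exact: sU.
  have /nbhs_ballP[e /= e0 eU] := open_nbhs_nbhs (conj oU Ufx).
  have [m me] : exists m, m.+1%:R^-1 + m.+1%:R^-1 < e.
    have e20 : 0 < e / 2 by rewrite divr_gt0.
    have [m hm] := ltr_add_invr e20.
    exists m; rewrite add0r in hm.
    by rewrite [ltRHS]splitr ltrD.
  have H i : exists q : rat, ball (ratr q : R) m.+1%:R^-1 (f x ord0 i).
    have : f x ord0 i < f x ord0 i + m.+1%:R^-1 by rewrite ltrDl invr_gt0.
    move=> /rat_in_itvoo[q]; rewrite in_itv/= => /andP[q1 q2].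
    exists q; rewrite /ball/= ltr_distlC; apply/andP; split.
      by rewrite ltrBlDr.
    by rewrite (lt_le_trans q1)// lerDl invr_ge0.
  pose q : 'rV[rat]_n := \row_i projT1 (cid (H i)).
  exists (q, m) => //; rewrite /F; case: asboolP => /=.
    by move=> _ i; rewrite mxE; case: cid.
  case=> v /= bv; apply: eU; split=> // i j.
  rewrite (ord1 i).
  apply: (le_ball (ltW me)).
  have h1 : ball (f x ord0 j) m.+1%:R^-1 (ratr (q ord0 j) : R).
    by apply: ball_sym; rewrite mxE; case: cid.
  exact: (ball_triangle h1 (bv j)).
apply: countable_bigcupT_measurable; first exact: countableP.
move=> p; rewrite /F; case: asboolP => // _.
have -> : f @^-1` box p = \bigcap_(i in [set: 'I_n])
    (fun x => f x ord0 i) @^-1` ball (ratr (p.1 ord0 i) : R) (p.2.+1%:R^-1).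
  by apply/seteqP; split=> x /= H i => [_|]; exact: H.
apply: fin_bigcap_measurable; first exact: finite_finset.
move=> i _; rewrite -[X in measurable X]setTI.
apply: (mf i) => //; apply: open_measurable; exact: ball_open.
Qed.

Lemma measurable_rV_cons n : measurable_fun setT
  (fun p : measurableTypeR R * 'rV[R]_n => row_mx p.1%:M p.2 : 'rV[R]_n.+1).
Proof.
apply: measurable_fun_rV => i.
have [j ->|j ->] := split_ordP (i : 'I_(1 + n)).
  rewrite (_ : (fun _ => _) = fst); first exact: measurable_fst.
  apply/funext => p; rewrite (ord1 j).
  by rewrite [LHS](row_mxEl p.1%:M p.2 ord0 ord0) !mxE.
rewrite (_ : (fun _ => _) = (fun v : 'rV[R]_n => v ord0 j) \o snd).
  apply: measurableT_comp; [exact: measurable_rV_coord|exact: measurable_snd].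
by apply/funext => p; rewrite [LHS](row_mxEr p.1%:M p.2 ord0 j).
Qed.

Lemma measurable_rV_uncons n : measurable_fun setT
  (fun v : 'rV[R]_n.+1 =>
    (v ord0 ord0, rsubmx (v : 'rV[R]_(1 + n))) : measurableTypeR R * 'rV[R]_n).
Proof.
apply/prod_measurable_funP; split => /=.
  exact: measurable_rV_coord.
apply: measurable_fun_rV => i /=.
rewrite (_ : (fun _ => _) = (fun v : 'rV[R]_n.+1 => v ord0 (rshift 1 i))).
  exact: measurable_rV_coord.
by apply/funext => v; rewrite !mxE.
Qed.

End borel_rV_lemmas.

(* Lebesgue measure on R^n is built by iterated products, R^(n.+1) being read
   as R * R^n through [row_mx]. *)
Section lebesgue_rV.
Context {R : realType}.

Section cons.
Context (n : nat) (m : {sigma_finite_measure set 'rV[R]_n -> \bar R}).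

Let cons (p : measurableTypeR R * 'rV[R]_n) : 'rV[R]_n.+1 :=
  row_mx p.1%:M p.2.

Let uncons (v : 'rV[R]_n.+1) : measurableTypeR R * 'rV[R]_n :=
  (v ord0 ord0, rsubmx (v : 'rV[R]_(1 + n))).

Definition lebesgue_cons : set 'rV[R]_n.+1 -> \bar R :=
  pushforward (lebesgue_measure \x m)%E cons.

Let cons_preimage (A : set 'rV[R]_n.+1) :
  measurable A -> measurable (cons @^-1` A).
Proof.
move=> mA; rewrite -[X in measurable X]setTI; exact: measurable_rV_cons.
Qed.

Let lebesgue_cons0 : lebesgue_cons set0 = 0%E.
Proof. by rewrite /lebesgue_cons /pushforward preimage_set0 measure0. Qed.

Let lebesgue_cons_ge0 A : (0 <= lebesgue_cons A)%E.
Proof. by rewrite /lebesgue_cons /pushforward; apply: measure_ge0. Qed.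

Let lebesgue_cons_sigma_additive : semi_sigma_additive lebesgue_cons.
Proof.
move=> F mF tF mUF; rewrite /lebesgue_cons /pushforward preimage_bigcup.
apply: measure_semi_sigma_additive.
- by move=> i; apply: cons_preimage.
- apply/trivIsetP => /= i j _ _ ij; rewrite -preimage_setI.
  by move/trivIsetP : tF => /(_ _ _ _ _ ij) ->//; rewrite preimage_set0.
- by rewrite -preimage_bigcup; exact: cons_preimage.
Qed.

HB.instance Definition _ := isMeasure.Build _ _ _ lebesgue_cons
  lebesgue_cons0 lebesgue_cons_ge0 lebesgue_cons_sigma_additive.

Let consK : cancel cons uncons.
Proof.
move=> [a v]; rewrite /cons /uncons; congr pair; last exact: row_mxKr.
have -> : ord0 = lshift n (ord0 : 'I_1) by exact/val_inj.
by rewrite [LHS](row_mxEl a%:M v ord0 ord0) !mxE.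
Qed.

Let lebesgue_cons_sigma_finite : sigma_finite setT lebesgue_cons.
Proof.
have /sigma_finiteP[F [TF ndF Foo]] :=
  sigma_finiteT (@lebesgue_measure R).
have /sigma_finiteP[G [TG ndG Goo]] := sigma_finiteT m.
exists (fun i => uncons @^-1` (F i `*` G i)).
  rewrite -preimage_bigcup (_ : \bigcup_i (F i `*` G i) = setT)//.
  rewrite -setXTT TF TG predeqE => -[x y]; split.
    by move=> [i _ []/= ? ?]; split; exists i.
  move=> [/= [i _ Fix] [j _ Gjy]]; exists (maxn i j) => //; split.
  - by move: x Fix; exact/subsetPset/ndF/leq_maxl.
  - by move: y Gjy; exact/subsetPset/ndG/leq_maxr.
move=> i; have [mF Fi] := Foo i; have [mG Gi] := Goo i; split.
  rewrite -[X in measurable X]setTI; apply: measurable_rV_uncons => //.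
  exact: measurableX.
rewrite /lebesgue_cons /pushforward -comp_preimage.
rewrite (_ : uncons \o cons = id) ?preimage_id; last exact/funext/consK.
by rewrite product_measure1E// lte_mul_pinfty// ge0_fin_numE.
Qed.

HB.instance Definition _ := Measure_isSigmaFinite.Build _ _ _ lebesgue_cons
  lebesgue_cons_sigma_finite.

End cons.

Fixpoint lebesgue_rV (n : nat) : {sigma_finite_measure set 'rV[R]_n -> \bar R} :=
  if n is n'.+1 then lebesgue_cons (lebesgue_rV n')
  else dirac (0 : 'rV[R]_0).

End lebesgue_rV.

Local Open Scope complex_scope.

Section euclidean.
Context {R : realType} {n : nat}.
Implicit Types s t x y : 'rV[R]_n.

Definition dotp x y : R := \sum_(i < n) x ord0 i * y ord0 i.

Definition norm2 x : R := Num.sqrt (dotp x x).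

Definition lev s t : Prop := forall i, s ord0 i <= t ord0 i.

Definition minv s t : 'rV[R]_n := \row_i Num.min (s ord0 i) (t ord0 i).

Definition orthant : set 'rV[R]_n := [set s | lev 0 s].

End euclidean.

Section complex_analysis.
Context {R : realType}.

Definition expi (a : R) : R[i] := cos a +i* sin a.

Definition cexp (z : R[i]) : R[i] :=
  (expR (complex.Re z))%:C * expi (complex.Im z).

Definition cintegrable d (T : measurableType d)
    (mu : {measure set T -> \bar R}) (D : set T) (f : T -> R[i]) : Prop :=
  mu.-integrable D (EFin \o (fun x => complex.Re (f x))) /\
  mu.-integrable D (EFin \o (fun x => complex.Im (f x))).

Definition cintegral d (T : measurableType d)
    (mu : {measure set T -> \bar R}) (D : set T) (f : T -> R[i]) : R[i] :=
  (\int[mu]_(x in D) complex.Re (f x)) +i* (\int[mu]_(x in D) complex.Im (f x)).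

Definition psd_hermitian n (A : 'M[R[i]]_n) : Prop :=
  (forall l m, A m l = (A l m)^*) /\
  (forall v : 'I_n -> R[i], 0 <= \sum_l \sum_m v l * A l m * (v m)^*).

Definition negative_definite d (q : 'rV[R]_d -> R[i]) : Prop :=
  forall (n : nat) (xi : 'I_n -> 'rV[R]_d),
    psd_hermitian (\matrix_(l, m) (q (xi l) + (q (xi m))^* - q (xi l - xi m))).

End complex_analysis.

Section function_spaces.
Context {R : realType} {d : nat}.
Implicit Types f g : 'rV[R]_d -> R.

Definition bounded_borel f : Prop :=
  measurable_fun setT f /\ exists M : R, forall x, `|f x| <= M.

Definition unif_cvg {I : Type} (F : set_system I) (u : I -> 'rV[R]_d -> R) g :
    Prop :=
  forall e : R, 0 < e -> \forall i \near F, forall x, `|u i x - g x| <= e.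

Definition partials (s : seq 'I_d) f : 'rV[R]_d -> R :=
  foldr (fun i g x => 'D_(delta_mx ord0 i) g x) f s.

Definition schwartz f : Prop := forall s : seq 'I_d,
  [/\ continuous (partials s f),
      forall i x, derivable (partials s f) x (delta_mx ord0 i) &
      forall a : 'I_d -> nat, exists M : R, forall x : 'rV[R]_d,
        `|(\prod_i x ord0 i ^+ a i) * partials s f x| <= M].

Definition fourier_cst : R := (2 * pi) `^ (- (d%:R / 2)).

Definition fourier f (xi : 'rV[R]_d) : R[i] :=
  fourier_cst%:C *
  cintegral (lebesgue_rV d) setT (fun x => expi (- dotp x xi) * (f x)%:C).

End function_spaces.
Arguments fourier_cst : clear implicits.

Section semigroups.
Context {R : realType} {d k : nat}.
Implicit Types (T : 'rV[R]_k -> ('rV[R]_d -> R) -> 'rV[R]_d -> R).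

Record C0_semigroup T : Prop := {
  C0_bounded_borel : forall s f, lev 0 s ->
    bounded_borel f -> bounded_borel (T s f) ;
  C0_linear : forall s (a : R) f g, lev 0 s ->
    bounded_borel f -> bounded_borel g ->
    T s (fun x => a * f x + g x) = (fun x => a * T s f x + T s g x) ;
  C0_bounded : forall s, lev 0 s -> exists C : R, forall f (M : R),
    bounded_borel f -> (forall x, `|f x| <= M) ->
    forall x, `|T s f x| <= C * M ;
  C0_id : forall f, bounded_borel f -> T 0 f = f ;
  C0_comp : forall s t f, lev 0 s -> lev 0 t -> bounded_borel f ->
    T (s + t) f = T s (T t f) ;
  C0_cvg : forall f, bounded_borel f ->
    unif_cvg (within orthant (nbhs (0 : 'rV[R]_k))) (fun s => T s f) f }.

Definition gen_quotient T (j : 'I_k) f (h : R) (x : 'rV[R]_d) : R :=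
  h^-1 * (T (h *: delta_mx ord0 j) f x - f x).

Definition gen_domain T (j : 'I_k) f : Prop :=
  bounded_borel f /\
  exists2 g, bounded_borel g & unif_cvg 0^'+ (gen_quotient T j f) g.

(* On [gen_domain T j] the limit is uniform; being pointwise as well, it is
   picked by the pointwise [lim]. *)
Definition generator T (j : 'I_k) f (x : 'rV[R]_d) : R :=
  lim (gen_quotient T j f h x @[h --> 0^'+]).

End semigroups.

Section conditioning.
Context {R : realType} {disp : measure_display} {Omega : measurableType disp}.
Implicit Types (P : probability Omega R) (G : set (set Omega)).

Definition measurable_wrt d' (E : measurableType d') G (Z : Omega -> E) : Prop :=
  forall B, measurable B -> G (Z @^-1` B).

(* [V] is a version of E[Z | G]. *)
Definition is_cond_exp P G (Z V : Omega -> R) : Prop :=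
  [/\ measurable_wrt G V, P.-integrable setT (EFin \o V) &
      forall A, G A -> \int[P]_(w in A) V w = \int[P]_(w in A) Z w].

Definition sigma_process (I : Type) (J : set I) d' (E : measurableType d')
    (Z : I -> Omega -> E) : set (set Omega) :=
  <<s [set A | exists2 i, J i & exists2 B, measurable B & A = Z i @^-1` B] >>.

Definition independent_processes P
    (I : Type) (J : set I) d1 (E : measurableType d1) (X : I -> Omega -> E)
    (I' : Type) (J' : set I') d2 (E' : measurableType d2)
    (S : I' -> Omega -> E') : Prop :=
  forall A B, sigma_process J X A -> sigma_process J' S B ->
    (P (A `&` B) = P A * P B)%E.

End conditioning.

Section multiparameter_markov.
Context {R : realType} {d k : nat} {disp : measure_display}
  {Omega : measurableType disp}.

Record filtration (F : 'rV[R]_k -> set (set Omega)) : Prop := {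
  filtration_sigma : forall s, lev 0 s -> sigma_algebra setT (F s) ;
  filtration_sub : forall s, lev 0 s -> F s `<=` measurable ;
  filtration_mono : forall s t, lev 0 s -> lev s t -> F s `<=` F t }.

Definition commuting (P : probability Omega R)
    (F : 'rV[R]_k -> set (set Omega)) : Prop :=
  forall (s t : 'rV[R]_k) (Z V W : Omega -> R), lev 0 s -> lev 0 t ->
    measurable_wrt (F t) Z -> (exists M : R, forall w, `|Z w| <= M) ->
    is_cond_exp P (F s) Z V -> is_cond_exp P (F (minv s t)) Z W ->
    {ae P, forall w, V w = W w}.

(* A single filtration serves all the laws [P x], so completeness is taken with
   respect to the family: subsets of [F s]-sets that are null under every
   [P x]. Asking it for each [P x] separately would force every subset of
   [Omega] into [F 0], as {X 0 != x} is null under [P x]. *)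
Definition complete_wrt (P : 'rV[R]_d -> probability Omega R)
    (G : set (set Omega)) : Prop :=
  forall A N, G A -> (forall x, P x A = 0%E) -> N `<=` A -> G N.

(* Right continuity and left limits along sequences that are monotone in the
   partial order. *)
Definition cadlag (x : 'rV[R]_k -> 'rV[R]_d) : Prop :=
  forall (s : 'rV[R]_k) (u : nat -> 'rV[R]_k),
    lev 0 s -> (forall n, lev 0 (u n)) -> u n @[n --> \oo] --> s ->
    ((forall n, lev (u n.+1) (u n)) -> x (u n) @[n --> \oo] --> x s) /\
    ((forall n, lev (u n) (u n.+1)) -> cvg (x (u n) @[n --> \oo])).

Record homogeneous_markov (P : 'rV[R]_d -> probability Omega R)
    (F : 'rV[R]_k -> set (set Omega)) (X : 'rV[R]_k -> Omega -> 'rV[R]_d)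
    (T : 'rV[R]_k -> ('rV[R]_d -> R) -> 'rV[R]_d -> R) : Prop := {
  hm_filtration : filtration F ;
  hm_adapted : forall s, lev 0 s -> measurable_wrt (F s) (X s) ;
  hm_cadlag : forall x, {ae P x, forall w, cadlag (fun s => X s w)} ;
  hm_complete : forall s, lev 0 s -> complete_wrt P (F s) ;
  hm_commuting : forall x, commuting (P x) F ;
  hm_markov : forall x s t f, lev 0 s -> lev 0 t -> bounded_borel f ->
    is_cond_exp (P x) (F s) (fun w => f (X (s + t) w))
      (fun w => T t f (X s w)) ;
  hm_start : forall x, P x [set w | X 0 w = x] = 1%E ;
  hm_semigroup : forall s f x, lev 0 s -> bounded_borel f ->
    T s f x = \int[P x]_w f (X s w) }.

End multiparameter_markov.

Section additive_subordination.
Context {R : realType} {d k : nat} {disp : measure_display}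
  {Omega : measurableType disp}.

Definition increment (S : R -> Omega -> 'rV[R]_k) (t1 t2 : R) (w : Omega) :
  'rV[R]_k := S t2 w - S t1 w.

Record additive_subordinator (P : probability Omega R)
    (S : R -> Omega -> 'rV[R]_k) : Prop := {
  as_measurable : forall t, 0 <= t -> measurable_fun setT (S t) ;
  as_orthant : forall t w, 0 <= t -> orthant (S t w) ;
  as_start : {ae P, forall w, S 0 w = 0} ;
  as_increasing : {ae P, forall w, forall t1 t2 : R,
    0 <= t1 -> t1 <= t2 -> lev (S t1 w) (S t2 w)} ;
  as_independent : forall (n : nat) (t : nat -> R) (B : nat -> set 'rV[R]_k),
    0 <= t 0%N -> (forall i, t i <= t i.+1) ->
    (forall i, measurable (B i)) ->
    P (\bigcap_(i in [set i | (i < n)%N])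
        (increment S (t i) (t i.+1) @^-1` B i)) =
    (\prod_(i < n) P (increment S (t i) (t i.+1) @^-1` B i))%E ;
  as_continuous : forall t e : R, 0 <= t -> 0 < e ->
    P [set w | e < norm2 (increment S t u w)]
      @[u --> within [set u | 0 <= u] (nbhs t)] --> 0%E }.

Definition levy_measure (nu : {measure set 'rV[R]_k -> \bar R}) : Prop :=
  nu (~` (orthant `\ 0)) = 0%E /\
  (\int[nu]_s (Num.min (norm2 s) 1)%:E < +oo)%E.

Definition levy_finite (nu : {measure set 'rV[R]_k -> \bar R})
    (A : set 'rV[R]_k) : \bar R :=
  \int[nu]_(s in A) (Num.min (norm2 s) 1)%:E.

Definition weak_cvg {I : Type} (F : set_system I)
    (m : I -> set 'rV[R]_k -> \bar R) (m0 : set 'rV[R]_k -> \bar R) : Prop :=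
  forall g : 'rV[R]_k -> R, continuous g ->
    (exists M : R, forall s, `|g s| <= M) ->
    (\int[m i]_s (g s)%:E)%E @[i --> F] --> (\int[m0]_s (g s)%:E)%E.

Record regular_characteristics (c : R -> 'rV[R]_k)
    (nu : R -> {measure set 'rV[R]_k -> \bar R}) : Prop := {
  rc_drift : forall t, 0 <= t -> orthant (c t) ;
  rc_levy : forall t, 0 <= t -> levy_measure (nu t) ;
  rc_drift_right_lim : forall j (t : R), 0 <= t ->
    cvg (c u ord0 j @[u --> t^'+]) ;
  rc_drift_left_lim : forall j (t : R), 0 < t ->
    cvg (c u ord0 j @[u --> t^'-]) ;
  rc_levy_right_lim : forall t : R, 0 <= t ->
    exists m : {finite_measure set 'rV[R]_k -> \bar R},
      weak_cvg t^'+ (fun u => levy_finite (nu u)) m ;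
  rc_levy_left_lim : forall t : R, 0 < t ->
    exists m : {finite_measure set 'rV[R]_k -> \bar R},
      weak_cvg t^'- (fun u => levy_finite (nu u)) m ;
  rc_drift_right_cts : forall j (t : R), 0 <= t ->
    c u ord0 j @[u --> t^'+] --> c t ord0 j ;
  rc_levy_right_cts : forall t : R, 0 <= t ->
    weak_cvg t^'+ (fun u => levy_finite (nu u)) (levy_finite (nu t)) ;
  rc_discontinuities : exists D : seq R, forall t : R, 0 <= t -> t \notin D ->
    (forall j, c u ord0 j @[u --> within [set u | 0 <= u] (nbhs t)]
                 --> c t ord0 j) /\
    weak_cvg (within [set u | 0 <= u] (nbhs t))
      (fun u => levy_finite (nu u)) (levy_finite (nu t)) }.

Definition levy_exponent (c : 'rV[R]_k)
    (nu : {measure set 'rV[R]_k -> \bar R}) (xi : 'rV[R]_k) : R[i] :=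
  (0 +i* dotp c xi) +
  cintegral nu (orthant `\ 0) (fun s => expi (dotp s xi) - 1).

Definition char_fun (P : probability Omega R) (Z : Omega -> 'rV[R]_k)
    (xi : 'rV[R]_k) : R[i] :=
  cintegral P setT (fun w => expi (dotp xi (Z w))).

(* Two ways in which [c] and [nu] determine the law of [S t]. In the first,
   [levy_exponent (c t) (nu t)] is the exponent at time [t] itself. In the
   second it is the density in time of that exponent; this is what makes [c t]
   and [nu t] appear undifferentiated in [subordinate_generator], whereas in the
   first the generator is that of the right derivatives of [c] and [nu]. *)
Definition pointwise_characteristics (P : probability Omega R)
    (S : R -> Omega -> 'rV[R]_k) (c : R -> 'rV[R]_k)
    (nu : R -> {measure set 'rV[R]_k -> \bar R}) : Prop :=
  forall t xi, 0 <= t ->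
    char_fun P (S t) xi = cexp (levy_exponent (c t) (nu t) xi).

Definition differential_characteristics (P : probability Omega R)
    (S : R -> Omega -> 'rV[R]_k) (c : R -> 'rV[R]_k)
    (nu : R -> {measure set 'rV[R]_k -> \bar R}) : Prop :=
  forall t xi, 0 <= t ->
    char_fun P (S t) xi =
    cexp (cintegral (@lebesgue_measure R) `[0, t]
            (fun u => levy_exponent (c u) (nu u) xi)).

Definition increment_law (P : probability Omega R)
    (S : R -> Omega -> 'rV[R]_k) (t1 t2 : R)
    (m : probability 'rV[R]_k R) : Prop :=
  forall B, measurable B -> P (increment S t1 t2 @^-1` B) = m B.

Definition evolution (T : 'rV[R]_k -> ('rV[R]_d -> R) -> 'rV[R]_d -> R)
    (pi12 : R -> R -> probability 'rV[R]_k R) (t1 t2 : R)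
    (f : 'rV[R]_d -> R) (x : 'rV[R]_d) : R :=
  \int[pi12 t1 t2]_(s in orthant) T s f x.

Definition subordinate (X : 'rV[R]_k -> Omega -> 'rV[R]_d)
    (S : R -> Omega -> 'rV[R]_k) (t : R) (w : Omega) : 'rV[R]_d :=
  X (S t w) w.

Definition mixed_transition (P : 'rV[R]_d -> probability Omega R)
    (X : 'rV[R]_k -> Omega -> 'rV[R]_d)
    (pi12 : R -> R -> probability 'rV[R]_k R)
    (p : R -> R -> 'rV[R]_d -> probability 'rV[R]_d R) : Prop :=
  forall t1 t2 x A, 0 <= t1 -> t1 <= t2 -> measurable A ->
    (p t1 t2 x A = \int[pi12 t1 t2]_(s in orthant) P x (X s @^-1` A))%E.

Record inhomogeneous_markov (P : 'rV[R]_d -> probability Omega R)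
    (Y : R -> Omega -> 'rV[R]_d)
    (p : R -> R -> 'rV[R]_d -> probability 'rV[R]_d R) : Prop := {
  im_measurable : forall t, 0 <= t -> measurable_fun setT (Y t) ;
  im_markov : forall x t1 t2 f, 0 <= t1 -> t1 <= t2 -> bounded_borel f ->
    is_cond_exp (P x) (sigma_process `[0, t1] Y) (fun w => f (Y t2 w))
      (fun w => \int[p t1 t2 (Y t1 w)]_y f y) }.

Definition right_quotient (U : R -> R -> ('rV[R]_d -> R) -> 'rV[R]_d -> R)
    (t : R) (f : 'rV[R]_d -> R) (h : R) (x : 'rV[R]_d) : R :=
  h^-1 * (U t (t + h) f x - f x).

Definition right_generator (U : R -> R -> ('rV[R]_d -> R) -> 'rV[R]_d -> R)
    (t : R) (f : 'rV[R]_d -> R) (x : 'rV[R]_d) : R :=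
  lim (right_quotient U t f h x @[h --> 0^'+]).

Definition subordinate_generator
    (T : 'rV[R]_k -> ('rV[R]_d -> R) -> 'rV[R]_d -> R)
    (c : 'rV[R]_k) (nu : {measure set 'rV[R]_k -> \bar R})
    (f : 'rV[R]_d -> R) (x : 'rV[R]_d) : R :=
  \sum_(j < k) c ord0 j * generator T j f x +
  \int[nu]_(s in orthant `\ 0) (T s f x - f x).

(* E[exp(i xi.(Y t2 - Y t1)) | Y t1 = x], the conditional law of [Y t2] given
   [Y t1 = x] being the transition probability [p t1 t2 x]. *)
Definition cond_char_fun (p : R -> R -> 'rV[R]_d -> probability 'rV[R]_d R)
    (t1 t2 : R) (x xi : 'rV[R]_d) : R[i] :=
  cintegral (p t1 t2 x) setT (fun y => expi (dotp xi (y - x))).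

(* [R[i]^o] carries the normed topology of the complex plane. *)
Definition symbol_quotient (p : R -> R -> 'rV[R]_d -> probability 'rV[R]_d R)
    (t : R) (x xi : 'rV[R]_d) (h : R) : R[i]^o :=
  (h^-1)%:C * (cond_char_fun p t (t + h) x xi - 1).

Definition symbol (p : R -> R -> 'rV[R]_d -> probability 'rV[R]_d R)
    (t : R) (x xi : 'rV[R]_d) : R[i]^o :=
  - lim (symbol_quotient p t x xi h @[h --> 0^'+]).

End additive_subordination.

(* Main.v *)
Require Import Defs.
From HB Require Import structures.
From mathcomp Require Import all_boot all_order all_algebra.
From mathcomp Require Import all_classical all_reals all_analysis.
From mathcomp Require Import measurable_realfun complex ring lra.
Set Implicit Arguments.
Unset Strict Implicit.
Unset Printing Implicit Defensive.
Import Order.TTheory GRing.Theory Num.Theory numFieldNormedType.Exports.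
Local Open Scope classical_set_scope.
Local Open Scope ring_scope.
Local Open Scope complex_scope.

(* Strong continuity on all bounded Borel functions is much more than on
   continuous ones. If [P x (X s <> x)] did not tend to 0 uniformly in [x] as
   [s] tends to 0, a gliding hump argument along a sequence of bad points would
   produce a Borel set whose indicator violates strong continuity. Hence [T] is
   norm continuous, every bounded Borel function lies in all the domains
   [gen_domain T j], and the generator [G] of [Y] acts on the functions
   [e_xi : y |-> exp (i xi.(y - x))], so that [symbol p t x xi = - G e_xi x].
   - Continuity: [f |-> G f x] is continuous along bounded pointwise convergent
     sequences.
   - Negative definiteness: [G 1 = 0], and [G f x >= 0] whenever [f >= 0] and
     [f x = 0]; apply this to [f y = |\sum_l v_l (e_(xi_l) y - 1)| ^ 2].
   - Fourier representation: insert the inversion formula for [f] in the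
     difference quotients and pass to the limit, which is dominated because the
     quotients of the [e_xi] at [x] are bounded by those of the indicator of
     [{x}].
   The inversion formula is proved with the Green function of
   [\prod_i (1 - d_i ^ 2)] in place of a Gaussian. *)

(** * Dominated real integrals and Fubini's theorem *)

(** The obstacle is that [Y_generator] speaks only of functions in every [gen_domain T j], and for a
    general Markov semigroup the oscillating e_xi need not lie there. What removes it is that
    [T s f x - f x] only sees the paths that have left [x], so one number, the mass off [{x}],
    controls all [f] with a given bound at once. This is quantified as
    [|T s f x - f x| <= C M min(|s|, 1)]: along an axis it gives the difference quotients an
    explicit rate, and in all coordinates together it is exactly what a Lévy measure integrates. For
    the inversion formula, Fubini cannot be applied to exp (i xi.(y - x)) f x, which is not
    integrable in x and xi jointly. Writing [f] as the Green function applied to u = \prod_i (1 -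
    d_i ^ 2) f puts the integrable weight \prod_i 1 / (1 + xi_i ^ 2) under the integral. The kernel
    and the weight are products of functions of one variable and essentially Fourier transforms of
    each other, which suits a Lebesgue measure built by iterated products. *)

Section real_integrals.
Context {R : realType} {d : measure_display} {T : measurableType d}.
Implicit Types (mu : {measure set T -> \bar R}) (D : set T) (f g : T -> R).

Lemma integrable_dom mu D f g : measurable D -> measurable_fun D f ->
  mu.-integrable D (EFin \o g) -> (forall x, D x -> `|f x| <= g x) ->
  mu.-integrable D (EFin \o f).
Proof.
move=> mD mf ig fg; apply: (le_integrable mD _ _ ig) => /=.
  exact/measurable_EFinP.
by move=> x Dx /=; rewrite lee_fin (le_trans (fg _ Dx))// ler_norm.
Qed.

Lemma le_normr_Rintegral_dom mu D f g : measurable D -> measurable_fun D f ->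
  mu.-integrable D (EFin \o g) -> (forall x, D x -> `|f x| <= g x) ->
  `|\int[mu]_(x in D) f x| <= \int[mu]_(x in D) g x.
Proof.
move=> mD mf ig fg; have jf := integrable_dom mD mf ig fg.
apply: (le_trans (le_normr_Rintegral mD jf)).
by apply: le_Rintegral => //; exact: integrable_norm.
Qed.

Lemma Rdominated_cvg mu D (f_ : nat -> T -> R) f g : measurable D ->
  (forall n, measurable_fun D (f_ n)) ->
  (forall x, D x -> f_ n x @[n --> \oo] --> f x) ->
  mu.-integrable D (EFin \o g) ->
  (forall n x, D x -> `|f_ n x| <= g x) ->
  \int[mu]_(x in D) f_ n x @[n --> \oo] --> \int[mu]_(x in D) f x.
Proof.
move=> mD mf_ cf ig fg.
have mf : measurable_fun D f by apply: measurable_fun_cvg cf.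
have if_ n : mu.-integrable D (EFin \o f_ n) by apply: integrable_dom ig (fg n).
have mE n : measurable_fun D (EFin \o f_ n) by exact/measurable_EFinP.
have mF : measurable_fun D (EFin \o f) by exact/measurable_EFinP.
have cE : {ae mu, forall x, D x -> (EFin \o f_ n) x @[n --> \oo] --> (EFin \o f) x}.
  by apply: aeW => x Dx; apply: cvg_EFin; [exact: nearW|exact: cf].
have bE : {ae mu, forall x n, D x -> (`|(EFin \o f_ n) x| <= (EFin \o g) x)%E}.
  by apply: aeW => x n Dx; rewrite lee_fin; exact: fg.
have [iF _ cF] := dominated_convergence mD mE mF cE ig bE.
by apply/fine_cvg; rewrite fineK//; exact: integrable_fin_num.
Qed.

Lemma Rintegral_cst_probability (Q : probability T R) (r : R) :
  \int[Q]_x r = r.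
Proof.
have := @Rintegral_cst _ _ _ Q setT measurableT r.
by rewrite [X in fine X](_ : _ = 1%E) ?mulr1//; exact: probability_setT.
Qed.

End real_integrals.

Section product_integrability.
Context {R : realType} {d1 d2 : measure_display}.
Context {T1 : measurableType d1} {T2 : measurableType d2}.
Context (m1 : {sigma_finite_measure set T1 -> \bar R}).
Context (m2 : {sigma_finite_measure set T2 -> \bar R}).
Implicit Type f : T1 * T2 -> R.

Lemma integrable_prod_section f (h : T2 -> R) :
  measurable_fun setT f ->
  (forall y, (\int[m1]_x `|f (x, y)|%:E <= (h y)%:E)%E) ->
  m2.-integrable setT (EFin \o h) ->
  (m1 \x m2)%E.-integrable setT (EFin \o f).
Proof.
move=> mf fh ih; apply/integrable21ltyP; first exact/measurable_EFinP.
apply: le_lt_trans (integrable_lty measurableT ih).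
apply: ge0_le_integral => //=.
- by move=> y _; exact: integral_ge0.
- apply: (@measurable_fun_fubini_tonelli_G _ _ _ _ _ m1 (fun z => `|f z|%:E)).
    by apply/measurable_EFinP; exact: measurableT_comp.
  by [].
- exact: measurable_int ih.
Qed.

Lemma integrable_prod_dom f (g1 : T1 -> R) (g2 : T2 -> R) :
  measurable_fun setT f -> m1.-integrable setT (EFin \o g1) ->
  m2.-integrable setT (EFin \o g2) ->
  (forall x, 0 <= g1 x) ->
  (forall x y, `|f (x, y)| <= g1 x * g2 y) ->
  (m1 \x m2)%E.-integrable setT (EFin \o f).
Proof.
move=> mf i1 i2 g10 fg.
apply: (@integrable_prod_section f (fun y => (\int[m1]_x g1 x) * g2 y)) => //.
- move=> y; have h : m1.-integrable setT (EFin \o (fun x => g1 x * g2 y)).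
    have := integrableZl measurableT (g2 y) i1.
    by apply: eq_integrable => // x _ /=; rewrite mulrC.
  rewrite -RintegralZr// fineK; last exact: integrable_fin_num.
  apply: ge0_le_integral => //=.
  + by apply/measurable_EFinP; do 2 apply: measurableT_comp => //.
  + exact: measurable_int h.
  + by move=> x _; rewrite lee_fin.
- have := integrableZl measurableT (\int[m1]_x g1 x) i2.
  by apply: eq_integrable => // y _.
Qed.

(** The real integral is [fine] of the extended one, hence 0 where a section has an infinite
    integral. Its absolute value never exceeds that of the extended integral, so integrability
    carries over. *)
Lemma integrable_Rfubini f : (m1 \x m2)%E.-integrable setT (EFin \o f) ->
  m1.-integrable setT (EFin \o (fun x => \int[m2]_y f (x, y))).
Proof.
move=> intf; have h := integrable_fubini_F intf.
have mF := measurable_int _ h.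
apply: (le_integrable measurableT _ _ h).
  apply/measurable_EFinP; apply: measurableT_comp => //; exact: mF.
move=> x _ /=; rewrite /Rintegral /fubini_F /=.
by case: (\int[m2]_y _)%E => //= *; rewrite ?lee_fin// leey.
Qed.

(** The real and the extended section integrals differ only where the latter is infinite, which
    happens on a null set of [x]. *)
Lemma Rintegral12_prod f : (m1 \x m2)%E.-integrable setT (EFin \o f) ->
  \int[m1]_x \int[m2]_y f (x, y) = \int[(m1 \x m2)%E]_z f z.
Proof.
move=> intf; rewrite /Rintegral -integral12_prod_meas1//; congr fine.
apply: ae_eq_integral => //.
- exact: measurable_int (integrable_Rfubini intf).
- exact: measurable_int (integrable_fubini_F intf).
have := integrable_ae measurableT (integrable_fubini_F intf).
by apply: filterS => x /(_ I) h _; rewrite /= fineK.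
Qed.

End product_integrability.

Section real_fubini.
Context {R : realType} {d1 d2 : measure_display}.
Context {T1 : measurableType d1} {T2 : measurableType d2}.
Context (m1 : {sigma_finite_measure set T1 -> \bar R}).
Context (m2 : {sigma_finite_measure set T2 -> \bar R}).
Context (f : T1 * T2 -> R).
Hypothesis intf : (m1 \x m2)%E.-integrable setT (EFin \o f).

Let swapf (z : T2 * T1) := f (z.2, z.1).

Lemma integrable_swap : (m2 \x m1)%E.-integrable setT (EFin \o swapf).
Proof.
have mf : measurable_fun setT f by apply/measurable_EFinP; exact: measurable_int intf.
apply/integrable12ltyP.
  apply/measurable_EFinP; apply: measurableT_comp => //; exact: measurable_swap.
by apply/(integrable21ltyP m1 m2 (f := EFin \o f)) => //; exact/measurable_EFinP.
Qed.

Lemma RFubini :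
  \int[m1]_x \int[m2]_y f (x, y) = \int[m2]_y \int[m1]_x f (x, y).
Proof.
rewrite (Rintegral12_prod intf) (Rintegral12_prod integrable_swap).
rewrite /Rintegral; congr fine.
by rewrite -(integral21_prod_meas1 intf) -(integral12_prod_meas1 integrable_swap).
Qed.

End real_fubini.

Section borel_rV_facts.
Context {R : realType} {n : nat}.

Lemma open_measurable_rV (U : set 'rV[R]_n) : open U -> measurable U.
Proof. by move=> oU; exact: sub_sigma_algebra. Qed.

Lemma measurable_set1_rV (x : 'rV[R]_n) : measurable [set x].
Proof.
rewrite -[X in measurable X]setCK; apply: measurableC; apply: open_measurable_rV.
apply: closed_openC; apply: accessible_closed_set1.
by apply: hausdorff_accessible; exact: norm_hausdorff.
Qed.

Lemma continuous_measurable_rV (f : 'rV[R]_n -> R) :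
  continuous f -> measurable_fun setT f.
Proof.
move=> cf; apply: (measurability _ (RGenOInfty.measurableE R)).
move=> _ [_ [a ->] <-]; rewrite setTI; apply: open_measurable_rV.
by apply: open_comp; [move=> v _; exact: cf|exact: interval_open].
Qed.

Lemma bounded_borel_indic (A : set 'rV[R]_n) : measurable A ->
  bounded_borel (\1_A : 'rV[R]_n -> R).
Proof.
move=> mA; split; first exact: measurable_indic.
by exists 1 => x; rewrite indicE; case: (_ \in _); rewrite ?normr1 ?normr0.
Qed.

End borel_rV_facts.

(** * Functionals on bounded Borel functions *)

Section gliding_hump.
Context {R : realType} {disp : measure_display} {E : measurableType disp}.
Context (m : nat -> probability E R) (x : nat -> E).
Hypothesis measurable_pt : forall y : E, measurable [set y].
Hypothesis m_cvg : forall A, measurable A -> forall e : R, 0 < e ->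
  exists N, forall n, (N <= n)%N -> `|fine (m n A) - \1_A (x n)| <= e.

Let mu n A : R := fine (m n A).

Let mu_ge0 n A : 0 <= mu n A.
Proof. by rewrite fine_ge0. Qed.

Let mu_le n A B : measurable A -> measurable B -> A `<=` B -> mu n A <= mu n B.
Proof.
move=> mA mB AB; apply: fine_le; rewrite ?fin_num_measure//.
by apply: le_measure => //; rewrite inE.
Qed.

Let mu_leU n A B : measurable A -> measurable B ->
  mu n (A `|` B) <= mu n A + mu n B.
Proof.
move=> mA mB; rewrite -fineD ?fin_num_measure//; apply: fine_le.
- by rewrite fin_num_measure//; exact: measurableU.
- by rewrite fin_numD !fin_num_measure.
- exact: measureU2.
Qed.

Let head n := \bigcup_(i in [set i | (i <= n)%N]) [set x i].
Let tail n := \bigcup_(i in [set i | (n <= i)%N]) [set x i].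

Let mhead n : measurable (head n). Proof. exact: bigcup_measurable. Qed.
Let mtail n : measurable (tail n). Proof. exact: bigcup_measurable. Qed.

Context (e : R) (e_gt0 : 0 < e).
Hypothesis mu_pt : forall n, mu n [set x n] <= 1 - e.

(** Were [y] visited infinitely often, [m_cvg] on its singleton would give it mass at least
    [1 - e / 2], against [mu_pt]. So the points, even if some are repeated, escape from every finite
    set. *)
Let leaves_pt y : exists N, forall n, (N <= n)%N -> x n <> y.
Proof.
have [N HN] := m_cvg (measurable_pt y) (divr_gt0 e_gt0 (ltr0n R 2)).
exists N => n Nn xny; have := HN n Nn.
rewrite indicE mem_set//= -xny -/(mu _ _) => h.
have := mu_pt n; move: h; rewrite ler_norml => /andP[h1 _] h2.
by move: e_gt0 h1 h2; lra.
Qed.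

Let leaves_head k : exists N, forall n, (N <= n)%N -> ~ head k (x n).
Proof.
elim: k => [|k [N HN]].
  have [N HN] := leaves_pt (x 0); exists N => n Nn [i /=].
  by rewrite leqn0 => /eqP -> /= /(HN n Nn).
have [M HM] := leaves_pt (x k.+1); exists (maxn N M) => n.
rewrite geq_max => /andP[Nn Mn] [i /=].
rewrite leq_eqVlt => /predU1P[->|]; first by move=> /= /(HM _ Mn).
by rewrite ltnS => ik xni; apply: (HN _ Nn); exists i.
Qed.

Let mu_head k : exists N, forall n, (N <= n)%N -> mu n (head k) <= e / 4.
Proof.
have [N HN] := leaves_head k.
have [M HM] := m_cvg (mhead k) (divr_gt0 e_gt0 (ltr0n R 4)).
exists (maxn N M) => n; rewrite geq_max => /andP[Nn Mn].
have := HM n Mn; rewrite indicE memNset; last exact: HN.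
by move=> h; apply: le_trans h; rewrite subr0 ler_norm.
Qed.

(** Every point occurs finitely often, so the sets [tail k] decrease to the empty set, and the fixed
    measure [m n] is continuous from above. *)
Let mu_tail n : exists N, forall k, (N <= k)%N -> mu n (tail k) <= e / 4.
Proof.
have h : m n (tail k) @[k --> \oo] --> m n (\bigcap_k tail k).
  apply: nonincreasing_cvg_mu => //.
  - by rewrite -ge0_fin_numE// fin_num_measure.
  - exact: bigcap_measurable.
  - move=> i j ij; apply/subsetPset => y [l /= jl ->]; exists l => //=.
    exact: leq_trans jl.
have t0 : \bigcap_k tail k = set0.
  rewrite -subset0 => y h1; have [N HN] := leaves_pt y.
  by have [i /= Ni yi] := h1 N I; apply: (HN i Ni).
rewrite t0 measure0 in h.
have /cvgrPdist_le h1 : mu n (tail k) @[k --> \oo] --> (0 : R).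
  by apply: fine_cvg.
have [N _ HN] := h1 _ (divr_gt0 e_gt0 (ltr0n R 4)).
by exists N => k Nk; have := HN k Nk; rewrite sub0r normrN ger0_norm.
Qed.

Let next n : exists k, [/\ (n < k)%N, mu n (tail k) <= e / 4 &
  forall n', (k <= n')%N -> mu n' (head n) <= e / 4].
Proof.
have [N HN] := mu_head n; have [M HM] := mu_tail n.
exists (maxn n.+1 (maxn N M)); split.
- by rewrite leq_max leqnn.
- by apply: HM; rewrite !leq_max leqnn !orbT.
- by move=> n'; rewrite !geq_max => /and3P[_ /HN].
Qed.

(* A subsequence [a] is chosen so that [m (a i)] puts little mass on the other
   points [x (a j)]; the set of all [x (a j)] then contradicts [m_cvg]. *)
Lemma gliding_hump : False.
Proof.
pose g n := sval (cid (next n)).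
have gP n : [/\ (n < g n)%N, mu n (tail (g n)) <= e / 4 &
  forall n', (g n <= n')%N -> mu n' (head n) <= e / 4] := svalP (cid (next n)).
pose a i := iter i g 0%N.
have aS i : (a i < a i.+1)%N by have [] := gP (a i).
have ale i j : (i <= j)%N -> (a i <= a j)%N.
  move=> /subnK <-; elim: (j - i)%N => // l IH.
  by rewrite addSn (leq_trans IH)// ltnW.
have ige i : (i <= a i)%N by elim: i => // i IH; exact: leq_ltn_trans IH (aS i).
pose A := \bigcup_i [set x (a i)].
have mA : measurable A by exact: bigcup_measurable.
have [N HN] := m_cvg mA (divr_gt0 e_gt0 (ltr0n R 4)).
(* The index [a N.+1] is beyond [N] and has a predecessor [a N], so both bounds of [next] are
   available. [m_cvg] asks for mass at least [1 - e / 4] on [A], while the three pieces of [A] carry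
   at most [(1 - e) + e / 4 + e / 4]. *)
have := HN (a N.+1) (leq_trans (leqnSn _) (ige _)).
rewrite indicE mem_set/=; last by exists N.+1.
rewrite -/(mu _ _) => h.
have h1 : mu (a N.+1) A <=
    mu (a N.+1) [set x (a N.+1)] + mu (a N.+1) (head (a N))
    + mu (a N.+1) (tail (a N.+2)).
  apply: (le_trans (mu_le (B := ([set x (a N.+1)] `|` head (a N)) `|` tail (a N.+2)) _ _ _ _)).
  - exact: mA.
  - by apply: measurableU => //; exact: measurableU.
  - move=> y [i _ ->]; have [iN|iN|->] := ltngtP i N.+1.
    + by left; right; exists (a i) => //=; apply: ale.
    + by right; exists (a i) => //; exact: (ale N.+2).
    + by left; left.
  - apply: (le_trans (mu_leU _ _ _)) => //; first exact: measurableU.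
    by rewrite lerD2r mu_leU.
have [_ _ /(_ _ (leqnn _)) h2] := gP (a N).
have [_ h3 _] := gP (a N.+1).
have h4 := mu_pt (a N.+1).
move: h; rewrite ler_norml => /andP[h5 _].
have {}h2 : mu (a N.+1) (head (a N)) <= e / 4 := h2.
have {}h3 : mu (a N.+1) (tail (a N.+2)) <= e / 4 := h3.
by move: e_gt0 h1 h2 h3 h4 h5; lra.
Qed.

End gliding_hump.

(** Layer-cake count: it writes the integer part of a number in [0, N] as the sum of the indicators
    of its superlevel sets. *)
Lemma sum_ord_lt (N m : nat) : (\sum_(i < N) (i < m)%N = minn N m)%N.
Proof.
elim: N => [|N IH]; first by rewrite big_ord0 min0n.
rewrite big_ord_recr/= IH; have [Nm|mN] := ltnP N m.
  by rewrite addn1 (minn_idPl Nm).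
by rewrite addn0 (minn_idPr (leqW mN)).
Qed.

Section functionals_on_bounded_borel.
Context {R : realType} {n : nat}.
Context (L : ('rV[R]_n -> R) -> R) (K : R).
Hypothesis L_linear : forall (a : R) f g, bounded_borel f -> bounded_borel g ->
  L (fun x => a * f x + g x) = a * L f + L g.
Hypothesis L_bounded : forall f (M : R), bounded_borel f ->
  (forall x, `|f x| <= M) -> `|L f| <= K * M.
Hypothesis L_indic : forall A, measurable A -> L \1_A = 0.

Lemma bounded_borel_linear (a : R) (f g : 'rV[R]_n -> R) :
  bounded_borel f -> bounded_borel g -> bounded_borel (fun x => a * f x + g x).
Proof.
move=> [mf [M fM]] [mg [N gN]]; split.
  by apply: measurable_funD => //; exact: measurable_funM.
exists (`|a| * M + N) => x; rewrite (le_trans (ler_normD _ _))// lerD// normrM.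
by rewrite ler_wpM2l.
Qed.

(** Step functions on a grid of mesh [2 * M / N] approximate [f] uniformly; [L] kills each of them
    by linearity, and its bound [K] makes the error vanish as [N] grows. *)
Lemma bounded_borel_functional_eq0 f : bounded_borel f -> L f = 0.
Proof.
move=> bf; have [mf [M0 fM0]] := bf.
(* The extra 1 keeps [M] positive, so that it can be divided by even when [f] is 0. *)
pose M := `|M0| + 1; have M_gt0 : 0 < M by rewrite ltr_wpDl.
have fM x : `|f x| <= M by rewrite (le_trans (fM0 x))// (le_trans (ler_norm _))// lerDl.
have b0 : bounded_borel (fun _ : 'rV[R]_n => 0 : R) by split=> //; exists 0 => x; rewrite normr0.
have L0 : L (fun=> 0) = 0.
  have := L_bounded (M := 0) b0; rewrite mulr0 => h.
  by apply/eqP; rewrite -normr_le0 h// => x; rewrite normr0.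
have K0 : 0 <= K.
  have := L_bounded (M := 1) b0; rewrite mulr1 => h.
  by apply: le_trans (h _) => // x; rewrite normr0.
have sumP N (a : R) (A : nat -> set 'rV[R]_n) : (forall i, measurable (A i)) ->
    bounded_borel (fun x => \sum_(i < N) a * \1_(A i) x) /\
    L (fun x => \sum_(i < N) a * \1_(A i) x) = 0.
  move=> mA; elim: N => [|N [b1 l1]].
    by under eq_fun do rewrite big_ord0.
  have -> : (fun x => \sum_(i < N.+1) a * \1_(A i) x) =
      (fun x => a * \1_(A N) x + \sum_(i < N) a * \1_(A i) x).
    by apply/funext => x; rewrite big_ord_recr/= addrC.
  split; first by apply: bounded_borel_linear => //; exact: bounded_borel_indic.
  by rewrite L_linear ?l1 ?L_indic ?mulr0 ?addr0//; exact: bounded_borel_indic.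
have approx N : (0 < N)%N -> `|L f| <= K * (2 * M / N%:R).
  move=> N0; have NR : 0 < N%:R :> R by rewrite ltr0n.
  (* [v] maps the range [-M, M] of [f] affinely into [0, N]; the step function [s] below is [f] with
     [v] replaced by its integer part. *)
  pose v x := (f x + M) / (2 * M) * N%:R.
  have v0 x : 0 <= v x.
    rewrite mulr_ge0// divr_ge0//; last by rewrite mulr_ge0// ltW.
    by have := fM x; rewrite ler_norml => /andP[]; lra.
  have vN x : v x <= N%:R.
    rewrite ler_piMl// ler_pdivrMr ?mulr_gt0//.
    by have := fM x; rewrite ler_norml => /andP[]; lra.
  have mv : measurable_fun setT v.
    by apply: measurable_funM => //; apply: measurable_funM => //; exact: measurable_funD.
  pose A i := v @^-1` `[i.+1%:R, +oo[.
  have mA i : measurable (A i) by rewrite -[X in measurable X]setTI; exact: mv.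
  have [bs ls] := sumP N (2 * M / N%:R) A mA.
  pose s x := (- M) * \1_[set: 'rV[R]_n] x + \sum_(i < N) 2 * M / N%:R * \1_(A i) x.
  have bT := @bounded_borel_indic R n _ measurableT.
  have b_s : bounded_borel s by exact: bounded_borel_linear.
  have Ls : L s = 0 by rewrite /s L_linear// ls L_indic// mulr0 addr0.
  have sf x : `|f x - s x| <= 2 * M / N%:R.
    have -> : s x = 2 * M / N%:R * (Num.trunc (v x))%:R - M.
      rewrite /s indicE in_setT mulr1 addrC -mulr_sumr; congr (_ * _ - _).
      have -> : Num.trunc (v x) = minn N (Num.trunc (v x)).
        apply/esym/minn_idPr; rewrite -(ler_nat R).
        by rewrite (le_trans _ (vN x))// truncn_le.
      rewrite -sum_ord_lt natr_sum; apply: eq_bigr => i _.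
      rewrite indicE truncn_gt_nat; congr (_%:R); congr nat_of_bool.
      by apply/idP/idP; rewrite inE /A /= in_itv/= andbT.
    have -> : f x = 2 * M / N%:R * v x - M by rewrite /v; field; rewrite !gt_eqF.
    rewrite opprB addrA subrK -mulrBr normrM ger0_norm; last first.
      by rewrite divr_ge0// mulr_ge0// ltW.
    rewrite ler_piMr ?divr_ge0 ?mulr_ge0// ?ltW//.
    have /andP[h1 h2] := truncn_itv (v0 x).
    by rewrite -natr1 in h2; rewrite ger0_norm ?subr_ge0//; move: h1 h2; lra.
  have bfs : bounded_borel (fun x => f x - s x).
    have := bounded_borel_linear (-1) b_s bf; congr bounded_borel.
    by apply/funext => x; rewrite mulN1r addrC.
  have -> : L f = L (fun x => f x - s x).
    have := L_linear (-1) b_s bf; rewrite Ls mulr0 add0r => <-.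
    by congr L; apply/funext => x; rewrite mulN1r addrC.
  exact: L_bounded.
apply/eqP; rewrite -normr_le0; apply/ler_addgt0Pr => e e0; rewrite add0r.
pose N := (Num.trunc (K * (2 * M) / e)).+1.
have N0 : 0 < N%:R :> R by rewrite ltr0n.
apply: (le_trans (approx N _)) => //.
rewrite mulrA ler_pdivrMr// [e * _]mulrC -ler_pdivrMr// ltW//.
by have /andP[] := truncn_itv (divr_ge0 (mulr_ge0 K0 (mulr_ge0 (ler0n _ 2) (ltW M_gt0))) (ltW e0)).
Qed.

End functionals_on_bounded_borel.

(** * Strongly continuous Markov semigroups on bounded Borel functions *)

Section markov_semigroup.
Context {R : realType} {d k : nat} {disp : measure_display}.
Context {Omega : measurableType disp}.
Context (P : 'rV[R]_d -> probability Omega R).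
Context (F : 'rV[R]_k -> set (set Omega)).
Context (X : 'rV[R]_k -> Omega -> 'rV[R]_d).
Context (T : 'rV[R]_k -> ('rV[R]_d -> R) -> 'rV[R]_d -> R).
Hypothesis X_markov : homogeneous_markov P F X T.
Hypothesis T_C0 : C0_semigroup T.
Implicit Types (f g : 'rV[R]_d -> R) (s t : 'rV[R]_k) (x : 'rV[R]_d) (C M h : R).

Lemma levD s t : lev 0 s -> lev 0 t -> lev 0 (s + t).
Proof. by move=> h1 h2 i; move: (h1 i) (h2 i); rewrite !mxE => *; exact: addr_ge0. Qed.

Lemma markov_measurable s : lev 0 s -> measurable_fun setT (X s).
Proof.
move=> s0 _ B mB; rewrite setTI.
apply: (filtration_sub (hm_filtration X_markov) s0).
exact: (hm_adapted X_markov s0 mB).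
Qed.

Let integrable_T s f x : lev 0 s -> bounded_borel f ->
  (P x).-integrable setT (EFin \o (fun w => f (X s w))).
Proof.
move=> s0 [mf [M fM]].
apply: (integrable_dom (g := fun=> M)) => //.
- by apply: (measurableT_comp mf); exact: markov_measurable.
- exact: finite_measure_integrable_cst.
Qed.

Lemma semigroup_indic s A x : lev 0 s -> measurable A ->
  T s \1_A x = fine (P x (X s @^-1` A)).
Proof.
move=> s0 mA; rewrite (hm_semigroup X_markov)//; last exact: bounded_borel_indic.
rewrite /Rintegral; congr fine.
rewrite -[X in P x X]setIT -integral_indic//.
by rewrite -[X in measurable X]setTI; exact: (markov_measurable s0).
Qed.

Lemma semigroup_bound s f M x : lev 0 s -> bounded_borel f ->
  (forall y, `|f y| <= M) -> `|T s f x| <= M.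
Proof.
move=> s0 bf fM; rewrite (hm_semigroup X_markov)//.
apply: (le_trans (le_normr_Rintegral_dom (g := fun=> M) _ _ _ _)) => //.
- apply: (measurableT_comp bf.1); exact: markov_measurable.
- exact: finite_measure_integrable_cst.
- by rewrite Rintegral_cst_probability.
Qed.

Lemma semigroup_cvg (f_ : nat -> 'rV[R]_d -> R) f M s x : lev 0 s ->
  (forall n, measurable_fun setT (f_ n)) -> (forall n y, `|f_ n y| <= M) ->
  bounded_borel f -> (forall y, f_ n y @[n --> \oo] --> f y) ->
  T s (f_ n) x @[n --> \oo] --> T s f x.
Proof.
move=> s0 mf_ fM bf cf.
have bf_ n : bounded_borel (f_ n) by split => //; exists M.
rewrite (_ : (fun n => T s (f_ n) x) = fun n => \int[P x]_w f_ n (X s w)).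
  rewrite (hm_semigroup X_markov)//.
  apply: (Rdominated_cvg (g := fun=> M)) => //.
  - by move=> n; apply: (measurableT_comp (mf_ n)); exact: markov_measurable.
  - exact: finite_measure_integrable_cst.
by apply/funext => n; rewrite (hm_semigroup X_markov).
Qed.

(** The difference [f (X s w) - f x] vanishes on the event [X s w = x] and is at most [2 * M]
    elsewhere. As [f] enters through [M] only, any smallness of the escape probability is uniform in
    [f]. *)
Lemma semigroup_subid_bound s f M x : lev 0 s -> bounded_borel f ->
  (forall y, `|f y| <= M) ->
  `|T s f x - f x| <= 2 * M * (1 - fine (P x (X s @^-1` [set x]))).
Proof.
move=> s0 bf fM; rewrite (hm_semigroup X_markov)//.
have mX := markov_measurable s0.
have mA : measurable (X s @^-1` [set x]).
  by rewrite -[X in measurable X]setTI; apply: mX => //; exact: measurable_set1_rV.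
have -> : \int[P x]_w f (X s w) - f x = \int[P x]_w (f (X s w) - f x).
  rewrite RintegralB//; first by rewrite Rintegral_cst_probability.
  - exact: integrable_T.
  - exact: finite_measure_integrable_cst.
pose C := ~` (X s @^-1` [set x]).
have mC : measurable C by exact: measurableC.
have iC : (P x).-integrable setT (EFin \o (\1_C : Omega -> R)).
  by apply: integrable_indic => //; rewrite ltey_eq fin_num_measure.
apply: (le_trans (le_normr_Rintegral_dom (g := fun w => 2 * M * \1_C w) _ _ _ _)) => //.
- apply: measurable_funB => //; exact: (measurableT_comp bf.1).
- exact: integrableZl iC.
- move=> w _; rewrite indicE; have [wC|] := boolP (w \in C).
    rewrite mulr1 (le_trans (ler_normB _ _))// mulrDl mul1r lerD//.
  rewrite notin_setE => wC; have -> : X s w = x by apply: contrapT.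
  by rewrite subrr normr0 mulr0.
- rewrite RintegralZl//.
  have -> : \int[P x]_w \1_C w = fine (P x C).
    by rewrite /Rintegral integral_indic// setIT.
  by rewrite probability_setC// fineB//= fin_num_measure.
Qed.

(** Strong continuity on the indicator of one Borel set is uniform in the starting point, but not
    over the sets. Bad times [s n] tending to 0 and bad starting points [x n] would yield laws of
    [X (s n)] under [P (x n)] that satisfy the hypotheses of [gliding_hump]. *)
Lemma escape_small (e : R) : 0 < e ->
  \forall s \near within orthant (nbhs (0 : 'rV[R]_k)), forall x,
    1 - fine (P x (X s @^-1` [set x])) <= e.
Proof.
move=> e0; apply: contrapT => nn.
have H n : exists sx : 'rV[R]_k * 'rV[R]_d, [/\ lev 0 sx.1,
    ball (0 : 'rV[R]_k) n.+1%:R^-1 sx.1 &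
    fine (P sx.2 (X sx.1 @^-1` [set sx.2])) <= 1 - e].
  apply: contrapT => h; apply: nn; apply/nbhs_ballP; exists n.+1%:R^-1 => /=.
    by rewrite invr_gt0.
  move=> s bs os x; rewrite leNgt; apply/negP => es; apply: h.
  by exists (s, x); split => //=; move: es; lra.
pose s n := (sval (cid (H n))).1; pose x n := (sval (cid (H n))).2.
have sxP n : [/\ lev 0 (s n), ball (0 : 'rV[R]_k) n.+1%:R^-1 (s n) &
    fine (P (x n) (X (s n) @^-1` [set (x n)])) <= 1 - e] := svalP (cid (H n)).
have s0 n : lev 0 (s n) by have [] := sxP n.
pose Y n := mfun_Sub (mem_set (markov_measurable (s0 n))).
apply: (@gliding_hump _ _ _ (fun n => distribution (P (x n)) (Y n)) x _ _ e e0).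
- exact: measurable_set1_rV.
- move=> A mA e' e'0.
  have /nbhs_ballP[/= r r0 Hr] := C0_cvg T_C0 (bounded_borel_indic mA) e'0.
  have [N HN] := ltr_add_invr r0; rewrite add0r in HN.
  exists N => n Nn.
  have [_ bsn _] := sxP n.
  have := Hr (s n) _ (s0 n) (x n); rewrite semigroup_indic//; apply.
  apply: le_ball bsn; rewrite (le_trans _ (ltW HN))//.
  by rewrite lef_pV2 ?posrE// ler_nat.
- by move=> n; have [] := sxP n.
Qed.

Lemma subid_small (e : R) : 0 < e ->
  \forall s \near within orthant (nbhs (0 : 'rV[R]_k)), forall f M x,
    bounded_borel f -> (forall y, `|f y| <= M) -> `|T s f x - f x| <= e * M.
Proof.
(* Halved to absorb the factor 2 of [semigroup_subid_bound]. *)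
move=> e0; have e20 : 0 < e / 2 by rewrite divr_gt0.
have := escape_small e20; apply: filterS2; last exact: (@withinT _ _ orthant).
move=> s s0 Hs f M x bf fM.
have M0 : 0 <= M by exact: le_trans (normr_ge0 _) (fM x).
apply: (le_trans (semigroup_subid_bound x s0 bf fM)).
apply: (le_trans (ler_wpM2l _ (Hs x))); first by rewrite mulr_ge0.
by rewrite -mulrA [_ * (e / 2)]mulrC mulrA mulrCA divff// mulr1 mulrC.
Qed.

Lemma bounded_borelB f g : bounded_borel f -> bounded_borel g ->
  bounded_borel (fun x => f x - g x).
Proof.
move=> [mf [M fM]] [mg [N gN]]; split; first exact: measurable_funB.
by exists (M + N) => x; rewrite (le_trans (ler_normB _ _))// lerD.
Qed.

Lemma semigroupB s f g x : lev 0 s -> bounded_borel f -> bounded_borel g ->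
  T s (fun y => f y - g y) x = T s f x - T s g x.
Proof.
move=> s0 bf bg; have := C0_linear T_C0 (-1) s0 bg bf.
move=> /(congr1 (fun u => u x)); rewrite mulN1r addrC => <-.
by congr (T s _ x); apply/funext => y; rewrite mulN1r addrC.
Qed.

Lemma bounded_borel_subid s f : lev 0 s -> bounded_borel f ->
  bounded_borel (fun x => T s f x - f x).
Proof. by move=> s0 bf; apply: bounded_borelB => //; exact: (C0_bounded_borel T_C0). Qed.

(** * One-parameter semigroups along the axes and their generators *)

Section axis.
Context (j : 'I_k).

Let ax (h : R) : 'rV[R]_k := h *: delta_mx ord0 j.

Let ax_ge0 h : 0 <= h -> lev 0 (ax h).
Proof. by move=> h0 i; rewrite !mxE mulr_ge0. Qed.

Let axD h1 h2 : ax (h1 + h2) = ax h1 + ax h2.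
Proof. by rewrite /ax scalerDl. Qed.

Let ax0 : ax 0 = 0. Proof. by rewrite /ax scale0r. Qed.

Let axis_small (e : R) : 0 < e -> exists2 r : R, 0 < r &
  forall h f M x, 0 <= h -> h <= r -> bounded_borel f ->
    (forall y, `|f y| <= M) -> `|T (ax h) f x - f x| <= e * M.
Proof.
move=> e0; have /nbhs_ballP[/= r r0 Hr] := subid_small e0.
(* The ball is open while the conclusion allows [h] to reach the bound, hence the half. *)
exists (r / 2); first by rewrite divr_gt0.
move=> h f M x h0 hr bf fM; apply: Hr => //; last exact: ax_ge0.
split=> // i1 i2; rewrite /ball/= !mxE sub0r normrN normrM ger0_norm//.
apply: (@le_lt_trans _ _ h).
  by rewrite ler_piMr//; case: (_ && _); rewrite ?normr1 ?normr0.
by move: r0 hr; lra.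
Qed.

(** Telescoping, each step being [T (a + b) f - T a f = T a (T b f - f)]. *)
Let axis_iter n h f x : 0 <= h -> bounded_borel f ->
  T (ax (n%:R * h)) f x - f x =
  \sum_(i < n) T (ax (i%:R * h)) (fun y => T (ax h) f y - f y) x.
Proof.
move=> h0 bf; elim: n => [|n IH].
  by rewrite mul0r ax0 (C0_id T_C0)// subrr big_ord0.
have nh0 : 0 <= n%:R * h by rewrite mulr_ge0.
rewrite big_ord_recr/= -IH semigroupB//; last 2 first.
- by apply: ax_ge0.
- by apply: (C0_bounded_borel T_C0) => //; exact: ax_ge0.
rewrite -natr1 mulrDl mul1r axD (C0_comp T_C0)//; try exact: ax_ge0.
by rewrite addrC addrA subrK.
Qed.

(** Discrete form of the argument that a norm continuous semigroup has a bounded generator. Let [r]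
    be such that [T] is within 1/2 of the identity up to time [r], and [n] the integer part of
    [r / h]. For [u = T h f - f], telescoping gives [n u = (T (n h) f - f) - \sum_(i < n) (T (i h) u
    - u)], so the supremum [U] of [|u|] satisfies [n U <= M / 2 + n U / 2]. Hence [U <= M / n], and
    [r < (n + 1) h <= 2 n h] turns this into [2 h M / r]. *)
Lemma axis_subid_linear : exists2 C : R, 0 <= C &
  forall h f M x, 0 <= h -> bounded_borel f ->
    (forall y, `|f y| <= M) -> `|T (ax h) f x - f x| <= C * h * M.
Proof.
have h20 : 0 < 2^-1 :> R by rewrite invr_gt0.
have [r r0 Hr] := axis_small h20.
exists (2 / r); first by rewrite divr_ge0// ltW.
move=> h f M x h0 bf fM.
have M0 : 0 <= M by exact: le_trans (normr_ge0 _) (fM x).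
have u2M y : `|T (ax h) f y - f y| <= 2 * M.
  rewrite (le_trans (ler_normB _ _))// mulrDl mul1r lerD//.
  by apply: semigroup_bound => //; exact: ax_ge0.
(* For [h >= r] the trivial bound [2 * M] is already at most [2 / r * h * M]. *)
have [rh|hr] := leP r h.
  apply: (le_trans (u2M x)); rewrite ler_wpM2r// -[leLHS]mulr1 -mulrA ler_wpM2l//.
  by rewrite mulrC ler_pdivlMr// mul1r.
have [->|hn0] := eqVneq h 0.
  by rewrite ax0 (C0_id T_C0)// subrr normr0 mulr0 mul0r.
have hp : 0 < h by rewrite lt_def hn0.
pose u y := T (ax h) f y - f y.
have bu : bounded_borel u by apply: bounded_borel_subid => //; exact: ax_ge0.
pose n := Num.trunc (r / h).
have /andP[n1 n2] : n%:R <= r / h < n.+1%:R.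
  by apply: truncn_itv; rewrite divr_ge0// ltW.
rewrite ler_pdivlMr// in n1; rewrite ltr_pdivrMr// in n2.
have n0 : (0 < n)%N.
  rewrite lt0n; apply/negP => /eqP n0; move: n2; rewrite n0 mul1r.
  by rewrite ltNge (ltW hr).
have nR : 1 <= n%:R :> R by rewrite ler1n.
(* The least bound of [|u|] is required, because it appears on both sides and half of it is
   absorbed; the crude bound [2 * M] only shows that it is finite. *)
pose A : set R := [set `|u y| | y in setT].
have supA : has_sup A.
  split; first by exists `|u x|; exists x.
  by exists (2 * M) => _ [y _ <-]; exact: u2M.
pose U := sup A.
have uU y : `|u y| <= U by apply: sup_upper_bound => //; exists y.
have key y : n%:R * `|u y| <= 2^-1 * M + n%:R * (2^-1 * U).
  have -> : n%:R * `|u y| = `|(T (ax (n%:R * h)) f y - f y)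
      - \sum_(i < n) (T (ax (i%:R * h)) u y - u y)|.
    rewrite axis_iter// -sumrB/=.
    under eq_bigr do rewrite opprB addrC subrK.
    by rewrite sumr_const card_ord -(mulr_natl (u y)) normrM normr_nat.
  rewrite (le_trans (ler_normB _ _))// lerD//.
    by apply: Hr => //; rewrite mulr_ge0.
  apply: (le_trans (ler_norm_sum _ _ _)).
  apply: (@le_trans _ _ (\sum_(i < n) 2^-1 * U)); last first.
    by rewrite sumr_const card_ord -(mulr_natl (2^-1 * U)).
  apply: ler_sum => i _; apply: Hr => //; first by rewrite mulr_ge0.
  by apply: le_trans n1; rewrite ler_wpM2r// ler_nat ltnW.
have UM : n%:R * U <= M.
  have : U <= (2^-1 * M + n%:R * (2^-1 * U)) / n%:R.
    apply: ge_sup; first by case: supA.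
    by move=> _ [y _ <-]; rewrite ler_pdivlMr ?ltr0n// mulrC; exact: key.
  by rewrite ler_pdivlMr ?ltr0n//; lra.
apply: (le_trans (uU x)).
rewrite mulrAC mulrAC -mulrA mulrAC ler_pdivlMr//.
have U0 : 0 <= U by exact: le_trans (normr_ge0 _) (uU x).
have h1 : U * r <= U * (n.+1%:R * h) by rewrite ler_wpM2l// ltW.
apply: (le_trans h1).
have h2 : U * (n.+1%:R * h) <= 2 * (n%:R * U) * h.
  rewrite (_ : U * _ = n.+1%:R * U * h); last by rewrite mulrA [U * _]mulrC.
  by rewrite ler_wpM2r//; have := ler_wpM2r U0 nR; rewrite -natr1; lra.
by apply: (le_trans h2); rewrite -mulrA ler_wpM2l// mulrC ler_wpM2l.
Qed.

(** By [axis_iter] the difference is a sum of terms [T (i h) u - u] in which [u = T h f - f] is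
    itself of size [C h M]. The linear bound is thus used twice and the error is quadratic in
    [n h]. *)
Let axis_additive C n h f M x : 0 <= C ->
  (forall h f M x, 0 <= h -> bounded_borel f ->
    (forall y, `|f y| <= M) -> `|T (ax h) f x - f x| <= C * h * M) ->
  0 <= h -> bounded_borel f -> (forall y, `|f y| <= M) ->
  `|(T (ax (n%:R * h)) f x - f x) - n%:R * (T (ax h) f x - f x)|
    <= C ^+ 2 * (n%:R * h) ^+ 2 * M.
Proof.
move=> C0 HC h0 bf fM.
have M0 : 0 <= M by exact: le_trans (normr_ge0 _) (fM x).
pose u y := T (ax h) f y - f y.
have bu : bounded_borel u by apply: bounded_borel_subid => //; exact: ax_ge0.
rewrite axis_iter// mulr_natl -[X in _ *+ X]card_ord -sumr_const -sumrB.
apply: (le_trans (ler_norm_sum _ _ _)).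
apply: (@le_trans _ _ (\sum_(i < n) C ^+ 2 * n%:R * h ^+ 2 * M)).
  apply: ler_sum => i _.
  apply: (@le_trans _ _ (C * (i%:R * h) * (C * h * M))).
    apply: (HC (i%:R * h) u) => //; first by rewrite mulr_ge0.
    by move=> y; exact: HC.
  have -> : C * (i%:R * h) * (C * h * M) = C ^+ 2 * i%:R * h ^+ 2 * M by ring.
  rewrite ler_wpM2r// ler_wpM2r ?sqr_ge0// ler_wpM2l ?sqr_ge0//.
  by rewrite ler_nat ltnW.
rewrite sumr_const card_ord -(mulr_natl (_ * M)).
by rewrite le_eqVlt; apply/predU1P; left; ring.
Qed.

(** Meant for [h] much smaller than [h1]. In [h1 = n h + r] with [0 <= r <= h], the multiple [n h]
    costs the quadratic error of [axis_additive] and the remainder [r] costs twice [C h M], which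
    vanishes with [h]. *)
Let axis_quotient_step C h1 h f M x : 0 <= C ->
  (forall h f M x, 0 <= h -> bounded_borel f ->
    (forall y, `|f y| <= M) -> `|T (ax h) f x - f x| <= C * h * M) ->
  0 < h -> 0 < h1 -> bounded_borel f -> (forall y, `|f y| <= M) ->
  `|h1 * (gen_quotient T j f h1 x - gen_quotient T j f h x)|
    <= 2 * C * h * M + C ^+ 2 * h1 ^+ 2 * M.
Proof.
move=> C0 HC h0 h10 bf fM.
have M0 : 0 <= M by exact: le_trans (normr_ge0 _) (fM x).
pose n := Num.trunc (h1 / h).
have /andP[n1 n2] : n%:R <= h1 / h < n.+1%:R.
  by apply: truncn_itv; rewrite divr_ge0// ltW.
rewrite ler_pdivlMr// in n1; rewrite ltr_pdivrMr// in n2.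
have nh0 : 0 <= n%:R * h by rewrite mulr_ge0// ltW.
pose r := h1 - n%:R * h.
have r0 : 0 <= r by rewrite subr_ge0.
have rh : r <= h by rewrite /r lerBlDl -natr1 mulrDl mul1r in n2 *; exact: ltW.
pose D h y := T (ax h) f y - f y.
have bT s : lev 0 s -> bounded_borel (T s f).
    by move=> s0; exact: (C0_bounded_borel T_C0 s0 bf).
have D1 : D h1 x = T (ax (n%:R * h)) (D r) x + D (n%:R * h) x.
  rewrite /D semigroupB//; last 2 first.
  - exact: ax_ge0.
  - by apply: bT; exact: ax_ge0.
  have -> : T (ax h1) f = T (ax (n%:R * h)) (T (ax r) f).
    by rewrite -(C0_comp T_C0 (ax_ge0 nh0) (ax_ge0 r0) bf) -axD /r addrC subrK.
  by rewrite addrA subrK.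
have E : h1 * (gen_quotient T j f h1 x - gen_quotient T j f h x) =
    T (ax (n%:R * h)) (D r) x + (D (n%:R * h) x - n%:R * D h x)
    - r / h * D h x.
  rewrite /gen_quotient -/(ax _) -/(ax _) -/(D h1 x) -/(D h x).
  rewrite mulrBr mulrA divff ?gt_eqF// mul1r D1 /r.
  by field; rewrite gt_eqF.
rewrite E (le_trans (ler_normB _ _))//.
have Dh (t : R) y : 0 <= t -> `|D t y| <= C * t * M by move=> t0; exact: HC.
have bD (t : R) : 0 <= t -> bounded_borel (D t).
  by move=> t0; apply: bounded_borel_subid => //; exact: ax_ge0.
have e1 : `|T (ax (n%:R * h)) (D r) x| <= C * h * M.
  apply: semigroup_bound; [exact: ax_ge0|exact: bD|].
  move=> y; apply: (le_trans (Dh r y r0)).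
  by rewrite ler_wpM2r// ler_wpM2l.
have e2 : `|D (n%:R * h) x - n%:R * D h x| <= C ^+ 2 * h1 ^+ 2 * M.
  apply: (le_trans (axis_additive n x C0 HC (ltW h0) bf fM)).
  by rewrite ler_wpM2r// ler_wpM2l ?sqr_ge0// ler_sqr ?nnegrE// ltW.
have e3 : `|r / h * D h x| <= C * h * M.
  rewrite normrM -[leRHS]mul1r ler_pM//; last exact: Dh (ltW h0).
  by rewrite ger0_norm ?divr_ge0 ?(ltW h0)// ler_pdivrMr// mul1r.
have e4 := ler_normD (T (ax (n%:R * h)) (D r) x) (D (n%:R * h) x - n%:R * D h x).
by move: e1 e2 e3 e4; lra.
Qed.

(** Both quotients are compared with the one at a third, tiny step [e / K]. The constant [K] is such
    that all terms proportional to that step add up to at most [e], which is arbitrary. *)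
Let axis_quotient_cauchy C h1 h2 f M x : 0 <= C ->
  (forall h f M x, 0 <= h -> bounded_borel f ->
    (forall y, `|f y| <= M) -> `|T (ax h) f x - f x| <= C * h * M) ->
  0 < h1 -> 0 < h2 -> bounded_borel f -> (forall y, `|f y| <= M) ->
  `|gen_quotient T j f h1 x - gen_quotient T j f h2 x|
    <= C ^+ 2 * M * (h1 + h2).
Proof.
move=> C0 HC h10 h20 bf fM.
have M0 : 0 <= M by exact: le_trans (normr_ge0 _) (fM x).
pose q h := gen_quotient T j f h x.
have step h' h : 0 < h' -> 0 < h ->
    `|q h' - q h| <= 2 * C * M / h' * h + C ^+ 2 * M * h'.
  move=> h'0 h0; have := axis_quotient_step x C0 HC h0 h'0 bf fM.
  rewrite normrM gtr0_norm// mulrC -ler_pdivlMr//.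
  by move=> /le_trans; apply; rewrite le_eqVlt; apply/predU1P; left; field; rewrite gt_eqF.
pose K := 2 * C * M / h1 + 2 * C * M / h2 + 1.
have K0 : 0 < K by rewrite ltr_wpDl// addr_ge0// divr_ge0 ?mulr_ge0// ltW.
apply/ler_addgt0Pr => e e0.
have eK : 0 < e / K by rewrite divr_gt0.
have s1 := step h1 _ h10 eK; have s2 := step h2 _ h20 eK.
have := ler_distD (q (e / K)) (q h1) (q h2); rewrite -/(q h1) -/(q h2).
rewrite [`|q (e / K) - _|]distrC => s3; apply: (le_trans s3).
have s4 : (2 * C * M / h1 + 2 * C * M / h2) * (e / K) <= e.
  rewrite mulrA ler_pdivrMr// mulrC ler_wpM2l// ?ltW// /K.
  by rewrite ltrDl.
apply: (le_trans (lerD s1 s2)).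
by move: s4; rewrite mulrDl mulrDr; lra.
Qed.

(** The Cauchy estimate gives the limit, and letting one of its two steps tend to 0 gives the rate.
    The constant depends neither on [f] nor on [x], which is what [bounded_borel_gen_domain] and
    [generator_sigma_cvg] rely on. *)
Lemma gen_quotient_cvg : exists2 C : R, 0 <= C & forall f M x h, 0 < h ->
  bounded_borel f -> (forall y, `|f y| <= M) ->
  gen_quotient T j f h x @[h --> 0^'+] --> generator T j f x /\
  `|gen_quotient T j f h x - generator T j f x| <= C * M * h.
Proof.
have [C C0 HC] := axis_subid_linear.
exists (C ^+ 2); first exact: sqr_ge0.
move=> f M x h h0 bf fM.
have M0 : 0 <= M by exact: le_trans (normr_ge0 _) (fM x).
pose q h := gen_quotient T j f h x.
have qq h1 h2 : 0 < h1 -> 0 < h2 -> `|q h1 - q h2| <= C ^+ 2 * M * (h1 + h2).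
  by move=> *; exact: axis_quotient_cauchy.
have K0 : 0 <= C ^+ 2 * M by rewrite mulr_ge0// sqr_ge0.
have cq : cvg (q h @[h --> 0^'+]).
  apply/cauchy_cvgP/cauchy_exP => e e0.
  have Kp : 0 < C ^+ 2 * M + 1 by rewrite ltr_wpDl.
  pose h1 := e / 2 / (C ^+ 2 * M + 1).
  have h10 : 0 < h1 by rewrite !divr_gt0.
  exists (q h1); 
  have : \forall h \near (0 : R)^'+, 0 < h < h1.
    near=> h'; apply/andP; split; near: h'; [exact: nbhs_right_gt|exact: nbhs_right_lt].
  apply: filterS => h' /andP[h'0 h'1]; rewrite /ball/=.
  apply: (le_lt_trans (qq _ _ h10 h'0)).
  apply: (@le_lt_trans _ _ (C ^+ 2 * M * (h1 + h1))).
    by rewrite ler_wpM2l// lerD2l ltW.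
  have : (C ^+ 2 * M + 1) * (h1 + h1) = e.
    by rewrite /h1; field; rewrite gt_eqF.
  by rewrite mulrDl mul1r; move: h10; lra.
split; first exact: cq.
have l1 : `|q h - q h'| @[h' --> 0^'+] --> `|q h - generator T j f x|.
  by apply: cvg_norm; apply: cvgB; [exact: cvg_cst|exact: cq].
have l2 : C ^+ 2 * M * (h + h') @[h' --> 0^'+] --> C ^+ 2 * M * (h + 0).
  apply: cvgMr; apply: cvgD; first exact: cvg_cst.
  exact: cvg_at_right_filter cvg_id.
have := ler_lim (cvgP _ l1) (cvgP _ l2).
rewrite (cvg_lim _ l1)// (cvg_lim _ l2)// addr0; apply.
by near=> h'; apply: qq.
Unshelve. all: by end_near. Qed.

Lemma bounded_borel_generator f : bounded_borel f -> bounded_borel (generator T j f).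
Proof.
move=> bf; have [mf [M fM]] := bf; have [C C0 HC] := gen_quotient_cvg.
split.
- apply: (measurable_fun_cvg (h := fun n => gen_quotient T j f n.+1%:R^-1)).
    move=> n; apply: measurable_funM => //; apply: measurable_funB => //.
    have s0 : lev 0 (ax n.+1%:R^-1) by apply: ax_ge0; rewrite invr_ge0.
    by have [] := C0_bounded_borel T_C0 s0 bf.
  move=> x _; have [cq _] := HC f M x 1 ltr01 bf fM.
  by have /cvg_at_rightP := cq; apply; split => //; exact: cvg_harmonic.
- exists (2 * M + C * M) => x; have [_ h1] := HC f M x 1 ltr01 bf fM.
  have h2 : `|gen_quotient T j f 1 x| <= 2 * M.
    rewrite /gen_quotient invr1 mul1r (le_trans (ler_normB _ _))//.
    by rewrite mulrDl mul1r lerD// semigroup_bound//; exact: ax_ge0.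
  have := ler_distD (gen_quotient T j f 1 x) (generator T j f x) 0.
  rewrite !subr0 => h3; apply: (le_trans h3); rewrite distrC addrC lerD//.
  by rewrite mulr1 in h1.
Qed.

Lemma bounded_borel_gen_domain f : bounded_borel f -> gen_domain T j f.
Proof.
move=> bf; split=> //; exists (generator T j f); first exact: bounded_borel_generator.
have [mf [M fM]] := bf; have [C C0 HC] := gen_quotient_cvg.
have M0 : 0 <= M by exact: le_trans (normr_ge0 _) (fM 0).
have CM : 0 < C * M + 1 by rewrite ltr_wpDl// mulr_ge0.
move=> e e0; near=> h => x.
have h0 : 0 < h by near: h; exact: nbhs_right_gt.
have [_ /le_trans] := HC f M x h h0 bf fM; apply.
apply: (@le_trans _ _ ((C * M + 1) * h)); first by rewrite ler_wpM2r ?ltW// ltrDl.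
rewrite mulrC -ler_pdivlMr//; near: h.
by apply: nbhs_right_le; rewrite divr_gt0.
Unshelve. all: by end_near. Qed.

(** Under a common bound [M], the quotient at a fixed [h] is within [C * M * h] of the generator for
    all the functions at once, and at fixed [h] dominated convergence under [P x] applies. Bounded
    pointwise convergence is the useful mode, because the characters do not depend on [xi]
    continuously in the sup norm. *)
Lemma generator_sigma_cvg (f_ : nat -> 'rV[R]_d -> R) f M x :
  (forall n, measurable_fun setT (f_ n)) -> (forall n y, `|f_ n y| <= M) ->
  bounded_borel f -> (forall y, `|f y| <= M) ->
  (forall y, f_ n y @[n --> \oo] --> f y) ->
  generator T j (f_ n) x @[n --> \oo] --> generator T j f x.
Proof.
move=> mf_ fM bf fM' cf; have [C C0 HC] := gen_quotient_cvg.
have bf_ n : bounded_borel (f_ n) by split => //; exists M.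
have M0 : 0 <= M by exact: le_trans (normr_ge0 _) (fM' x).
have CM : 0 < C * M + 1 by rewrite ltr_wpDl// mulr_ge0.
apply/cvgrPdist_le => e e0.
pose h := e / 3 / (C * M + 1).
have h0 : 0 < h by rewrite !divr_gt0.
have CMh : C * M * h <= e / 3.
  apply: (@le_trans _ _ ((C * M + 1) * h)); first by rewrite ler_wpM2r ?ltW// ltrDl.
  by rewrite /h mulrC divfK// gt_eqF.
have cq : gen_quotient T j (f_ n) h x @[n --> \oo] --> gen_quotient T j f h x.
  apply: cvgMr; apply: cvgB; last exact: cf.
  by apply: (semigroup_cvg (M := M)) => //; apply: ax_ge0; exact: ltW.
have e30 : 0 < e / 3 by rewrite divr_gt0.
move/cvgrPdist_le : cq => /(_ _ e30); apply: filterS => n.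
have [_ h1] := HC f M x h h0 bf fM'.
have [_ h2] := HC (f_ n) M x h h0 (bf_ n) (fM n).
have := ler_distD (gen_quotient T j f h x) (generator T j f x) (generator T j (f_ n) x).
have := ler_distD (gen_quotient T j (f_ n) h x) (gen_quotient T j f h x) (generator T j (f_ n) x).
by rewrite [`|generator T j f x - gen_quotient _ _ _ _ _|]distrC; lra.
Qed.

End axis.

(** The time [s] is reached one coordinate direction at a time. Each leg is charged to the bound of
    its axis, since [T t f] keeps the bound [M] of [f]. *)
Lemma semigroup_subid_l1 : exists2 C : R, 0 <= C & forall s f M x, lev 0 s ->
  bounded_borel f -> (forall y, `|f y| <= M) ->
  `|T s f x - f x| <= C * (\sum_j s ord0 j) * M.
Proof.
have H j := axis_subid_linear j.
pose C_ j := sval (cid2 (H j)).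
have C_ge0 j : 0 <= C_ j by rewrite /C_; case: cid2.
have CP j h f M x : 0 <= h -> bounded_borel f -> (forall y, `|f y| <= M) ->
    `|T (h *: delta_mx ord0 j) f x - f x| <= C_ j * h * M.
  by rewrite /C_; case: cid2 => /= c _; apply.
pose C := \sum_j C_ j.
have CC j : C_ j <= C by rewrite /C (bigD1 j)//= lerDl sumr_ge0.
exists C; first exact: sumr_ge0.
move=> s f M x s0 bf fM.
have sj j : 0 <= s ord0 j by have := s0 j; rewrite mxE.
have M0 : 0 <= M by exact: le_trans (normr_ge0 _) (fM x).
rewrite {1}(row_sum_delta s).
have ax0 j : lev 0 (s ord0 j *: delta_mx ord0 j).
  by move=> i; rewrite !mxE mulr_ge0.
have sum0 (r : seq 'I_k) : lev 0 (\sum_(j <- r) s ord0 j *: delta_mx ord0 j).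
  elim: r => [|j r IH]; first by rewrite big_nil.
  by rewrite big_cons; exact: levD.
elim: (index_enum _) => [|j r IH].
  by rewrite !big_nil (C0_id T_C0)// subrr normr0 mulr0 mul0r.
rewrite !big_cons (C0_comp T_C0)//; set t := \sum_(_ <- r) _.
have bt : bounded_borel (T t f) := C0_bounded_borel T_C0 (sum0 r) bf.
have := ler_distD (T t f x) (T (s ord0 j *: delta_mx ord0 j) (T t f) x) (f x).
move=> /le_trans; apply; rewrite mulrDr mulrDl lerD//.
apply: (le_trans (CP j (s ord0 j) (T t f) M x _ _ _)) => //.
  by move=> y; apply: semigroup_bound => //; exact: sum0.
by rewrite ler_wpM2r// ler_wpM2r.
Qed.

Lemma coord_le_norm2 s j : s ord0 j <= norm2 s.
Proof.
rewrite (le_trans (ler_norm _))// -sqrtr_sqr ler_wsqrtr// /dotp (bigD1 j)//=.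
by rewrite -expr2 lerDl sumr_ge0// => i _; rewrite -expr2 sqr_ge0.
Qed.

(** Puts the bound in the form that a Lévy measure integrates. If [norm2 s <= 1], the coordinate sum
    is at most [k * norm2 s]; otherwise [2 * M] is used. Hence [C * k + 2]. *)
Lemma semigroup_subid_norm2 : exists2 C : R, 0 <= C & forall s f M x, lev 0 s ->
  bounded_borel f -> (forall y, `|f y| <= M) ->
  `|T s f x - f x| <= C * M * Num.min (norm2 s) 1.
Proof.
have [C C0 HC] := semigroup_subid_l1.
exists (C * k%:R + 2); first by rewrite addr_ge0// mulr_ge0.
move=> s f M x s0 bf fM.
have M0 : 0 <= M by exact: le_trans (normr_ge0 _) (fM x).
have [n1|n1] := leP (norm2 s) 1.
  apply: (le_trans (HC s f M x s0 bf fM)); rewrite mulrAC.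
  apply: (@le_trans _ _ (C * M * (k%:R * norm2 s))).
    rewrite ler_wpM2l ?mulr_ge0//.
    apply: (le_trans (ler_sum _ (fun i _ => coord_le_norm2 s i))).
    by rewrite sumr_const card_ord mulr_natl.
  rewrite mulrA ler_wpM2r//; first exact: sqrtr_ge0.
  by rewrite mulrAC ler_wpM2r// lerDl.
rewrite mulr1; apply: (@le_trans _ _ (2 * M)); last first.
  by rewrite ler_wpM2r// lerDr mulr_ge0.
by rewrite (le_trans (ler_normB _ _))// mulrDl mul1r lerD// semigroup_bound.
Qed.

(** Two times need not be comparable in the partial order, so both are compared with their
    coordinatewise maximum, which the semigroup law reaches from either. *)
Lemma semigroup_lipschitz : exists2 C : R, 0 <= C & forall s t f M x,
  lev 0 s -> lev 0 t -> bounded_borel f -> (forall y, `|f y| <= M) ->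
  `|T s f x - T t f x| <= C * M * \sum_j `|s ord0 j - t ord0 j|.
Proof.
have [C C0 HC] := semigroup_subid_l1.
have half s m f M x : lev 0 s -> lev s m -> bounded_borel f ->
    (forall y, `|f y| <= M) ->
    `|T m f x - T s f x| <= C * M * \sum_j (m ord0 j - s ord0 j).
  move=> s0 sm bf fM.
  have ms : lev 0 (m - s) by move=> i; rewrite !mxE subr_ge0.
  have -> : T m f = T s (T (m - s) f) by rewrite -(C0_comp T_C0)// addrC subrK.
  have bm : bounded_borel (T (m - s) f) by exact: (C0_bounded_borel T_C0).
  rewrite -semigroupB//; apply: semigroup_bound => //; first exact: bounded_borelB.
  move=> y; apply: (le_trans (HC (m - s) f M y ms bf fM)).
  by rewrite mulrAC; under eq_bigr do rewrite !mxE.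
exists C => // s t f M x s0 t0 bf fM.
pose m : 'rV[R]_k := \row_j Num.max (s ord0 j) (t ord0 j).
have sm : lev s m by move=> j; rewrite mxE le_max lexx.
have tm : lev t m by move=> j; rewrite mxE le_max lexx orbT.
have h1 := half s m f M x s0 sm bf fM.
have h2 := half t m f M x t0 tm bf fM.
have := ler_distD (T m f x) (T s f x) (T t f x).
rewrite [`|T s f x - T m f x|]distrC => /le_trans; apply.
apply: (le_trans (lerD h1 h2)); rewrite -mulrDr -big_split/=.
rewrite le_eqVlt; apply/predU1P; left; congr (_ * _); apply: eq_bigr => j _.
rewrite mxE; have [st|ts] := leP (s ord0 j) (t ord0 j).
  by rewrite ler0_norm ?subr_le0// subrr addr0 opprB.
by rewrite gtr0_norm ?subr_gt0// subrr add0r.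
Qed.

Lemma measurable_orthant : measurable (orthant : set 'rV[R]_k).
Proof.
have -> : orthant = \bigcap_(i in [set: 'I_k])
    (fun v : 'rV[R]_k => v ord0 i) @^-1` `[0, +oo[.
  apply/seteqP; split => s /= H i.
    by move=> _ /=; rewrite in_itv/= andbT; have := H i; rewrite mxE.
  by have := H i I; rewrite /= in_itv/= andbT mxE.
apply: fin_bigcap_measurable; first exact: finite_finset.
move=> i _; rewrite -[X in measurable X]setTI.
exact: measurable_rV_coord.
Qed.

Lemma semigroup_measurable f x : bounded_borel f ->
  measurable_fun orthant (fun s => T s f x).
Proof.
move=> bf; have [mf [M fM]] := bf.
have M0 : 0 <= M by exact: le_trans (normr_ge0 _) (fM x).
(* Nothing is known of [T s] off the orthant. [pos] retracts the whole space onto it without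
   increasing coordinate distances, which produces a function continuous everywhere. *)
pose pos (s : 'rV[R]_k) : 'rV[R]_k := \row_j Num.max (s ord0 j) 0.
have pos0 s : lev 0 (pos s) by move=> j; rewrite !mxE le_max lexx orbT.
have [C C0 HC] := semigroup_lipschitz.
suff cT : continuous (fun s => T (pos s) f x).
  apply: (@eq_measurable_fun _ _ _ _ _ (fun s => T (pos s) f x)).
    move=> s; rewrite inE => s0; congr (T _ f x); apply/rowP => j; rewrite mxE.
    by apply/max_idPl; have := s0 j; rewrite mxE.
  apply: measurable_funS (continuous_measurable_rV cT) => //.
move=> s A /nbhs_ballP[e /= e0 eA].
(* The 1 keeps the denominator of the radius positive even if [C] or [M] is 0. *)
have K0 : 0 < C * M * k%:R + 1 by rewrite ltr_wpDl// !mulr_ge0.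
have eK : 0 < e / (C * M * k%:R + 1) by rewrite divr_gt0.
apply/nbhs_ballP; exists (e / (C * M * k%:R + 1)) => //= t [_ st].
apply: eA; rewrite /ball/=.
apply: (le_lt_trans (HC _ _ f M x _ _ _ _)) => //.
apply: (@le_lt_trans _ _ (C * M * \sum_(j < k) e / (C * M * k%:R + 1))).
  rewrite ler_wpM2l ?mulr_ge0//; apply: ler_sum => j _.
  have := st ord0 j; rewrite /ball/= => /ltW; apply: le_trans.
  rewrite !mxE; case: (leP (s ord0 j) 0) => a1; case: (leP (t ord0 j) 0) => a2.
  - by rewrite subrr normr0.
  - rewrite sub0r normrN gtr0_norm// distrC; apply: le_trans (ler_norm _); lra.
  - rewrite subr0 gtr0_norm//; apply: le_trans (ler_norm _); lra.
  - by [].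
rewrite sumr_const card_ord -(mulr_natl (e / _)) !mulrA.
rewrite ltr_pdivrMr// mulrC ltr_pM2l//.
by rewrite ltrDl.
Qed.

Lemma measurable_norm2 n : measurable_fun setT (@norm2 R n).
Proof.
apply: (@measurableT_comp _ _ _ _ _ _ (@Num.sqrt R)).
  by apply: continuous_measurable_fun; exact: sqrt_continuous.
apply: measurable_sum => i.
by apply: measurable_funM; exact: measurable_rV_coord.
Qed.

Let D : set 'rV[R]_k := orthant `\ 0.

Let mD : measurable D.
Proof. by apply: measurableD; [exact: measurable_orthant|exact: measurable_set1_rV]. Qed.

Lemma levy_integrable (nu : {measure set 'rV[R]_k -> \bar R}) :
  levy_measure nu ->
  nu.-integrable (orthant `\ 0) (EFin \o (fun s => Num.min (norm2 s) 1)).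
Proof.
move=> [_ nuoo]; apply: (@integrableS _ _ _ _ setT) => //.
apply/integrableP; split.
  by apply/measurable_EFinP; apply: measurable_minr => //; exact: measurable_norm2.
apply: le_lt_trans nuoo; rewrite le_eqVlt; apply/predU1P; left.
by apply: eq_integral => s _ /=; rewrite ger0_norm// le_min ler01 sqrtr_ge0.
Qed.

(** The drift terms converge by [generator_sigma_cvg]; under the Lévy integral the convergence is
    dominated by [C * M * Num.min (norm2 s) 1]. *)
Lemma subordinate_generator_sigma_cvg c nu (f_ : nat -> 'rV[R]_d -> R) f M x :
  levy_measure nu ->
  (forall n, measurable_fun setT (f_ n)) -> (forall n y, `|f_ n y| <= M) ->
  bounded_borel f -> (forall y, `|f y| <= M) ->
  (forall y, f_ n y @[n --> \oo] --> f y) ->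
  subordinate_generator T c nu (f_ n) x @[n --> \oo] -->
  subordinate_generator T c nu f x.
Proof.
move=> lnu mf_ fM bf fM' cf; rewrite /subordinate_generator.
have bf_ n : bounded_borel (f_ n) by split => //; exists M.
apply: cvgD.
  apply: cvg_big => [|j _]; first exact: add_continuous.
  apply: cvgMr.
  exact: (generator_sigma_cvg (M := M)).
have [C C0 HC] := semigroup_subid_norm2.
have mT g : bounded_borel g -> measurable_fun D (fun s => T s g x - g x).
  move=> bg; apply: measurable_funB => //.
  apply: measurable_funS (semigroup_measurable x bg); first exact: measurable_orthant.
  exact: subDsetl.
apply: (@Rdominated_cvg _ _ _ _ _ (fun n s => T s (f_ n) x - f_ n x)
  (fun s => T s f x - f x) (fun s => C * M * Num.min (norm2 s) 1)) => //.
- by move=> n; exact: mT.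
- move=> s [s0 _]; apply: cvgB; last exact: cf.
  exact: (semigroup_cvg (M := M)).
- exact: integrableZl (levy_integrable lnu).
- by move=> n s [s0 _]; exact: HC.
Qed.

(** [mixed_transition] compares the two sides on indicators only. Their difference is a linear
    functional of [f], bounded with constant 2 as each side is a contraction, so
    [bounded_borel_functional_eq0] extends the equality. *)
Lemma evolution_integral (pi12 : R -> R -> probability 'rV[R]_k R)
    (p : R -> R -> 'rV[R]_d -> probability 'rV[R]_d R) (t1 t2 : R) f x :
  mixed_transition P X pi12 p -> 0 <= t1 -> t1 <= t2 -> bounded_borel f ->
  \int[p t1 t2 x]_y f y = evolution T pi12 t1 t2 f x.
Proof.
move=> pm t10 t12 bf; apply/eqP; rewrite -subr_eq0; apply/eqP.
pose L g := \int[p t1 t2 x]_y g y - evolution T pi12 t1 t2 g x.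
have ip g : bounded_borel g -> (p t1 t2 x).-integrable setT (EFin \o g).
  move=> [mg [M gM]]; apply: (integrable_dom (g := fun=> M)) => //.
  exact: finite_measure_integrable_cst.
have iM (M : R) : (pi12 t1 t2).-integrable orthant (EFin \o fun=> M).
  apply: (@integrableS _ _ _ _ setT) => //; first exact: measurable_orthant.
  exact: finite_measure_integrable_cst.
have iT g : bounded_borel g ->
    (pi12 t1 t2).-integrable orthant (EFin \o (fun s => T s g x)).
  move=> bg; have [mg [M gM]] := bg.
  apply: (integrable_dom (g := fun=> M)) => //; first exact: measurable_orthant.
    exact: semigroup_measurable.
  by move=> s s0; exact: semigroup_bound.
apply: (@bounded_borel_functional_eq0 _ _ L 2) => //.
- move=> a g1 g2 b1 b2; rewrite /L /evolution.
  have -> : \int[pi12 t1 t2]_(s in orthant) T s (fun y => a * g1 y + g2 y) x =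
      \int[pi12 t1 t2]_(s in orthant) (a * T s g1 x + T s g2 x).
    by apply: eq_Rintegral => s; rewrite inE => s0; rewrite (C0_linear T_C0).
  have i1 := integrableZl measurableT a (ip _ b1).
  have i2 := integrableZl measurable_orthant a (iT _ b1).
  rewrite (RintegralD measurableT i1 (ip _ b2)) (RintegralZl _ measurableT (ip _ b1)).
  rewrite (RintegralD measurable_orthant i2 (iT _ b2)).
  by rewrite (RintegralZl _ measurable_orthant (iT _ b1)); ring.
- move=> g M bg gM; rewrite /L (le_trans (ler_normB _ _))// mulrDl mul1r lerD//.
    apply: (le_trans (le_normr_Rintegral_dom (g := fun=> M) _ _ _ _)) => //.
    + exact: bg.1.
    + exact: finite_measure_integrable_cst.
    + by rewrite Rintegral_cst_probability.
  apply: (le_trans (le_normr_Rintegral_dom (g := fun=> M) _ _ _ _)) => //.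
  + exact: measurable_orthant.
  + exact: semigroup_measurable.
  + by move=> s s0; exact: semigroup_bound.
  (* The integral runs over the orthant only, whose mass under [pi12 t1 t2] is at most 1. *)
  + rewrite Rintegral_cst; last exact: measurable_orthant.
    rewrite ler_piMr//; first exact: le_trans (normr_ge0 _) (gM x).
    have fo : pi12 t1 t2 orthant \is a fin_num.
      by rewrite fin_num_measure//; exact: measurable_orthant.
    by rewrite -lee_fin fineK// probability_le1//; exact: measurable_orthant.
- move=> A mA; rewrite /L /evolution.
  have -> : \int[p t1 t2 x]_y \1_A y = fine (p t1 t2 x A).
    by rewrite /Rintegral integral_indic// setIT.
  rewrite pm// /Rintegral; apply/eqP; rewrite subr_eq0; apply/eqP; congr fine.
  apply: eq_integral => s; rewrite inE => s0.
  rewrite semigroup_indic// fineK// fin_num_measure//.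
  by rewrite -[X in measurable X]setTI; apply: (markov_measurable s0).
Qed.

End markov_semigroup.

(** * Complex-valued integrals *)

Section complex_facts.
Context {R : realType}.
Implicit Types (z w : R[i]) (a b : R).

Lemma complex_ReM z w : complex.Re (z * w) =
  complex.Re z * complex.Re w - complex.Im z * complex.Im w.
Proof. by case: z; case: w. Qed.

Lemma complex_ImM z w : complex.Im (z * w) =
  complex.Re z * complex.Im w + complex.Im z * complex.Re w.
Proof. by case: z; case: w => *. Qed.

Lemma complex_eqP z w : complex.Re z = complex.Re w ->
  complex.Im z = complex.Im w -> z = w.
Proof. by case: z; case: w => ? ? ? ? /= -> ->. Qed.

Lemma expiD a b : expi (a + b) = expi a * expi b.
Proof.
by apply: complex_eqP; rewrite ?complex_ReM ?complex_ImM /= ?cosD ?sinD// addrC.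
Qed.

Lemma expi0 : expi 0 = 1 :> R[i].
Proof. by rewrite /expi cos0 sin0. Qed.

Lemma conj_expi a : (expi a)^* = expi (- a).
Proof. by rewrite /expi cosN sinN. Qed.

Lemma normc_expi a : ComplexField.Normc.normc (expi a) = 1.
Proof. by rewrite /= cos2Dsin2 sqrtr1. Qed.

Lemma normc_real a : ComplexField.Normc.normc a%:C = `|a|.
Proof. by rewrite /= expr0n/= addr0 sqrtr_sqr. Qed.

Lemma normr_Re_le z : `|complex.Re z| <= ComplexField.Normc.normc z.
Proof.
case: z => a b /=; rewrite -sqrtr_sqr ler_wsqrtr// lerDl; exact: sqr_ge0.
Qed.

Lemma normr_Im_le z : `|complex.Im z| <= ComplexField.Normc.normc z.
Proof.
case: z => a b /=; rewrite -sqrtr_sqr ler_wsqrtr// lerDr; exact: sqr_ge0.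
Qed.

Lemma normc_le z : ComplexField.Normc.normc z <= `|complex.Re z| + `|complex.Im z|.
Proof.
case: z => a b /=; rewrite -[leRHS]ger0_norm ?addr_ge0// -sqrtr_sqr ler_wsqrtr//.
rewrite sqrrD !real_normK ?num_real// -addrA [_ *+ 2 + _]addrC addrA lerDl.
by rewrite mulrn_wge0// mulr_ge0.
Qed.

Lemma complex_cvg {I : Type} (G : set_system I) {FG : Filter G} (u : I -> R[i]^o) (l : R[i]^o) :
  complex.Re (u i) @[i --> G] --> complex.Re l ->
  complex.Im (u i) @[i --> G] --> complex.Im l -> u i @[i --> G] --> l.
Proof.
move=> /cvgrPdist_lt cR /cvgrPdist_lt cI; apply/cvgrPdist_lt => -[e e'].
(* In the order of [R[i]], positivity forces the imaginary part of the tolerance to be 0. *)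
rewrite ltcE /= => /andP[/eqP -> e0].
have e20 : 0 < e / 2 by rewrite divr_gt0.
have {}cR := cR _ e20; have {}cI := cI _ e20.
near=> i; rewrite ltcE /= eqxx /=.
apply: (le_lt_trans (normc_le _)); rewrite [e]splitr ltrD//.
- have : `|complex.Re l - complex.Re (u i)| < e / 2 by near: i.
  by case: (l : R[i]) (u i : R[i]) => ? ? [].
- have : `|complex.Im l - complex.Im (u i)| < e / 2 by near: i.
  by case: (l : R[i]) (u i : R[i]) => ? ? [].
Unshelve. all: by end_near. Qed.

End complex_facts.

Section complex_integrals.
Context {R : realType} {d : measure_display} {T : measurableType d}.
Implicit Types (mu : {measure set T -> \bar R}) (f g : T -> R[i]).
Notation normc := ComplexField.Normc.normc.

Definition cmeasurable f :=
  measurable_fun setT (fun x => complex.Re (f x)) /\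
  measurable_fun setT (fun x => complex.Im (f x)).

Lemma cmeasurableM f g : cmeasurable f -> cmeasurable g ->
  cmeasurable (fun x => f x * g x).
Proof.
move=> [f1 f2] [g1 g2]; split.
  under eq_fun do rewrite complex_ReM.
  by apply: measurable_funB; apply: measurable_funM.
under eq_fun do rewrite complex_ImM.
by apply: measurable_funD; apply: measurable_funM.
Qed.

Lemma cmeasurable_real (h : T -> R) : measurable_fun setT h ->
  cmeasurable (fun x => (h x)%:C).
Proof. by move=> mh; split => //=; exact: measurable_cst. Qed.

Lemma cmeasurable_cst (c : R[i]) : cmeasurable (fun=> c).
Proof. by split; exact: measurable_cst. Qed.

Lemma cmeasurable_expi (h : T -> R) : measurable_fun setT h ->
  cmeasurable (fun x => expi (h x)).
Proof.
move=> mh; split => /=.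
  apply: (measurableT_comp _ mh); apply: continuous_measurable_fun.
  exact: continuous_cos.
apply: (measurableT_comp _ mh); apply: continuous_measurable_fun.
exact: continuous_sin.
Qed.

Lemma cintegrable_dom mu f (g : T -> R) : cmeasurable f ->
  mu.-integrable setT (EFin \o g) -> (forall x, normc (f x) <= g x) ->
  cintegrable mu setT f.
Proof.
move=> [m1 m2] ig fg; split; apply: (integrable_dom measurableT _ ig) => //= x _.
  exact: le_trans (normr_Re_le _) (fg x).
exact: le_trans (normr_Im_le _) (fg x).
Qed.

Lemma cintegrable_measurable mu f : cintegrable mu setT f -> cmeasurable f.
Proof.
by move=> [/measurable_int i1 /measurable_int i2]; split; exact/measurable_EFinP.
Qed.

Lemma cintegrable_normc mu f : cintegrable mu setT f ->
  mu.-integrable setT (EFin \o (fun x => normc (f x))).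
Proof.
move=> cf; have [m1 m2] := cintegrable_measurable cf; case: cf => i1 i2.
have i12 := integrableD measurableT (integrable_norm i1) (integrable_norm i2).
apply: (@integrable_dom _ _ _ _ _ _
  (fun x => `|complex.Re (f x)| + `|complex.Im (f x)|)) => //.
- rewrite (_ : (fun x => normc (f x)) =
      Num.sqrt \o (fun x => complex.Re (f x) ^+ 2 + complex.Im (f x) ^+ 2)); last first.
    by apply/funext => x /=; case: (f x).
  apply: (@measurableT_comp _ _ _ _ _ _ (@Num.sqrt R)).
    by apply: continuous_measurable_fun; exact: sqrt_continuous.
  by apply: measurable_funD; exact: measurable_funX.
- move=> x _; rewrite ger0_norm; first exact: normc_le.
  exact: le_trans (normr_ge0 _) (normr_Re_le _).
Qed.

Lemma cintegralZl mu (c : R[i]) f : cintegrable mu setT f ->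
  cintegrable mu setT (fun x => c * f x) /\
  cintegral mu setT (fun x => c * f x) = c * cintegral mu setT f.
Proof.
move=> [i1 i2]; have h r := integrableZl measurableT r i1.
have h' r := integrableZl measurableT r i2.
split.
  split; under eq_fun do rewrite /= ?complex_ReM ?complex_ImM.
    exact: (integrableB measurableT (h _) (h' _)).
  exact: (integrableD measurableT (h' _) (h _)).
apply: complex_eqP; rewrite ?complex_ReM ?complex_ImM /=.
  under eq_Rintegral do rewrite complex_ReM.
  by rewrite (RintegralB measurableT (h _) (h' _)) !RintegralZl.
under eq_Rintegral do rewrite complex_ImM.
by rewrite (RintegralD measurableT (h' _) (h _)) !RintegralZl.
Qed.

Lemma cintegralD mu f g : cintegrable mu setT f -> cintegrable mu setT g ->
  cintegrable mu setT (fun x => f x + g x) /\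
  cintegral mu setT (fun x => f x + g x) = cintegral mu setT f + cintegral mu setT g.
Proof.
move=> [f1 f2] [g1 g2].
have ReD x : complex.Re (f x + g x) = complex.Re (f x) + complex.Re (g x).
  by case: (f x) (g x) => ? ? [].
have ImD x : complex.Im (f x + g x) = complex.Im (f x) + complex.Im (g x).
  by case: (f x) (g x) => ? ? [].
split.
  split; under eq_fun do rewrite /= ?ReD ?ImD.
    exact: (integrableD measurableT f1 g1).
  exact: (integrableD measurableT f2 g2).
apply: complex_eqP => /=.
  under eq_Rintegral do rewrite ReD.
  exact: (RintegralD measurableT f1 g1).
under eq_Rintegral do rewrite ImD.
exact: (RintegralD measurableT f2 g2).
Qed.

Lemma cintegrable_bounded (Q : probability T R) f (M : R) : cmeasurable f ->
  (forall x, normc (f x) <= M) -> cintegrable Q setT f.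
Proof.
move=> mf fM; apply: (cintegrable_dom (g := fun=> M)) => //.
exact: finite_measure_integrable_cst.
Qed.

End complex_integrals.

Section complex_fubini.
Context {R : realType} {d1 d2 : measure_display}.
Context {T1 : measurableType d1} {T2 : measurableType d2}.
Context (m1 : {sigma_finite_measure set T1 -> \bar R}).
Context (m2 : {sigma_finite_measure set T2 -> \bar R}).
Implicit Type f : T1 * T2 -> R[i].

Lemma cintegrable_fubini f : cintegrable (m1 \x m2)%E setT f ->
  cintegrable m1 setT (fun x => cintegral m2 setT (fun y => f (x, y))).
Proof.
by move=> [/integrable_Rfubini i1 /integrable_Rfubini i2]; split.
Qed.

Lemma cFubini f : cintegrable (m1 \x m2)%E setT f ->
  cintegral m1 setT (fun x => cintegral m2 setT (fun y => f (x, y))) =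
  cintegral m2 setT (fun y => cintegral m1 setT (fun x => f (x, y))).
Proof. by move=> [/RFubini h1 /RFubini h2]; apply: complex_eqP. Qed.

End complex_fubini.

(** * The exponential and Cauchy kernels on the line *)

Section exponential_kernel.
Context {R : realType}.
Notation mu := (@lebesgue_measure R).
Implicit Types (e x z a b M : R) (g : R -> R).

Lemma continuous_is_derive g g1 : (forall x : R, is_derive x 1 g (g1 x)) ->
  continuous g.
Proof.
move=> dg x; apply: differentiable_continuous; apply/derivable1_diffP.
by case: (dg x).
Qed.

Lemma is_derive_expdecay e x z : is_derive z 1
  (fun z => expR (- (e * (z - x)))) (- e * expR (- (e * (z - x)))).
Proof.
by apply: is_derive_eq; rewrite /GRing.scale/=; ring.
Qed.

Lemma cvg_expdecay e x : 0 < e -> expR (- (e * (z - x))) @[z --> +oo] --> 0.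
Proof.
move=> e0; apply: (cvg_comp (fun z => e * (z - x)) (fun z => expR (- z))); last first.
  exact: cvgr_expR.
apply/cvgryPge => A; near=> z.
rewrite mulrC -ler_pdivrMr// lerBrDr.
by near: z; apply: nbhs_pinfty_ge; rewrite num_real.
Unshelve. all: by end_near. Qed.

Section resolvent.
Context (e : R) (e_gt0 : 0 < e).

(** The integrand is the derivative of [F], the terms in [e * g1] cancelling, and boundedness of [g]
    and [g1] makes [F] vanish at infinity. The sign hypothesis gives access to the fundamental
    theorem of calculus on a half-line for nonnegative integrands. *)
Lemma integral_expdecay_right g g1 g2 x M :
  (forall z : R, is_derive z 1 g (g1 z)) ->
  (forall z : R, is_derive z 1 g1 (g2 z)) -> continuous g2 ->
  (forall z, `|g z| <= M) -> (forall z, `|g1 z| <= M) ->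
  (forall z, 0 <= e ^+ 2 * g z - g2 z) ->
  (\int[mu]_(z in `[x, +oo[)
     (expR (- (e * (z - x))) * (e ^+ 2 * g z - g2 z))%:E = (e * g x + g1 x)%:E)%E.
Proof.
move=> dg dg1 cg2 gM g1M pos.
have M0 : 0 <= M by exact: le_trans (normr_ge0 _) (gM 0).
have cg := continuous_is_derive dg; have cg1 := continuous_is_derive dg1.
have cE : continuous (fun z => expR (- (e * (z - x)))).
  by apply: (@continuous_is_derive _ (fun z => - e * expR (- (e * (z - x))))) => z;
    exact: is_derive_expdecay.
pose f z := expR (- (e * (z - x))) * (e ^+ 2 * g z - g2 z).
pose F z := - (expR (- (e * (z - x))) * (e * g z + g1 z)).
have dF z : is_derive z 1 F (f z).
  have h1 := is_derive_expdecay e x z.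
  have h2 := dg z; have h3 := dg1 z.
  by apply: is_derive_eq; rewrite /GRing.scale/= /f; ring.
have cf : continuous f.
  move=> z; apply: cvgM; first exact: cE.
  by apply: cvgB; [apply: cvgMr; exact: cg|exact: cg2].
have cF := continuous_is_derive dF.
have Fl : F z @[z --> +oo] --> (0 : R).
  rewrite -oppr0; apply: cvgN.
  apply/norm_cvg0P.
  apply: (@squeeze_cvgr _ _ _ _ (fun=> 0) (fun z => expR (- (e * (z - x))) * (e * M + M))).
  - near=> z; rewrite normr_ge0/= normrM ger0_norm ?expR_ge0// ler_wpM2l ?expR_ge0//.
    rewrite (le_trans (ler_normD _ _))// lerD// normrM gtr0_norm//.
    by rewrite ler_wpM2l// ltW.
  - exact: cvg_cst.
  - by rewrite -(mul0r (e * M + M)); apply: cvgMl; exact: cvg_expdecay.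
rewrite (@ge0_continuous_FTC2y _ f F x 0) //.
- by rewrite sub0e /F subrr mulr0 oppr0 expR0 mul1r EFinN oppeK.
- by move=> z _; rewrite mulr_ge0 ?expR_ge0.
- exact: continuous_subspaceT.
- by apply: cvg_at_right_filter; exact: cF.
- by move=> z _; rewrite derive1E; case: (dF z).
Unshelve. all: by end_near. Qed.

(** Reflection reduces to the right half-line and changes the sign of the first derivative, so that
    the two boundary terms in [g1 x] cancel on the whole line. *)
Lemma integral_expdecay_left g g1 g2 x M :
  (forall z : R, is_derive z 1 g (g1 z)) ->
  (forall z : R, is_derive z 1 g1 (g2 z)) -> continuous g2 ->
  (forall z, `|g z| <= M) -> (forall z, `|g1 z| <= M) ->
  (forall z, 0 <= e ^+ 2 * g z - g2 z) ->
  (\int[mu]_(z in `]-oo, x])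
     (expR (- (e * (x - z))) * (e ^+ 2 * g z - g2 z))%:E = (e * g x - g1 x)%:E)%E.
Proof.
move=> dg dg1 cg2 gM g1M pos.
have cg := continuous_is_derive dg.
rewrite -(opprK x) ge0_integration_by_substitutionNy; last 2 first.
- apply: continuous_subspaceT => z; apply: cvgM; last first.
    by apply: cvgB; [apply: cvgMr; exact: cg|exact: cg2].
  apply: continuous_comp; last exact: continuous_expR.
  apply: cvgN; apply: cvgMr; apply: cvgB; [exact: cvg_cst|exact: cvg_id].
- by move=> z _; rewrite mulr_ge0 ?expR_ge0.
have dN z : is_derive z 1 (fun z : R => - z) (- 1 : R).
  exact: is_deriveNid.
have dg' z : is_derive z 1 (fun z => g (- z)) (- g1 (- z)).
  by have := is_derive1_comp (dg (- z)) (dN z); rewrite mulrN1.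
have dg1' z : is_derive z 1 (fun z => - g1 (- z)) (g2 (- z)).
  have h := is_derive1_comp (dg1 (- z)) (dN z).
  by have := is_deriveN h; rewrite mulrN1 opprK.
have cg2' : continuous (fun z => g2 (- z)).
  by move=> z; apply: continuous_comp; [exact: opp_continuous|exact: cg2].
have := @integral_expdecay_right _ _ _ (- x) M dg' dg1' cg2'.
rewrite !opprK => h; rewrite -h// => [|z]; last by rewrite normrN.
by apply: eq_integral => z _ /=; congr (expR (- (e * _)) * _)%:E; ring.
Qed.

Let integral_expdecay_ge0 g g1 g2 x M :
  (forall z : R, is_derive z 1 g (g1 z)) ->
  (forall z : R, is_derive z 1 g1 (g2 z)) -> continuous g2 ->
  (forall z, `|g z| <= M) -> (forall z, `|g1 z| <= M) ->
  (forall z, 0 <= e ^+ 2 * g z - g2 z) ->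
  (\int[mu]_z (expR (- (e * `|x - z|)) * (e ^+ 2 * g z - g2 z))%:E =
    (2 * e * g x)%:E)%E.
Proof.
move=> dg dg1 cg2 gM g1M pos.
have cg := continuous_is_derive dg.
have cf : continuous (fun z => expR (- (e * `|x - z|)) * (e ^+ 2 * g z - g2 z)).
  move=> z; apply: cvgM; last first.
    by apply: cvgB; [apply: cvgMr; exact: cg|exact: cg2].
  apply: continuous_comp; last exact: continuous_expR.
  apply: cvgN; apply: cvgMr; apply: cvg_norm.
  by apply: cvgB; [exact: cvg_cst|exact: cvg_id].
have mf := continuous_measurable_fun cf.
rewrite -set_itvNyy (@itv_bndbnd_setU _ _ _ (BRight x))// ge0_integral_setU//=; last 3 first.
- by apply/measurable_EFinP; exact: measurable_funTS.
- by move=> z _; rewrite lee_fin mulr_ge0// expR_ge0.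
- apply/disj_setPS => z [] /=; rewrite !in_itv/= andbT => zx.
  by rewrite ltNge zx.
rewrite integral_itv_obnd_cbnd; last first.
  by apply/measurable_EFinP; exact: measurable_funTS.
rewrite (_ : (2 * e * g x)%:E = ((e * g x - g1 x)%:E + (e * g x + g1 x)%:E)%E); last first.
  by rewrite -EFinD; congr EFin; ring.
have <- := integral_expdecay_left x dg dg1 cg2 gM g1M pos.
have <- := integral_expdecay_right x dg dg1 cg2 gM g1M pos.
congr (_ + _)%E; apply: eq_integral => z; rewrite inE/= in_itv/= ?andbT => xz.
  by rewrite ger0_norm// subr_ge0.
by rewrite distrC ger0_norm// subr_ge0.
Qed.

Let is_derive_addcst g (c z dg : R) : is_derive z 1 g dg ->
  is_derive z 1 (fun z => g z + c) dg.
Proof.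
by move=> h; apply: is_derive_eq; rewrite addr0.
Qed.

Lemma integrable_expdecay x :
  mu.-integrable setT (EFin \o (fun z => expR (- (e * `|x - z|)))).
Proof.
(* For this constant function the factor [e ^+ 2 * g z - g2 z] is 1. *)
have := @integral_expdecay_ge0 (fun=> e ^- 2) (fun=> 0) (fun=> 0) x (e ^- 2).
have e2 : e ^- 2 >= 0 by rewrite invr_ge0 sqr_ge0.
have eE z : expR (- (e * `|x - z|)) * (e ^+ 2 * e ^- 2 - 0) = expR (- (e * `|x - z|)).
  by rewrite divff ?subr0 ?mulr1// expf_neq0// gt_eqF.
under eq_integral do rewrite eE.
move=> h; apply/integrableP; split.
  apply/measurable_EFinP; apply: continuous_measurable_fun => z.
  apply: continuous_comp; last exact: continuous_expR.
  apply: cvgN; apply: cvgMr; apply: cvg_norm.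
  by apply: cvgB; [exact: cvg_cst|exact: cvg_id].
under eq_integral do rewrite /= ger0_norm ?expR_ge0//.
rewrite h ?ltry//.
- by move=> z; exact: cvg_cst.
- by move=> _; rewrite ger0_norm.
- by move=> _; rewrite normr0.
- by move=> _; rewrite divff ?subr0// expf_neq0// gt_eqF.
Qed.

(* [exp (- e |x|) / (2 e)] is the Green function of [e ^ 2 - d ^ 2 / dx ^ 2]. *)
Lemma Rintegral_expdecay g g1 g2 x M :
  (forall z : R, is_derive z 1 g (g1 z)) ->
  (forall z : R, is_derive z 1 g1 (g2 z)) -> continuous g2 ->
  (forall z, `|g z| <= M) -> (forall z, `|g1 z| <= M) -> (forall z, `|g2 z| <= M) ->
  mu.-integrable setT
    (EFin \o (fun z => expR (- (e * `|x - z|)) * (e ^+ 2 * g z - g2 z))) /\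
  \int[mu]_z (expR (- (e * `|x - z|)) * (e ^+ 2 * g z - g2 z)) = 2 * e * g x.
Proof.
move=> dg dg1 cg2 gM g1M g2M.
have M0 : 0 <= M by exact: le_trans (normr_ge0 _) (gM 0).
have cg := continuous_is_derive dg.
have iE c : mu.-integrable setT (EFin \o (fun z => c * expR (- (e * `|x - z|)))).
  exact: integrableZl (integrable_expdecay x).
have ef : mu.-integrable setT
    (EFin \o (fun z => expR (- (e * `|x - z|)) * (e ^+ 2 * g z - g2 z))).
  apply: (integrable_dom _ _ (iE (e ^+ 2 * M + M))) => //.
    apply: continuous_measurable_fun => z; apply: cvgM; last first.
      by apply: cvgB; [apply: cvgMr; exact: cg|exact: cg2].
    apply: continuous_comp; last exact: continuous_expR.
    apply: cvgN; apply: cvgMr; apply: cvg_norm.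
    by apply: cvgB; [exact: cvg_cst|exact: cvg_id].
  move=> z _; rewrite normrM ger0_norm ?expR_ge0// mulrC ler_wpM2r ?expR_ge0//.
  rewrite (le_trans (ler_normB _ _))// lerD// normrM ger0_norm ?sqr_ge0//.
  by rewrite ler_wpM2l// sqr_ge0.
split=> //.
(* Chosen so that [e ^+ 2 * K = e ^+ 2 * M + M]: adding [K] to [g] makes the integrand nonnegative,
   and the contribution of the constant [K] is subtracted at the end. *)
pose K := M + e ^- 2 * M.
have e2 : e ^+ 2 > 0 by rewrite exprn_gt0.
have K0 : 0 <= K by rewrite addr_ge0// mulr_ge0// invr_ge0 ltW.
have gK z : `|g z + K| <= M + K.
  by rewrite (le_trans (ler_normD _ _))// lerD// ger0_norm.
have g1K z : `|g1 z| <= M + K by rewrite (le_trans (g1M z))// lerDl.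
have eK : e ^+ 2 * K = e ^+ 2 * M + M by rewrite /K mulrDr mulrA divff ?mul1r// gt_eqF.
have pos z : 0 <= e ^+ 2 * (g z + K) - g2 z.
  rewrite mulrDr eK.
  have := g2M z; have := gM z; rewrite !ler_norml => /andP[h1 h2] /andP[h3 h4].
  have := ler_wpM2l (ltW e2) h1; move: h3 h4; lra.
have h1 := @integral_expdecay_ge0 _ g1 g2 x (M + K)
  (fun z => is_derive_addcst K (dg z)) dg1 cg2 gK g1K pos.
have h2 := @integral_expdecay_ge0 (fun=> K) (fun=> 0) (fun=> 0) x K.
have {}h2 : \int[mu]_z (expR (- (e * `|x - z|)) * (e ^+ 2 * K - 0)) = 2 * e * K.
  rewrite /Rintegral h2//.
  - by move=> z; exact: cvg_cst.
  - by move=> _; rewrite ger0_norm.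
  - by move=> _; rewrite normr0.
  - by move=> _; rewrite subr0 mulr_ge0// ltW.
have h3 : \int[mu]_z (expR (- (e * `|x - z|)) * (e ^+ 2 * (g z + K) - g2 z)) =
    2 * e * (g x + K) by rewrite /Rintegral h1.
have : \int[mu]_z (expR (- (e * `|x - z|)) * (e ^+ 2 * (g z + K) - g2 z)) =
    \int[mu]_z (expR (- (e * `|x - z|)) * (e ^+ 2 * g z - g2 z)) +
    \int[mu]_z (expR (- (e * `|x - z|)) * (e ^+ 2 * K - 0)).
  rewrite -RintegralD//.
    by apply: eq_Rintegral => z _; ring.
  have := iE (e ^+ 2 * K - 0).
  by apply: eq_integrable => // z _ /=; rewrite mulrC.
by rewrite h3 h2 mulrDr => /addIr ->.
Qed.

Let sqr_denom_gt0 b : 0 < e ^+ 2 + b ^+ 2.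
Proof. by rewrite ltr_wpDr ?sqr_ge0// exprn_gt0. Qed.

Let trig_bound (u c : R) : `|u| <= 1 -> `|c * u| <= `|c|.
Proof. by move=> u1; rewrite normrM ler_piMr. Qed.

Let continuous_scaled (u : R -> R) (b c : R) : continuous u ->
  continuous (fun z : R => c * u (b * z)).
Proof.
move=> cu z; apply: cvgMr; apply: continuous_comp; last exact: cu.
by apply: cvgMr; exact: cvg_id.
Qed.

(** The function [cos (b * z)] is an eigenfunction of [e ^ 2 - d ^ 2 / dz ^ 2] with eigenvalue
    [e ^+ 2 + b ^+ 2], so the Green function divides it by that number. The same holds for the
    sine. *)
Lemma Rintegral_expdecay_cos b x :
  \int[mu]_z (expR (- (e * `|x - z|)) * cos (b * z)) =
    2 * e * cos (b * x) / (e ^+ 2 + b ^+ 2).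
Proof.
pose c := (e ^+ 2 + b ^+ 2)^-1.
pose M := `|c| + `|- b * c| + `|- b ^+ 2 * c|.
have [||||||_ h] := @Rintegral_expdecay (fun z => c * cos (b * z))
  (fun z => (- b * c) * sin (b * z)) (fun z => (- b ^+ 2 * c) * cos (b * z)) x M.
- by move=> z; apply: is_derive_eq; rewrite /GRing.scale/=; ring.
- by move=> z; apply: is_derive_eq; rewrite /GRing.scale/=; ring.
- by apply: continuous_scaled; exact: continuous_cos.
- move=> z; apply: (le_trans (trig_bound _ (cos_max _))).
  by rewrite /M -addrA lerDl addr_ge0.
- move=> z; apply: (le_trans (trig_bound _ (sin_max _))).
  by rewrite /M addrAC lerDr addr_ge0.
- move=> z; apply: (le_trans (trig_bound _ (cos_max _))).
  by rewrite /M lerDr addr_ge0.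
transitivity (2 * e * (c * cos (b * x))); last by rewrite /c; ring.
rewrite -h; apply: eq_Rintegral => z _; congr (_ * _).
by rewrite /c; field; rewrite gt_eqF.
Qed.

Lemma Rintegral_expdecay_sin b x :
  \int[mu]_z (expR (- (e * `|x - z|)) * sin (b * z)) =
    2 * e * sin (b * x) / (e ^+ 2 + b ^+ 2).
Proof.
pose c := (e ^+ 2 + b ^+ 2)^-1.
pose M := `|c| + `|b * c| + `|- b ^+ 2 * c|.
have [||||||_ h] := @Rintegral_expdecay (fun z => c * sin (b * z))
  (fun z => (b * c) * cos (b * z)) (fun z => (- b ^+ 2 * c) * sin (b * z)) x M.
- by move=> z; apply: is_derive_eq; rewrite /GRing.scale/=; ring.
- by move=> z; apply: is_derive_eq; rewrite /GRing.scale/=; ring.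
- by apply: continuous_scaled; exact: continuous_sin.
- move=> z; apply: (le_trans (trig_bound _ (sin_max _))).
  by rewrite /M -addrA lerDl addr_ge0.
- move=> z; apply: (le_trans (trig_bound _ (cos_max _))).
  by rewrite /M addrAC lerDr addr_ge0.
- move=> z; apply: (le_trans (trig_bound _ (sin_max _))).
  by rewrite /M lerDr addr_ge0.
transitivity (2 * e * (c * sin (b * x))); last by rewrite /c; ring.
rewrite -h; apply: eq_Rintegral => z _; congr (_ * _).
by rewrite /c; field; rewrite gt_eqF.
Qed.

End resolvent.

Let continuous_cauchy : continuous (fun x : R => (1 + x ^+ 2)^-1).
Proof. exact: continuous_oneDsqrV. Qed.

Let cauchy_ge0 x : 0 <= (1 + x ^+ 2)^-1.
Proof. by rewrite invr_ge0 addr_ge0// sqr_ge0. Qed.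

Let integral_cauchy : (\int[mu]_x ((1 + x ^+ 2)^-1 : R)%:E = pi%:E)%E.
Proof.
rewrite (ge0_symfun_integralT cauchy_ge0 continuous_cauchy); last first.
  by move=> x /=; rewrite sqrrN.
rewrite -set_itvcy integral0y_oneDsqr -EFinM; congr EFin.
by rewrite mulrC divfK.
Qed.

Lemma integrable_cauchy :
  mu.-integrable setT (EFin \o (fun x : R => (1 + x ^+ 2)^-1)).
Proof.
apply/integrableP; split.
  by apply/measurable_EFinP; exact: continuous_measurable_fun.
under eq_integral do rewrite /= ger0_norm//.
by rewrite integral_cauchy ltry.
Qed.

Lemma Rintegral_cauchy : \int[mu]_x (1 + x ^+ 2)^-1 = pi :> R.
Proof. by rewrite /Rintegral integral_cauchy. Qed.

Lemma Rintegral_scale e (G : R -> R) : 0 < e -> continuous G ->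
  (forall x, 0 <= G x) -> \int[mu]_x G x = \int[mu]_x (G (e * x) * e).
Proof.
move=> e0 cG G0; pose F x := e * x.
have dF x : is_derive x 1 F e.
  by apply: is_derive_eq; rewrite /GRing.scale/=; ring.
have F' : F^`()%classic = cst e.
  by apply/funext => x; rewrite derive1E; case: (dF x).
rewrite /Rintegral (@increasing_ge0_integration_by_substitutionT _ F G)//.
- by rewrite F'.
- by move=> x y xy; rewrite /F ltr_pM2l.
- by rewrite F' => x; exact: cvg_cst.
- by rewrite F'; exact: is_cvg_cst.
- by rewrite F'; exact: is_cvg_cst.
- apply/cvgrNyPle => A; have := nbhs_ninfty_le (num_real (A / e)).
  by apply: filterS => x; rewrite ler_pdivlMr// mulrC.
- apply/cvgryPge => A; have := nbhs_pinfty_ge (num_real (A / e)).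
  by apply: filterS => x; rewrite ler_pdivrMr// mulrC.
Qed.

Let continuous_expdecay e x : continuous (fun z => expR (- (e * `|x - z|))).
Proof.
move=> z; apply: continuous_comp; last exact: continuous_expR.
apply: cvgN; apply: cvgMr; apply: cvg_norm.
by apply: cvgB; [exact: cvg_cst|exact: cvg_id].
Qed.

Let one_sqr_gt0 x : 0 < 1 + x ^+ 2.
Proof. by rewrite ltr_wpDr ?sqr_ge0. Qed.

Let sqr_sqr_gt0 e x : 0 < e -> 0 < e ^+ 2 + x ^+ 2.
Proof. by move=> e0; rewrite ltr_wpDr ?sqr_ge0// exprn_gt0. Qed.

Let poisson_le e x : 0 < e -> e / (e ^+ 2 + x ^+ 2) <= e^-1.
Proof.
move=> e0; rewrite ler_pdivrMr ?sqr_sqr_gt0// mulrDr expr2 mulKf ?gt_eqF//.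
by rewrite lerDl mulr_ge0 ?sqr_ge0// invr_ge0 ltW.
Qed.

(** * Fourier transform of the Cauchy density, for cosine and sine at once *)

Section cauchy_transform.
Context (u : R -> R).
Hypothesis u_continuous : continuous u.
Hypothesis u_le1 : forall x, `|u x| <= 1.
Hypothesis u_resolvent : forall e, 0 < e -> forall b x,
  \int[mu]_z (expR (- (e * `|x - z|)) * u (b * z)) =
    2 * e * u (b * x) / (e ^+ 2 + b ^+ 2).

(* Fubini on [exp (- e |x|) exp (- |a - z|) u (xi z)]. *)
Let abel_cauchy e a : 0 < e ->
  \int[mu]_x (expR (- (e * `|0 - x|)) * ((1 + x ^+ 2)^-1 * u (a * x))) =
  \int[mu]_x ((1 + x ^+ 2)^-1 * expR (- (1 * `|a - e * x|))) * u 0.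
Proof.
move=> e0.
have i1 := integrable_expdecay ltr01 a.
have i2 := integrable_expdecay e0 0.
have icos e' x b : 0 < e' ->
    mu.-integrable setT (EFin \o (fun z => expR (- (e' * `|x - z|)) * u (b * z))).
  move=> e'0; apply: (integrable_dom _ _ (integrable_expdecay e'0 x)) => //.
    apply: measurable_funM.
      by apply: continuous_measurable_fun; exact: continuous_expdecay.
    apply: (measurableT_comp (continuous_measurable_fun u_continuous)).
    exact: measurable_funM.
  by move=> z _; rewrite normrM ger0_norm ?expR_ge0// ler_piMr ?expR_ge0// u_le1.
pose f (z : measurableTypeR R * measurableTypeR R) :=
  expR (- (e * `|0 - z.1|)) * (2^-1 * (expR (- (1 * `|a - z.2|)) * u (z.1 * z.2))).
have mf : measurable_fun setT f.
  apply: measurable_funM.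
    by apply: (measurableT_comp (continuous_measurable_fun (@continuous_expdecay e 0))).
  apply: measurable_funM => //; apply: measurable_funM.
    by apply: (measurableT_comp (continuous_measurable_fun (@continuous_expdecay 1 a))).
  apply: (measurableT_comp (continuous_measurable_fun u_continuous)).
  by apply: measurable_funM.
have intf : (mu \x mu)%E.-integrable setT (EFin \o f).
  apply: (integrable_prod_dom mf i2 i1) => [x|x y]; first exact: expR_ge0.
  rewrite normrM ger0_norm ?expR_ge0// ler_wpM2l ?expR_ge0//.
  rewrite normrM ger0_norm// normrM ger0_norm ?expR_ge0//.
  have h1 := u_le1 (x * y); have h2 := expR_ge0 (- (1 * `|a - y|)).
  have := ler_piMr h2 h1; have := mulr_ge0 h2 (normr_ge0 (u (x * y))).
  by rewrite /=; lra.
have h := RFubini intf.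
(* The resolvent identity with parameter 1 expands [(1 + x ^+ 2)^-1 * u (a * x)] as an integral over
   [y]. After the exchange, the identity with parameter [e] at the point 0 evaluates the integral
   over [x]; this is where [u 0] comes from. *)
transitivity (\int[mu]_x \int[mu]_y f (x, y)).
  apply: eq_Rintegral => x _; rewrite /f /=.
  rewrite (RintegralZl _ measurableT (integrableZl measurableT 2^-1 (icos 1 a x ltr01))).
  rewrite (RintegralZl _ measurableT (icos 1 a x ltr01)).
  rewrite (u_resolvent ltr01) expr1n [x * a]mulrC; congr (_ * _).
  by field; apply: lt0r_neq0; exact: one_sqr_gt0.
have den0 y : 0 < e ^+ 2 + y ^+ 2 by exact: sqr_sqr_gt0.
have ck : continuous (fun y => expR (- (1 * `|a - y|)) * (e / (e ^+ 2 + y ^+ 2))).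
  move=> y; apply: cvgM; first exact: continuous_expdecay.
  apply: cvgMr; apply: cvgV; first by rewrite gt_eqF.
  by apply: cvgD; [exact: cvg_cst|exact: exprn_continuous].
have k0 y : 0 <= expR (- (1 * `|a - y|)) * (e / (e ^+ 2 + y ^+ 2)).
  by apply: mulr_ge0; [exact: expR_ge0|apply: divr_ge0; exact: ltW].
have ik : mu.-integrable setT
    (EFin \o (fun y => expR (- (1 * `|a - y|)) * (e / (e ^+ 2 + y ^+ 2)))).
  apply: (integrable_dom measurableT _ (integrableZl measurableT e^-1 i1)).
    exact: continuous_measurable_fun.
  move=> y _; rewrite (ger0_norm (k0 y)) mulrC; apply: ler_wpM2r; first exact: expR_ge0.
  exact: poisson_le.
rewrite h.
transitivity (\int[mu]_y (expR (- (1 * `|a - y|)) * (e / (e ^+ 2 + y ^+ 2)) * u 0)).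
  apply: eq_Rintegral => y _; rewrite /f /=.
  transitivity (\int[mu]_x (2^-1 * expR (- (1 * `|a - y|)) *
      (expR (- (e * `|0 - x|)) * u (y * x)))).
    by apply: eq_Rintegral => x _; rewrite [y * x]mulrC; ring.
  rewrite (RintegralZl _ measurableT (icos e 0 y e0)) (u_resolvent e0) mulr0.
  by field; apply: lt0r_neq0; exact: den0.
(* Rescaling by [e] turns the Poisson kernel into the Cauchy density and leaves [e] only inside the
   exponential, where the limit at 0 is harmless. *)
rewrite (RintegralZr _ measurableT ik) (Rintegral_scale e0 ck k0); congr (_ * _).
apply: eq_Rintegral => y _; field.
apply/andP; split; apply: lt0r_neq0; last exact: den0.
exact: one_sqr_gt0.
Qed.

(** The damping [exp (- e |x|)] is there because the double integral does not converge absolutely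
    without it. It is removed along [e = 1 / (n + 1)], the integrands on both sides of [abel_cauchy]
    being dominated by the Cauchy density. *)
Lemma Rintegral_cauchy_trig a :
  \int[mu]_x ((1 + x ^+ 2)^-1 * u (a * x)) = pi * expR (- `|a|) * u 0.
Proof.
have mc : measurable_fun [set: R] (fun x : R => (1 + x ^+ 2)^-1).
  exact: continuous_measurable_fun.
have n0 : n.+1%:R^-1 @[n --> \oo] --> (0 : R) by exact: cvg_harmonic.
have l1 : \int[mu]_x (expR (- (n.+1%:R^-1 * `|0 - x|)) * ((1 + x ^+ 2)^-1 * u (a * x)))
    @[n --> \oo] --> \int[mu]_x ((1 + x ^+ 2)^-1 * u (a * x)).
  apply: (Rdominated_cvg _ _ _ integrable_cauchy) => //.
  - move=> n; apply: measurable_funM.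
      by apply: continuous_measurable_fun; exact: continuous_expdecay.
    apply: measurable_funM => //.
    apply: (measurableT_comp (continuous_measurable_fun u_continuous)).
    exact: measurable_funM.
  - move=> x _; rewrite -[X in _ --> X]mul1r; apply: cvgMl.
    have : expR (- (n.+1%:R^-1 * `|0 - x|)) @[n --> \oo] --> expR (- (0 * `|0 - x|)).
      apply: continuous_cvg; first exact: continuous_expR.
      by apply: cvgN; apply: cvgMl.
    by rewrite mul0r oppr0 expR0.
  - move=> n x _; rewrite normrM ger0_norm ?expR_ge0// -[leRHS]mul1r ler_pM ?expR_ge0//.
    by rewrite normrM ger0_norm// ler_piMr// u_le1.
have l2 : \int[mu]_x ((1 + x ^+ 2)^-1 * expR (- (1 * `|a - n.+1%:R^-1 * x|)))
    @[n --> \oo] --> \int[mu]_x ((1 + x ^+ 2)^-1 * expR (- `|a|)).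
  apply: (Rdominated_cvg _ _ _ integrable_cauchy) => //.
  - move=> n; apply: measurable_funM => //.
    apply: (measurableT_comp (continuous_measurable_fun (@continuous_expdecay 1 a))).
    exact: measurable_funM.
  - move=> x _; apply: cvgMr.
    rewrite -[X in _ --> expR (- X)]mul1r -[X in `|X|]subr0 -(mul0r x).
    have c1 : n.+1%:R^-1 * x @[n --> \oo] --> 0 * x by exact: cvgMl.
    exact: (cvg_comp _ _ c1 (@continuous_expdecay 1 a (0 * x))).
  - move=> n x _; rewrite normrM ger0_norm// ler_piMr// ger0_norm ?expR_ge0//.
have l3 : \int[mu]_x (expR (- (n.+1%:R^-1 * `|0 - x|)) * ((1 + x ^+ 2)^-1 * u (a * x)))
    @[n --> \oo] --> \int[mu]_x ((1 + x ^+ 2)^-1 * expR (- `|a|)) * u 0.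
  under eq_cvg do rewrite abel_cauchy ?invr_gt0//.
  exact: cvgMl.
rewrite -(cvg_lim _ l1)// (cvg_lim _ l3)//.
by rewrite (RintegralZr _ measurableT integrable_cauchy) Rintegral_cauchy.
Qed.

End cauchy_transform.

Lemma Rintegral_cauchy_cos a :
  \int[mu]_x ((1 + x ^+ 2)^-1 * cos (a * x)) = pi * expR (- `|a|).
Proof.
rewrite (Rintegral_cauchy_trig (@continuous_cos R) (@cos_max R)) ?cos0 ?mulr1//.
exact: Rintegral_expdecay_cos.
Qed.

Lemma Rintegral_cauchy_sin a : \int[mu]_x ((1 + x ^+ 2)^-1 * sin (a * x)) = 0.
Proof.
rewrite (Rintegral_cauchy_trig (@continuous_sin R) (@sin_max R)) ?sin0 ?mulr0//.
exact: Rintegral_expdecay_sin.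
Qed.

End exponential_kernel.

(** * Fourier inversion *)

Section row_cons.
Context {R : realType} {n : nat}.
Implicit Types (a : R) (v : 'rV[R]_n).

(** The map whose image measure is [lebesgue_cons]; integrals over [lebesgue_rV n.+1] unfold along
    it. *)
Definition row_cons a v : 'rV[R]_n.+1 := row_mx a%:M v.

Lemma row_cons0 a v : row_cons a v ord0 ord0 = a.
Proof.
have -> : ord0 = lshift n (ord0 : 'I_1) by exact/val_inj.
by rewrite [LHS](row_mxEl a%:M v ord0 ord0) !mxE.
Qed.

Lemma row_consS a v (i : 'I_n) : row_cons a v ord0 (lift ord0 i) = v ord0 i.
Proof.
have -> : lift ord0 i = rshift 1 i by exact/val_inj.
exact: (row_mxEr a%:M v ord0 i).
Qed.

Lemma row_consK (v : 'rV[R]_n.+1) :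
  row_cons (v ord0 ord0) (\row_i v ord0 (lift ord0 i)) = v.
Proof.
apply/rowP => i; have [j ->|->] := unliftP ord0 i; last by rewrite row_cons0.
by rewrite row_consS mxE.
Qed.

Lemma row_cons_shift_tail a v (h : R) (i : 'I_n) :
  row_cons a (h *: delta_mx ord0 i + v) =
  h *: delta_mx ord0 (lift ord0 i) + row_cons a v.
Proof.
apply/rowP => j; have [l ->|->] := unliftP ord0 j.
  by rewrite [RHS]mxE !row_consS !mxE eqxx/= (inj_eq lift_inj).
by rewrite [RHS]mxE !row_cons0 !mxE/= mulr0 add0r.
Qed.

Lemma row_cons_shift_head a v (h : R) :
  row_cons (h *: 1 + a) v = h *: delta_mx ord0 ord0 + row_cons a v.
Proof.
apply/rowP => j; have [l ->|->] := unliftP ord0 j.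
  by rewrite [RHS]mxE !row_consS !mxE/= mulr0 add0r.
by rewrite [RHS]mxE !row_cons0 !mxE.
Qed.

Lemma measurable_row_cons : measurable_fun setT
  (fun p : measurableTypeR R * 'rV[R]_n => row_cons p.1 p.2).
Proof. exact: measurable_rV_cons. Qed.

End row_cons.

Section lebesgue_cons.
Context {R : realType} {n : nat}.
Notation leb := (@lebesgue_rV R).
Notation mu := (@lebesgue_measure R).

Lemma Rintegral_lebesgue_cons (f : 'rV[R]_n.+1 -> R) : measurable_fun setT f ->
  (mu \x leb n)%E.-integrable setT (EFin \o (fun p => f (row_cons p.1 p.2))) ->
  (leb n.+1).-integrable setT (EFin \o f) /\
  \int[leb n.+1]_v f v = \int[mu]_a \int[leb n]_v f (row_cons a v).
Proof.
move=> mf intf; have mf' : measurable_fun setT (EFin \o f) by exact/measurable_EFinP.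
have mc := @measurable_row_cons R n.
have intf' : (mu \x leb n)%E.-integrable
    ((fun p : measurableTypeR R * 'rV[R]_n => row_cons p.1 p.2) @^-1` setT)
    ((EFin \o f) \o (fun p => row_cons p.1 p.2)).
  by rewrite preimage_setT.
split.
  exact: (integrable_pushforward mc mf' intf' measurableT).
rewrite (Rintegral12_prod intf) /Rintegral; congr fine.
have := integral_pushforward mc mf' intf' measurableT.
by rewrite preimage_setT.
Qed.

Lemma cintegral_lebesgue_cons (f : 'rV[R]_n.+1 -> R[i]) : cmeasurable f ->
  cintegrable (mu \x leb n)%E setT (fun p => f (row_cons p.1 p.2)) ->
  cintegrable (leb n.+1) setT f /\
  cintegral (leb n.+1) setT f =
    cintegral mu setT (fun a => cintegral (leb n) setT (fun v => f (row_cons a v))).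
Proof.
move=> [m1 m2] [i1 i2].
have [j1 e1] := Rintegral_lebesgue_cons m1 i1.
have [j2 e2] := Rintegral_lebesgue_cons m2 i2.
by split; [split|apply: complex_eqP].
Qed.

End lebesgue_cons.

(** * Integrals of products of functions of one coordinate *)

Section tensor.
Context {R : realType}.
Notation leb := (@lebesgue_rV R).
Notation mu := (@lebesgue_measure R).
Notation normc := ComplexField.Normc.normc.

Lemma integral_lebesgue_rV0 (f : 'rV[R]_0 -> R) : measurable_fun setT f ->
  (leb 0).-integrable setT (EFin \o f) /\ \int[leb 0]_v f v = f 0.
Proof.
move=> mf.
have D (g : 'rV[R]_0 -> \bar R) : measurable_fun setT g -> (\int[leb 0]_v g v = g 0%R)%E.
  move=> mg; have := @integral_dirac _ _ (0 : 'rV[R]_0) R setT measurableT g mg.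
  by rewrite diracT mul1e.
have mE : measurable_fun setT (EFin \o f) by exact/measurable_EFinP.
split; last by rewrite /Rintegral D.
by apply/integrableP; split => //; rewrite D ?ltry//; exact: measurableT_comp.
Qed.

Lemma cintegral_tensor n (phi : 'I_n -> R -> R[i]) :
  (forall i, cintegrable mu setT (phi i)) ->
  cintegrable (leb n) setT (fun v => \prod_(i < n) phi i (v ord0 i)) /\
  cintegral (leb n) setT (fun v => \prod_(i < n) phi i (v ord0 i)) =
    \prod_(i < n) cintegral mu setT (phi i).
Proof.
elim: n phi => [|n IH] phi cphi.
  have -> : (fun v : 'rV[R]_0 => \prod_(i < 0) phi i (v ord0 i)) = fun=> 1.
    by apply/funext => v; rewrite big_ord0.
  have [i1 e1] := integral_lebesgue_rV0 (f := fun=> 1) (measurable_cst _).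
  have [i0 e0] := integral_lebesgue_rV0 (f := fun=> 0) (measurable_cst _).
  by rewrite big_ord0; split; [split|apply: complex_eqP].
have [iP eP] := IH (fun i => phi (lift ord0 i)) (fun i => cphi _).
set Phi := fun v : 'rV[R]_n => \prod_(i < n) phi (lift ord0 i) (v ord0 i).
have mphi i : cmeasurable (phi i) by exact: cintegrable_measurable (cphi i).
have mPhi : cmeasurable Phi by exact: cintegrable_measurable iP.
have E p : \prod_(i < n.+1) phi i (row_cons p.1 p.2 ord0 i) = phi ord0 p.1 * Phi p.2.
  rewrite big_ord_recl row_cons0; congr (_ * _).
  by apply: eq_bigr => i _; rewrite row_consS.
have ip : cintegrable (mu \x leb n)%E setT (fun p => phi ord0 p.1 * Phi p.2).
  have [m1 m2] : cmeasurable (fun p : measurableTypeR R * 'rV[R]_n => phi ord0 p.1 * Phi p.2).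
    apply: cmeasurableM; split.
    - exact: (measurableT_comp (mphi ord0).1).
    - exact: (measurableT_comp (mphi ord0).2).
    - exact: (measurableT_comp mPhi.1).
    - exact: (measurableT_comp mPhi.2).
  have nn (z : R[i]) : 0 <= normc z by exact: (le_trans (normr_ge0 _) (normr_Re_le z)).
  split; apply: (integrable_prod_dom _ (cintegrable_normc (cphi ord0)) (cintegrable_normc iP))
    => //.
  - by move=> x y; rewrite -ComplexField.Normc.normcM; exact: normr_Re_le.
  - by move=> x y; rewrite -ComplexField.Normc.normcM; exact: normr_Im_le.
have mprod : cmeasurable (fun v : 'rV[R]_n.+1 => \prod_(i < n.+1) phi i (v ord0 i)).
  elim: (index_enum _) => [|i s IHs].
    by under eq_fun do rewrite big_nil; exact: cmeasurable_cst.
  under eq_fun do rewrite big_cons; apply: cmeasurableM => //; split.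
  - by apply: (measurableT_comp (mphi i).1); exact: measurable_rV_coord.
  - by apply: (measurableT_comp (mphi i).2); exact: measurable_rV_coord.
have ip' : cintegrable (mu \x leb n)%E setT
    (fun p => \prod_(i < n.+1) phi i (row_cons p.1 p.2 ord0 i)).
  by under eq_fun do rewrite E.
have [i1 e1] := cintegral_lebesgue_cons mprod ip'.
split=> //; rewrite e1 big_ord_recl -eP.
transitivity (cintegral mu setT (fun a => cintegral (leb n) setT Phi * phi ord0 a)).
  congr cintegral; apply/funext => a; rewrite mulrC.
  have [_ <-] := cintegralZl (phi ord0 a) iP.
  by congr cintegral; apply/funext => v; exact: (E (a, v)).
by have [_ ->] := cintegralZl (cintegral (leb n) setT Phi) (cphi ord0); rewrite mulrC.
Qed.

End tensor.

Section kernels.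
Context {R : realType}.
Notation leb := (@lebesgue_rV R).
Notation mu := (@lebesgue_measure R).

(* [resolvent_kernel] is the Green function of [\prod_i (1 - d_i ^ 2)], whose
   Fourier multiplier is the inverse of [cauchy_weight]. *)
Definition resolvent_kernel n (x z : 'rV[R]_n) : R :=
  \prod_(i < n) (2^-1 * expR (- `|x ord0 i - z ord0 i|)).

Definition cauchy_weight n (x : 'rV[R]_n) : R := \prod_(i < n) (1 + x ord0 i ^+ 2)^-1.

Lemma resolvent_kernel_ge0 n (x z : 'rV[R]_n) : 0 <= resolvent_kernel x z.
Proof. by apply: prodr_ge0 => i _; rewrite mulr_ge0 ?expR_ge0. Qed.

Lemma resolvent_kernelC n (x z : 'rV[R]_n) : resolvent_kernel x z = resolvent_kernel z x.
Proof. by apply: eq_bigr => i _; rewrite distrC. Qed.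

Lemma cauchy_weight_ge0 n (x : 'rV[R]_n) : 0 <= cauchy_weight x.
Proof. by apply: prodr_ge0 => i _; rewrite invr_ge0 addr_ge0 ?sqr_ge0. Qed.

Lemma cauchy_weight_le1 n (x : 'rV[R]_n) : cauchy_weight x <= 1.
Proof.
rewrite /cauchy_weight.
suff /andP[] : 0 <= \prod_(i < n) (1 + x ord0 i ^+ 2)^-1 <= 1 by [].
elim/big_ind: _ => [|a b /andP[a0 a1] /andP[b0 b1]|i _]; first by rewrite ler01 lexx.
  by rewrite mulr_ge0//= mulr_ile1.
rewrite invr_ge0 addr_ge0 ?sqr_ge0//=.
by rewrite invf_le1 ?lerDl ?sqr_ge0// ltr_wpDr ?sqr_ge0.
Qed.

Lemma expi_sum n (a : 'I_n -> R) : expi (\sum_i a i) = \prod_i expi (a i).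
Proof.
elim: n a => [|n IH] a; first by rewrite !big_ord0 expi0.
by rewrite !big_ord_recl expiD IH.
Qed.

Lemma real_complex_prod n (a : 'I_n -> R) : (\prod_i a i)%:C = \prod_i (a i)%:C.
Proof. exact: (rmorph_prod (real_complex R)). Qed.

(** Real and imaginary parts are [Rintegral_expdecay_cos] and [Rintegral_expdecay_sin] with
    parameter 1; the factor 1/2 normalises the kernel to total mass 1. *)
Let kernel1 (z b : R) :
  cintegrable mu setT (fun t => (2^-1 * expR (- `|t - z|))%:C * expi (- (t * b))) /\
  cintegral mu setT (fun t => (2^-1 * expR (- `|t - z|))%:C * expi (- (t * b))) =
    ((1 + b ^+ 2)^-1)%:C * expi (- (z * b)).
Proof.
have E t : (2^-1 * expR (- `|t - z|))%:C * expi (- (t * b)) =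
    (2^-1)%:C * ((expR (- (1 * `|z - t|)))%:C * expi (- (t * b))).
  by rewrite mul1r distrC mulrA -rmorphM.
under eq_fun do rewrite E.
have i1 := integrable_expdecay ltr01 z.
have me : measurable_fun [set: R] (fun t => expR (- (1 * `|z - t|))).
  by apply/measurable_EFinP; exact: measurable_int i1.
have ci : cintegrable mu setT (fun t => (expR (- (1 * `|z - t|)))%:C * expi (- (t * b))).
  apply: (cintegrable_dom _ i1).
    apply: cmeasurableM; first exact: cmeasurable_real.
    by apply: cmeasurable_expi; apply: measurable_funN; exact: measurable_funM.
  move=> t; rewrite ComplexField.Normc.normcM normc_expi normc_real mulr1.
  by rewrite ger0_norm ?expR_ge0.
have [h ->] := cintegralZl (2^-1)%:C ci; split => //.
have sq : 0 < 1 + b ^+ 2 :> R by rewrite ltr_wpDr ?sqr_ge0.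
have isin : mu.-integrable setT (EFin \o (fun t => expR (- (1 * `|z - t|)) * sin (b * t))).
  apply: (integrable_dom measurableT _ i1).
    apply: measurable_funM => //.
    apply: (measurableT_comp (continuous_measurable_fun (@continuous_sin R))).
    exact: measurable_funM.
  by move=> t _; rewrite normrM ger0_norm ?expR_ge0// ler_piMr ?expR_ge0// sin_max.
set J := cintegral _ _ _.
have JR : complex.Re J = 2 * cos (b * z) / (1 + b ^+ 2).
  rewrite -[2 in RHS]mulr1 -[X in _ / (X + _)](expr1n R 2) -(Rintegral_expdecay_cos ltr01).
  by apply: eq_Rintegral => t _; rewrite /= mul0r subr0 cosN [t * b]mulrC.
have JI : complex.Im J = - (2 * sin (b * z) / (1 + b ^+ 2)).
  rewrite -[2 in RHS]mulr1 -[X in _ / (X + _)](expr1n R 2) -(Rintegral_expdecay_sin ltr01).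
  rewrite -mulN1r -(RintegralZl _ measurableT isin).
  by apply: eq_Rintegral => t _; rewrite /= mul0r addr0 sinN [t * b]mulrC mulN1r mulrN.
apply: complex_eqP; rewrite ?complex_ReM ?complex_ImM JR JI /= !mul0r ?subr0 ?addr0.
  by rewrite cosN [z * b]mulrC; field; apply: lt0r_neq0.
by rewrite sinN [z * b]mulrC; field; apply: lt0r_neq0.
Qed.

Let cauchy1 (a : R) :
  cintegrable mu setT (fun t => ((1 + t ^+ 2)^-1)%:C * expi (a * t)) /\
  cintegral mu setT (fun t => ((1 + t ^+ 2)^-1)%:C * expi (a * t)) =
    (2 * pi)%:C * (2^-1 * expR (- `|a|))%:C.
Proof.
have i1 := @integrable_cauchy R.
have me : measurable_fun [set: R] (fun t : R => (1 + t ^+ 2)^-1).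
  by apply/measurable_EFinP; exact: measurable_int i1.
have sq t : 0 < 1 + t ^+ 2 :> R by rewrite ltr_wpDr ?sqr_ge0.
split.
  apply: (cintegrable_dom _ i1).
    apply: cmeasurableM; first exact: cmeasurable_real.
    by apply: cmeasurable_expi; exact: measurable_funM.
  move=> t; rewrite ComplexField.Normc.normcM normc_expi normc_real mulr1.
  by rewrite gtr0_norm// invr_gt0.
apply: complex_eqP; rewrite ?complex_ReM ?complex_ImM /=.
  rewrite mul0r subr0 mulrACA divff// mul1r -Rintegral_cauchy_cos.
  by apply: eq_Rintegral => t _; rewrite /= mul0r subr0.
transitivity (\int[mu]_t ((1 + t ^+ 2)^-1 * sin (a * t))); last first.
  by rewrite Rintegral_cauchy_sin mulr0 mul0r addr0.
by apply: eq_Rintegral => t _; rewrite /= mul0r addr0.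
Qed.

(** With [cauchy_weight_char] this is Fourier inversion for a single kernel: kernel to weight, and
    weight back to [(2 * pi) ^+ n] times the kernel. General [f] are superpositions of such
    kernels. *)
Lemma resolvent_kernel_char n (z b : 'rV[R]_n) :
  cintegrable (leb n) setT
    (fun x => (resolvent_kernel x z)%:C * expi (- dotp x b)) /\
  cintegral (leb n) setT
    (fun x => (resolvent_kernel x z)%:C * expi (- dotp x b)) =
    (cauchy_weight b)%:C * expi (- dotp z b).
Proof.
have E x : (resolvent_kernel x z)%:C * expi (- dotp x b) = \prod_(i < n)
    ((2^-1 * expR (- `|x ord0 i - z ord0 i|))%:C * expi (- (x ord0 i * b ord0 i))).
  by rewrite big_split/= -expi_sum sumrN -real_complex_prod.
under eq_fun do rewrite E.
have [h1 h2] := @cintegral_tensor R n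
  (fun i t => (2^-1 * expR (- `|t - z ord0 i|))%:C * expi (- (t * b ord0 i)))
  (fun i => (kernel1 (z ord0 i) (b ord0 i)).1).
split=> //; rewrite h2 /cauchy_weight real_complex_prod /dotp -sumrN expi_sum -big_split/=.
by apply: eq_bigr => i _; rewrite (kernel1 _ _).2.
Qed.

Lemma cauchy_weight_char n (y z : 'rV[R]_n) :
  cintegrable (leb n) setT
    (fun b => (cauchy_weight b)%:C * expi (dotp (y - z) b)) /\
  cintegral (leb n) setT
    (fun b => (cauchy_weight b)%:C * expi (dotp (y - z) b)) =
    ((2 * pi) ^+ n * resolvent_kernel y z)%:C.
Proof.
have E b : (cauchy_weight b)%:C * expi (dotp (y - z) b) = \prod_(i < n)
    (((1 + b ord0 i ^+ 2)^-1)%:C * expi ((y ord0 i - z ord0 i) * b ord0 i)).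
  rewrite big_split/= -expi_sum -real_complex_prod; congr (_ * expi _).
  by apply: eq_bigr => i _; rewrite !mxE.
under eq_fun do rewrite E.
have [h1 h2] := @cintegral_tensor R n
  (fun i t => ((1 + t ^+ 2)^-1)%:C * expi ((y ord0 i - z ord0 i) * t))
  (fun i => (cauchy1 (y ord0 i - z ord0 i)).1).
split=> //; rewrite h2.
under eq_bigr do rewrite (cauchy1 _).2.
by rewrite big_split/= prodr_const card_ord -rmorphXn -real_complex_prod -rmorphM.
Qed.

(** Read off from [resolvent_kernel_char] at frequency 0, where the weight is 1. *)
Lemma integrable_resolvent_kernel n (z : 'rV[R]_n) :
  (leb n).-integrable setT (EFin \o (fun x => resolvent_kernel x z)) /\
  \int[leb n]_x resolvent_kernel x z = 1.
Proof.
have [[h1 _] h2] := resolvent_kernel_char z 0.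
have E x : complex.Re ((resolvent_kernel x z)%:C * expi (- dotp x 0)) = resolvent_kernel x z.
  rewrite /dotp big1 ?oppr0 ?expi0 ?mulr1// => i _; by rewrite mxE mulr0.
split.
  by move: h1; apply: eq_integrable => // x _; congr EFin; exact: E.
move: h2 => /(congr1 (@complex.Re R)) /=.
have {}E x : resolvent_kernel x z * cos (- dotp x 0) - 0 * sin (- dotp x 0) =
  resolvent_kernel x z := E x.
under eq_Rintegral do rewrite E.
move=> ->; rewrite mul0r subr0 /dotp big1 => [|i _]; last by rewrite mxE mulr0.
rewrite oppr0 cos0 mulr1 /cauchy_weight big1// => i _.
by rewrite mxE expr0n addr0 invr1.
Qed.

Lemma integrable_cauchy_weight n :
  (leb n).-integrable setT (EFin \o (@cauchy_weight n)).
Proof.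
have [[h1 _] _] := @cauchy_weight_char n 0 0.
move: h1; apply: eq_integrable => // x _ /=.
rewrite mul0r !subr0 /dotp big1 ?cos0 ?mulr1// => i _; by rewrite mxE mul0r.
Qed.

End kernels.

(** * Functions with integrable derivatives and their Green representation *)

Section tame_functions.
Context {R : realType}.
Notation leb := (@lebesgue_rV R).
Notation mu := (@lebesgue_measure R).

(** What the inversion argument takes from [schwartz]. A bound by [cauchy_weight] implies
    integrability and, being a product over the coordinates, survives the freezing of one of them;
    all derivation sequences are kept so that the class is closed under [sub_partial2]. *)
Definition tame n (f : 'rV[R]_n -> R) : Prop := forall s : seq 'I_n,
  [/\ continuous (partials s f),
      forall i x, derivable (partials s f) x (delta_mx ord0 i) &
      exists M : R, forall x, `|partials s f x| <= M * cauchy_weight x].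

Definition sub_partial2 n (i : 'I_n) (f : 'rV[R]_n -> R) : 'rV[R]_n -> R :=
  fun x => f x - partials [:: i; i] f x.

(** [partials] applies the last index of the list first, so differentiating the argument appends on
    the right, and mixed partial derivatives never have to commute. *)
Lemma partials_rcons n s (i : 'I_n) (f : 'rV[R]_n -> R) :
  partials s (partials [:: i] f) = partials (rcons s i) f.
Proof. by rewrite /partials foldr_rcons. Qed.

Lemma tame_partial n i (f : 'rV[R]_n -> R) : tame f -> tame (partials [:: i] f).
Proof. by move=> tf s; rewrite partials_rcons; exact: tf. Qed.

Lemma tame_sub n (f g : 'rV[R]_n -> R) : tame f -> tame g ->
  tame (fun x => f x - g x).
Proof.
move=> tf tg.
have E s : partials s (fun x => f x - g x) = (fun x => partials s f x - partials s g x).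
  elim: s => [//|i s IH] /=; rewrite -/(partials s _) IH.
  apply/funext => x; rewrite deriveB//.
    by have [_ + _] := tf s; apply.
  by have [_ + _] := tg s; apply.
move=> s; rewrite E; have [c1 d1 [M1 b1]] := tf s; have [c2 d2 [M2 b2]] := tg s.
split.
- by move=> x; have c1x := c1 x; have c2x := c2 x; exact: cvgB c1x c2x.
- by move=> i x; have d1x := d1 i x; have d2x := d2 i x; exact: derivableB d1x d2x.
- by exists (M1 + M2) => x; rewrite mulrDl (le_trans (ler_normB _ _))// lerD.
Qed.

Lemma tame_sub_partial2 n i (f : 'rV[R]_n -> R) : tame f -> tame (sub_partial2 i f).
Proof.
move=> tf; apply: tame_sub => //.
by have := tame_partial i (tame_partial i tf).
Qed.

Let quotient_row_cons n a (f : 'rV[R]_n.+1 -> R) (i : 'I_n) v :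
  (fun h : R => h^-1 *: (((fun v => f (row_cons a v)) \o shift v) (h *: delta_mx ord0 i) -
    f (row_cons a v))) =
  (fun h : R => h^-1 *: ((f \o shift (row_cons a v)) (h *: delta_mx ord0 (lift ord0 i)) -
    f (row_cons a v))).
Proof. by apply/funext => h /=; rewrite row_cons_shift_tail. Qed.

Lemma derive_row_cons n a (f : 'rV[R]_n.+1 -> R) (i : 'I_n) v :
  'D_(delta_mx ord0 i) (fun v => f (row_cons a v)) v =
  'D_(delta_mx ord0 (lift ord0 i)) f (row_cons a v).
Proof. by rewrite /derive quotient_row_cons. Qed.

Lemma derivable_row_cons n a (f : 'rV[R]_n.+1 -> R) (i : 'I_n) v :
  derivable f (row_cons a v) (delta_mx ord0 (lift ord0 i)) ->
  derivable (fun v => f (row_cons a v)) v (delta_mx ord0 i).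
Proof. by rewrite /derivable quotient_row_cons. Qed.

Lemma is_derive_row_cons_head n t (f : 'rV[R]_n.+1 -> R) (v : 'rV[R]_n) :
  derivable f (row_cons t v) (delta_mx ord0 ord0) ->
  is_derive t 1 (fun t : R => f (row_cons t v)) ('D_(delta_mx ord0 ord0) f (row_cons t v)).
Proof.
move=> df.
have E : (fun h : R => h^-1 *: (((fun t : R => f (row_cons t v)) \o shift t) (h *: 1) -
    f (row_cons t v))) =
  (fun h : R => h^-1 *: ((f \o shift (row_cons t v)) (h *: delta_mx ord0 ord0) -
    f (row_cons t v))).
  by apply/funext => h /=; rewrite row_cons_shift_head.
by split; [rewrite /derivable E|rewrite /derive E].
Qed.

Lemma partials_row_cons n a (f : 'rV[R]_n.+1 -> R) (s : seq 'I_n) :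
  partials s (fun v => f (row_cons a v)) =
  (fun v => partials (map (lift ord0) s) f (row_cons a v)).
Proof.
elim: s => [//|i s IH] /=; rewrite -/(partials s _) IH.
by apply/funext => v; rewrite derive_row_cons.
Qed.

Lemma continuous_row_cons n a : continuous (@row_cons R n a).
Proof.
move=> v A /nbhs_ballP[e /= e0 eA]; apply/nbhs_ballP; exists e => //= w [_ vw].
apply: eA; split => // i j; rewrite (ord1 i).
have [l ->|->] := unliftP ord0 j; first by rewrite !row_consS; exact: vw.
by rewrite !row_cons0; exact: ballxx.
Qed.

Lemma continuous_row_cons_head n (v : 'rV[R]_n) : continuous (fun a : R => row_cons a v).
Proof.
move=> a A /nbhs_ballP[e /= e0 eA]; apply/nbhs_ballP; exists e => //= b ab.
apply: eA; split => // i j; rewrite (ord1 i).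
have [l ->|->] := unliftP ord0 j; first by rewrite !row_consS; exact: ballxx.
by rewrite !row_cons0.
Qed.

Lemma cauchy_weight_row_cons n a (v : 'rV[R]_n) :
  cauchy_weight (row_cons a v) = (1 + a ^+ 2)^-1 * cauchy_weight v.
Proof.
rewrite /cauchy_weight big_ord_recl row_cons0; congr (_ * _).
by apply: eq_bigr => i _; rewrite row_consS.
Qed.

Lemma resolvent_kernel_row_cons n a b (v w : 'rV[R]_n) :
  resolvent_kernel (row_cons a v) (row_cons b w) =
  2^-1 * expR (- `|a - b|) * resolvent_kernel v w.
Proof.
rewrite /resolvent_kernel big_ord_recl !row_cons0; congr (_ * _).
by apply: eq_bigr => i _; rewrite !row_consS.
Qed.

Lemma tame_row_cons n a (f : 'rV[R]_n.+1 -> R) : tame f ->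
  tame (fun v => f (row_cons a v)).
Proof.
move=> tf s; rewrite partials_row_cons; have [c1 d1 [M b1]] := tf (map (lift ord0) s).
split.
- by move=> v; apply: continuous_comp; [exact: continuous_row_cons|exact: c1].
- by move=> i v; apply: derivable_row_cons; exact: d1.
- exists `|M| => v; apply: (le_trans (b1 _)); rewrite cauchy_weight_row_cons.
  have w0 : 0 <= (1 + a ^+ 2)^-1 * cauchy_weight v.
    by rewrite mulr_ge0 ?cauchy_weight_ge0// invr_ge0 addr_ge0 ?sqr_ge0.
  apply: (le_trans (ler_wpM2r w0 (ler_norm M))); rewrite ler_wpM2l//.
  rewrite ler_piMl ?cauchy_weight_ge0// invf_le1 ?lerDl ?sqr_ge0//.
  by rewrite ltr_wpDr ?sqr_ge0.
Qed.

Lemma tame_bounded n (f : 'rV[R]_n -> R) : tame f ->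
  continuous f /\ exists2 M : R, 0 <= M & forall x, `|f x| <= M * cauchy_weight x.
Proof.
move=> /(_ [::])[/= c _ [M b]]; split => //; exists `|M| => // x.
by rewrite (le_trans (b x))// ler_wpM2r ?ler_norm// cauchy_weight_ge0.
Qed.

(** The operator [\prod_i (1 - d_i ^ 2)] over the indices of [s]. In this left fold the first index
    acts first, so the induction on the dimension meets [sub_partial2 ord0 f] as its new
    function. *)
Definition resolvent_op n (s : seq 'I_n) (f : 'rV[R]_n -> R) :=
  foldl (fun g i => sub_partial2 i g) f s.

Lemma tame_resolvent_op n s (f : 'rV[R]_n -> R) : tame f -> tame (resolvent_op s f).
Proof. by elim: s f => //= i s IH f tf; apply: IH; exact: tame_sub_partial2. Qed.

Lemma sub_partial2_row_cons n a (f : 'rV[R]_n.+1 -> R) (i : 'I_n) :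
  (fun v => sub_partial2 (lift ord0 i) f (row_cons a v)) =
  sub_partial2 i (fun v => f (row_cons a v)).
Proof. by apply/funext => v; rewrite /sub_partial2 partials_row_cons. Qed.

Lemma resolvent_op_row_cons n a (s : seq 'I_n) (f : 'rV[R]_n.+1 -> R) :
  (fun v => resolvent_op (map (lift ord0) s) f (row_cons a v)) =
  resolvent_op s (fun v => f (row_cons a v)).
Proof.
elim: s f => [//|i s IH] f.
have -> : resolvent_op (i :: s) (fun v => f (row_cons a v)) =
  resolvent_op s (sub_partial2 i (fun v => f (row_cons a v))) by [].
by rewrite -sub_partial2_row_cons -IH.
Qed.

Lemma measurable_resolvent_kernel d (T : measurableType d) n (x z : T -> 'rV[R]_n) :
  measurable_fun setT x -> measurable_fun setT z ->
  measurable_fun setT (fun t => resolvent_kernel (x t) (z t)).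
Proof.
move=> mx mz; apply: measurable_prod => i _; apply: measurable_funM => //.
apply: (measurableT_comp (continuous_measurable_fun (@continuous_expR R))); apply: measurable_funN.
apply: measurableT_comp => //; apply: measurable_funB.
  by apply: (measurableT_comp (measurable_rV_coord i) mx).
by apply: (measurableT_comp (measurable_rV_coord i) mz).
Qed.

(** Induction on the dimension. With the first coordinate frozen at [a], the induction hypothesis
    integrates out the others and leaves [(1 - d_0 ^ 2) f] at [row_cons a v0]; the remaining
    integral in [a] is the one-dimensional formula. *)
Lemma resolvent_representation n (f : 'rV[R]_n -> R) : tame f -> forall x,
  (leb n).-integrable setT
    (EFin \o (fun z => resolvent_kernel x z * resolvent_op (enum 'I_n) f z)) /\
  \int[leb n]_z (resolvent_kernel x z * resolvent_op (enum 'I_n) f z) = f x.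
Proof.
elim: n f => [|n IH] f tf x.
  have [|i1 e1] := @integral_lebesgue_rV0 R
      (fun z => resolvent_kernel x z * resolvent_op (enum 'I_0) f z).
    apply: measurable_funM; last first.
      apply: continuous_measurable_rV.
      by have [] := tame_bounded (tame_resolvent_op (enum 'I_0) tf).
    by apply: measurable_resolvent_kernel => //; exact: measurable_cst.
  split => //; rewrite e1 /resolvent_kernel big_ord0 mul1r.
  have -> : enum 'I_0 = [::] by apply/size0nil; rewrite size_enum_ord.
  by congr f; apply/rowP; case.
set w := sub_partial2 ord0 f.
have tw : tame w by exact: tame_sub_partial2.
have L : resolvent_op (enum 'I_n.+1) f = resolvent_op (map (lift ord0) (enum 'I_n)) w.
  by rewrite enum_ordSl.
have tL : tame (resolvent_op (enum 'I_n.+1) f) by exact: tame_resolvent_op.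
have [cL [M M0 bL]] := tame_bounded tL.
have mL := continuous_measurable_rV cL.
pose a0 := x ord0 ord0; pose v0 : 'rV[R]_n := \row_i x ord0 (lift ord0 i).
have x0 : x = row_cons a0 v0 by rewrite row_consK.
set G := fun z => resolvent_kernel x z * resolvent_op (enum 'I_n.+1) f z.
have mG : measurable_fun setT G.
  by apply: measurable_funM => //; apply: measurable_resolvent_kernel => //; exact: measurable_cst.
have GE a v : G (row_cons a v) = 2^-1 * expR (- `|a0 - a|) *
    (resolvent_kernel v0 v * resolvent_op (enum 'I_n) (fun v => w (row_cons a v)) v).
  rewrite /G x0 resolvent_kernel_row_cons -[LHS]mulrA; congr (_ * (_ * _)).
  by rewrite L -[LHS]/((fun v => _) v) resolvent_op_row_cons.
have i1 : mu.-integrable setT (EFin \o (fun a => 2^-1 * expR (- `|a0 - a|))).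
  have := integrableZl measurableT 2^-1 (integrable_expdecay ltr01 a0).
  by apply: eq_integrable => // a _ /=; rewrite mul1r.
have i2 : (leb n).-integrable setT (EFin \o (fun v => M * resolvent_kernel v0 v)).
  have := integrableZl measurableT M (integrable_resolvent_kernel v0).1.
  by apply: eq_integrable => // a _ /=; rewrite resolvent_kernelC.
have iG : (mu \x leb n)%E.-integrable setT (EFin \o (fun p => G (row_cons p.1 p.2))).
  apply: (integrable_prod_dom _ i1 i2).
  - exact: measurableT_comp (@measurable_row_cons R n).
  - by move=> a; rewrite mulr_ge0 ?expR_ge0.
  - move=> a v /=; rewrite /G x0 resolvent_kernel_row_cons normrM -mulrA [M * _]mulrC mulrA.
    rewrite ger0_norm; last by rewrite !mulr_ge0 ?expR_ge0 ?resolvent_kernel_ge0.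
    rewrite [leRHS]mulrA ler_wpM2l ?mulr_ge0 ?expR_ge0 ?resolvent_kernel_ge0//.
    apply: (le_trans (bL _)); rewrite ler_piMr//; exact: cauchy_weight_le1.
have [j1 ->] := Rintegral_lebesgue_cons mG iG; split => //.
pose g t := f (row_cons t v0).
pose g1 t := 'D_(delta_mx ord0 ord0) f (row_cons t v0).
pose g2 t := partials [:: ord0; ord0] f (row_cons t v0).
have [_ d0 [B0 b0]] := tf [::].
have [_ d1 [B1 b1]] := tf [:: ord0].
have [c2 _ [B2 b2]] := tf [:: ord0; ord0].
have dg (t : R) : is_derive t 1 g (g1 t) by apply: is_derive_row_cons_head; exact: d0.
have dg1 (t : R) : is_derive t 1 g1 (g2 t).
  exact: (@is_derive_row_cons_head _ t (partials [:: ord0] f) v0 (d1 _ _)).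
have cg2 : continuous g2.
  by move=> t; apply: continuous_comp; [exact: continuous_row_cons_head|exact: c2].
pose B := `|B0| + `|B1| + `|B2|.
have bw (c y : R) z : `|y| <= c * cauchy_weight (z : 'rV[R]_n.+1) -> `|y| <= `|c|.
  move=> /le_trans; apply; apply: (le_trans (ler_wpM2r (cauchy_weight_ge0 z) (ler_norm c))).
  by rewrite ler_piMr// cauchy_weight_le1.
have gB t : `|g t| <= B by rewrite (le_trans (bw _ _ _ (b0 _)))// /B -addrA lerDl addr_ge0.
have g1B t : `|g1 t| <= B.
  by rewrite (le_trans (bw _ _ _ (b1 _)))// /B addrAC lerDr addr_ge0.
have g2B t : `|g2 t| <= B by rewrite (le_trans (bw _ _ _ (b2 _)))// /B lerDr addr_ge0.
have [ie ee] := Rintegral_expdecay ltr01 a0 dg dg1 cg2 gB g1B g2B.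
(* The value given by [Rintegral_expdecay] with parameter 1, times the normalisation 1/2 of the
   kernel. *)
have -> : f x = 2^-1 * (2 * 1 * g a0) by rewrite /g -x0; field.
rewrite -ee -(RintegralZl _ measurableT ie); apply: eq_Rintegral => a _.
have [ia ea] := IH _ (tame_row_cons a tw) v0.
under eq_Rintegral do rewrite GE.
rewrite (RintegralZl _ measurableT ia) ea mul1r -mulrA; congr (_ * (_ * _)).
by rewrite expr1n mul1r.
Qed.

End tame_functions.

(** * The inversion formula for tame, hence for Schwartz functions *)

Section fourier_inversion.
Context {R : realType}.
Notation leb := (@lebesgue_rV R).
Notation normc := ComplexField.Normc.normc.

Lemma cintegral_real d (T : measurableType d) (m : {measure set T -> \bar R}) (f : T -> R) :
  m.-integrable setT (EFin \o f) ->
  cintegrable m setT (fun x => (f x)%:C) /\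
  cintegral m setT (fun x => (f x)%:C) = (\int[m]_x f x)%:C.
Proof.
move=> jf; split; first by split => //; exact: integrable0.
by apply: complex_eqP => //=; rewrite Rintegral_cst// mul0r.
Qed.

Section product.
Context {d1 d2 : measure_display} {T1 : measurableType d1} {T2 : measurableType d2}.
Context (m1 : {sigma_finite_measure set T1 -> \bar R}).
Context (m2 : {sigma_finite_measure set T2 -> \bar R}).
Implicit Type f : T1 * T2 -> R[i].

Lemma cintegrable_prod_dom f (g1 : T1 -> R) (g2 : T2 -> R) : cmeasurable f ->
  m1.-integrable setT (EFin \o g1) -> m2.-integrable setT (EFin \o g2) ->
  (forall x, 0 <= g1 x) -> (forall x y, normc (f (x, y)) <= g1 x * g2 y) ->
  cintegrable (m1 \x m2)%E setT f.
Proof.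
move=> [mR mI] i1 i2 g10 fg; split; apply: (integrable_prod_dom _ i1 i2) => // x y.
  exact: le_trans (normr_Re_le _) (fg x y).
exact: le_trans (normr_Im_le _) (fg x y).
Qed.

(** For dominating functions that do not split into a product over the two variables, such as
    [resolvent_kernel x z] times the modulus of [u z]. *)
Lemma cintegrable_prod_section f (k : T1 -> T2 -> R) (h : T2 -> R) : cmeasurable f ->
  (forall x y, normc (f (x, y)) <= k x y) ->
  (forall y, m1.-integrable setT (EFin \o k ^~ y)) ->
  (forall y, \int[m1]_x k x y <= h y) -> m2.-integrable setT (EFin \o h) ->
  cintegrable (m1 \x m2)%E setT f.
Proof.
move=> [mR mI] fk ik kh ih.
have H (g : T1 * T2 -> R) y : measurable_fun setT g ->
    (forall x, `|g (x, y)| <= normc (f (x, y))) ->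
    (\int[m1]_x `|g (x, y)|%:E <= (h y)%:E)%E.
  move=> mg gf; apply: (@le_trans _ _ (\int[m1]_x k x y)%:E); last by rewrite lee_fin.
  rewrite /Rintegral fineK; last exact: (integrable_fin_num measurableT (ik y)).
  apply: ge0_le_integral => //=.
  - apply/measurable_EFinP; apply: measurableT_comp => //.
    exact: (measurableT_comp mg).
  - exact: measurable_int (ik y).
  - by move=> x _; rewrite lee_fin (le_trans (gf x)).
split.
  apply: (integrable_prod_section (h := h)) => // y.
  apply: (H (fun z => complex.Re (f z))) => // x; exact: normr_Re_le.
apply: (integrable_prod_section (h := h)) => // y.
apply: (H (fun z => complex.Im (f z))) => // x; exact: normr_Im_le.
Qed.

End product.

Lemma measurable_dotp2 d (T : measurableType d) n (x z : T -> 'rV[R]_n) :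
  measurable_fun setT x -> measurable_fun setT z ->
  measurable_fun setT (fun t => dotp (x t) (z t)).
Proof.
move=> mx mz; apply: measurable_sum => i; apply: measurable_funM.
  by apply: (measurableT_comp (measurable_rV_coord i) mx).
by apply: (measurableT_comp (measurable_rV_coord i) mz).
Qed.

Lemma dotpBl n (x y z : 'rV[R]_n) : dotp (x - y) z = dotp x z - dotp y z.
Proof. by rewrite /dotp -sumrB; apply: eq_bigr => i _; rewrite !mxE mulrBl. Qed.

Lemma measurable_cauchy_weight n : measurable_fun setT (@cauchy_weight R n).
Proof. by have /measurable_int/measurable_EFinP := @integrable_cauchy_weight R n. Qed.

Section inversion.
Context {n : nat} (f : 'rV[R]_n -> R).
Hypothesis f_tame : tame f.

Let u := resolvent_op (enum 'I_n) f.

Let u_tame : tame u. Proof. exact: tame_resolvent_op. Qed.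

Let mu_ : measurable_fun setT u.
Proof. by apply: continuous_measurable_rV; have [] := tame_bounded u_tame. Qed.

Let u_integrable : (leb n).-integrable setT (EFin \o u).
Proof.
have [_ [M M0 b]] := tame_bounded u_tame.
apply: (integrable_dom measurableT mu_
  (integrableZl measurableT M (@integrable_cauchy_weight R n))).
by move=> x _; exact: b.
Qed.

Let mfst : measurable_fun setT (fst : 'rV[R]_n * 'rV[R]_n -> 'rV[R]_n).
Proof. exact: measurable_fst. Qed.

Let msnd : measurable_fun setT (snd : 'rV[R]_n * 'rV[R]_n -> 'rV[R]_n).
Proof. exact: measurable_snd. Qed.

(** [resolvent_representation] is inserted for [f x] and the kernel is transformed in [x]. The gain
    is the factor [cauchy_weight b], which makes the transform of [f] integrable. *)
Let fourier_integral b :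
  cintegral (leb n) setT (fun x => expi (- dotp x b) * (f x)%:C) =
  cintegral (leb n) setT (fun z => (u z * cauchy_weight b)%:C * expi (- dotp z b)).
Proof.
pose G (p : 'rV[R]_n * 'rV[R]_n) : R[i] :=
  (resolvent_kernel p.1 p.2 * u p.2)%:C * expi (- dotp p.1 b).
have mG : cmeasurable G.
  apply: cmeasurableM.
    apply: cmeasurable_real; apply: measurable_funM; last exact: (measurableT_comp mu_).
    exact: measurable_resolvent_kernel.
  apply: cmeasurable_expi; apply: measurable_funN.
  by apply: measurable_dotp2 => //; exact: measurable_cst.
have iG : cintegrable (leb n \x leb n)%E setT G.
  apply: (@cintegrable_prod_section _ _ _ _ _ _ _ (fun x z => resolvent_kernel x z * `|u z|)
      (fun z => `|u z|)) => //.
  - move=> x z; rewrite ComplexField.Normc.normcM normc_expi normc_real mulr1 normrM.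
    by rewrite ger0_norm// resolvent_kernel_ge0.
  - move=> z; have := integrableZl measurableT `|u z| (integrable_resolvent_kernel z).1.
    by apply: eq_integrable => // x _ /=; rewrite mulrC.
  - move=> z; have [h1 h2] := integrable_resolvent_kernel z.
    by rewrite (RintegralZr _ measurableT h1) h2 mul1r.
  - exact: integrable_norm u_integrable.
transitivity (cintegral (leb n) setT (fun x => cintegral (leb n) setT (fun z => G (x, z)))).
  congr cintegral; apply/funext => x.
  have [i1 e1] := resolvent_representation f_tame x.
  have [ci ce] := cintegral_real i1.
  have [_ h] := cintegralZl (expi (- dotp x b)) ci.
  rewrite -e1 -ce -h; congr cintegral; apply/funext => z.
  by rewrite /G /= mulrC.
rewrite (cFubini iG); congr cintegral; apply/funext => z.
have [ck ek] := resolvent_kernel_char z b.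
have [_ h] := cintegralZl (u z)%:C ck.
rewrite rmorphM -mulrA -ek -h; congr cintegral; apply/funext => x.
by rewrite /G /= rmorphM mulrA [(u z)%:C * _]mulrC.
Qed.

Let fourierE b : fourier f b = (fourier_cst R n)%:C *
  cintegral (leb n) setT (fun z => (u z * cauchy_weight b)%:C * expi (- dotp z b)).
Proof. by rewrite /fourier fourier_integral. Qed.

(** The integrand of the inversion formula once [fourierE] is inserted; the weight in [p.1] and the
    decay of [u] in [p.2] make it absolutely integrable. *)
Let W (y : 'rV[R]_n) (p : 'rV[R]_n * 'rV[R]_n) : R[i] :=
  (u p.2 * cauchy_weight p.1)%:C * expi (dotp (y - p.2) p.1).

Let W_integrable y : cintegrable (leb n \x leb n)%E setT (W y).
Proof.
apply: (cintegrable_prod_dom (g1 := @cauchy_weight R n) (g2 := fun z => `|u z|)).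
- apply: cmeasurableM.
    apply: cmeasurable_real; apply: measurable_funM; first exact: (measurableT_comp mu_).
    exact: (measurableT_comp (@measurable_cauchy_weight n)).
  apply: cmeasurable_expi.
  under eq_fun do rewrite dotpBl; apply: measurable_funB; last exact: measurable_dotp2.
  by apply: measurable_dotp2 => //; exact: measurable_cst.
- exact: integrable_cauchy_weight.
- exact: integrable_norm u_integrable.
- exact: cauchy_weight_ge0.
- move=> b z; rewrite ComplexField.Normc.normcM normc_expi normc_real mulr1 normrM.
  by rewrite mulrC ger0_norm// cauchy_weight_ge0.
Qed.

Let W_section y b : cintegral (leb n) setT (fun z => W y (b, z)) =
  expi (dotp y b) * cintegral (leb n) setT
    (fun z => (u z * cauchy_weight b)%:C * expi (- dotp z b)).
Proof.
have ci : cintegrable (leb n) setT (fun z => (u z * cauchy_weight b)%:C * expi (- dotp z b)).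
  apply: (cintegrable_dom (g := fun z => cauchy_weight b * `|u z|)).
  - apply: cmeasurableM; first by apply: cmeasurable_real; exact: measurable_funM.
    apply: cmeasurable_expi; apply: measurable_funN; exact: measurable_dotp2.
  - exact: integrableZl (integrable_norm u_integrable).
  - move=> z; rewrite ComplexField.Normc.normcM normc_expi normc_real mulr1 normrM.
    by rewrite mulrC ger0_norm// cauchy_weight_ge0.
have [_ <-] := cintegralZl (expi (dotp y b)) ci.
congr cintegral; apply/funext => z; rewrite /W /= dotpBl expiD.
by rewrite mulrCA mulrA.
Qed.

(** Up to a constant the transform is the partial integral of [W 0] over its second variable, so
    Fubini's theorem applies. *)
Lemma fourier_integrable : cintegrable (leb n) setT (fourier f).
Proof.
have h := cintegrable_fubini (W_integrable 0).
have [+ _] := cintegralZl (fourier_cst R n)%:C h.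
congr cintegrable; apply/funext => b.
rewrite W_section fourierE /dotp big1 ?expi0 ?mul1r// => i _.
by rewrite mxE mul0r.
Qed.

(** After the exchange, the integral in [b] is the transform of the weight, namely [(2 * pi) ^+ n]
    times the kernel at [y], and [resolvent_representation] returns [f y]. [fourier_cst] occurs
    twice, once in [fourier], and [c2] cancels the constants. *)
Lemma fourier_inversion y : (f y)%:C = (fourier_cst R n)%:C *
  cintegral (leb n) setT (fun b => expi (dotp y b) * fourier f b).
Proof.
have c2 : fourier_cst R n ^+ 2 * (2 * pi) ^+ n = 1.
  have p0 : 0 < 2 * pi :> R by rewrite mulr_gt0// pi_gt0.
  rewrite /fourier_cst -powR_mulrn ?powR_ge0// -powRrM -powR_mulrn ?ltW//.
  rewrite -powRD; last by apply/implyP => _; rewrite gt_eqF.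
  by rewrite mulNr divfK// addNr powRr0.
have E b : expi (dotp y b) * fourier f b =
    (fourier_cst R n)%:C * cintegral (leb n) setT (fun z => W y (b, z)).
  by rewrite fourierE W_section mulrCA.
under eq_fun do rewrite E.
have [_ ->] := cintegralZl (fourier_cst R n)%:C (cintegrable_fubini (W_integrable y)).
rewrite (cFubini (W_integrable y)).
have [ir er] := resolvent_representation f_tame y.
have E2 z : cintegral (leb n) setT (fun b => W y (b, z)) =
    ((2 * pi) ^+ n)%:C * (resolvent_kernel y z * u z)%:C.
  have [cc ec] := cauchy_weight_char y z.
  have [_ h] := cintegralZl (u z)%:C cc.
  rewrite mulrC -rmorphM/= mulrAC [_ * u z]mulrC rmorphM/= [resolvent_kernel _ _ * _]mulrC -ec -h.
  by congr cintegral; apply/funext => b; rewrite /W /= rmorphM mulrA.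
under [X in _ = _ * (_ * cintegral _ _ X)]eq_fun do rewrite E2.
have [ci ei] := cintegral_real ir.
have [_ ->] := cintegralZl ((2 * pi) ^+ n)%:C ci.
by rewrite ei er !mulrA -!rmorphM/= -expr2 c2 mul1r.
Qed.

End inversion.

Lemma schwartz_tame n (f : 'rV[R]_n -> R) : schwartz f -> tame f.
Proof.
move=> sf s; have [c d1 b] := sf s; split => //.
(* The inverse of the weight is expanded one factor at a time: [1 + x_j ^ 2] either keeps a monomial
   or raises its exponent in [j] by 2, and [schwartz] bounds every monomial. *)
have H (l : seq 'I_n) (a : 'I_n -> nat) : exists M : R, forall x : 'rV[R]_n,
    (\prod_(i <- l) (1 + x ord0 i ^+ 2)) *
      `|(\prod_i x ord0 i ^+ a i) * partials s f x| <= M.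
  elim: l a => [|j l IH] a.
    by have [M bM] := b a; exists M => x; rewrite big_nil mul1r.
  have [M1 b1] := IH a; have [M2 b2] := IH (fun i => (a i + (i == j) * 2)%N).
  exists (M1 + M2) => x; rewrite big_cons mulrDl mul1r mulrDl lerD//.
  apply: le_trans (b2 x); rewrite le_eqVlt; apply/predU1P; left.
  have -> : \prod_i x ord0 i ^+ (a i + (i == j) * 2) =
      (\prod_i x ord0 i ^+ a i) * x ord0 j ^+ 2.
    under eq_bigr do rewrite exprD.
    rewrite big_split/=; congr (_ * _); rewrite (bigD1 j)//= eqxx mul1n.
    by rewrite big1 ?mulr1// => i /negPf ->; rewrite mul0n expr0.
  rewrite [x ord0 j ^+ 2 * _]mulrC -[LHS]mulrA; congr (_ * _).
  by rewrite -{1}(ger0_norm (sqr_ge0 (x ord0 j))) -normrM mulrCA mulrA.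
have [M bM] := H (index_enum _) (fun=> 0%N).
exists M => x; have := bM x.
rewrite [X in `|X * _|]big1 ?mul1r => [|i _]; last by rewrite expr0.
have p0 : 0 < \prod_(i < n) (1 + x ord0 i ^+ 2).
  by apply: prodr_gt0 => i _; rewrite ltr_wpDr ?sqr_ge0.
by rewrite mulrC -ler_pdivlMr// /cauchy_weight prodfV.
Qed.

End fourier_inversion.

(** * The symbol *)

Section dominated.
Context {R : realType} {d : measure_display} {T : measurableType d}.

Lemma cdominated_cvg (m : {measure set T -> \bar R}) (f_ : nat -> T -> R[i])
    (f : T -> R[i]) (g : T -> R) : (forall n, cmeasurable (f_ n)) ->
  (forall x, complex.Re (f_ n x) @[n --> \oo] --> complex.Re (f x)) ->
  (forall x, complex.Im (f_ n x) @[n --> \oo] --> complex.Im (f x)) ->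
  m.-integrable setT (EFin \o g) ->
  (forall n x, ComplexField.Normc.normc (f_ n x) <= g x) ->
  complex.Re (cintegral m setT (f_ n)) @[n --> \oo] --> complex.Re (cintegral m setT f) /\
  complex.Im (cintegral m setT (f_ n)) @[n --> \oo] --> complex.Im (cintegral m setT f).
Proof.
move=> mf cR cI ig fg; split; apply: (Rdominated_cvg _ _ _ ig) => //.
- by move=> n; have [] := mf n.
- by move=> n x _; exact: le_trans (normr_Re_le _) (fg n x).
- by move=> n; have [] := mf n.
- by move=> n x _; exact: le_trans (normr_Im_le _) (fg n x).
Qed.

End dominated.

(** Dominated convergence is about sequences, so continuity in [xi] is tested on sequences that
    converge coordinatewise. *)
Lemma seq_continuous_rV {R : realType} n (f : 'rV[R]_n -> R) :
  (forall (u : nat -> 'rV[R]_n) (v : 'rV[R]_n), (forall i, u k ord0 i @[k --> \oo] --> v ord0 i) ->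
    f (u k) @[k --> \oo] --> f v) -> continuous f.
Proof.
move=> H v A /nbhs_ballP[e /= e0 eA]; apply: contrapT => nA.
have W k : exists w : 'rV[R]_n, ball v k.+1%:R^-1 w /\ ~ ball (f v) e (f w).
  apply: contrapT => h; apply: nA; apply/nbhs_ballP; exists k.+1%:R^-1 => /=.
    by rewrite invr_gt0.
  move=> w bw; apply: eA; apply: contrapT => nb; apply: h; by exists w.
pose u k := sval (cid (W k)).
have [bu nb] : (forall k, ball v k.+1%:R^-1 (u k)) /\ (forall k, ~ ball (f v) e (f (u k))).
  by split => k; have [] := svalP (cid (W k)).
have cu i : u k ord0 i @[k --> \oo] --> v ord0 i.
  apply/cvgrPdist_lt => e' e'0; have [N HN] := ltr_add_invr e'0; rewrite add0r in HN.
  exists N => // k /= Nk; have [_ /(_ ord0 i)] := bu k; rewrite /ball/= => /lt_trans; apply.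
  by apply: le_lt_trans HN; rewrite lef_pV2 ?posrE// ler_nat.
have /cvgrPdist_lt/(_ _ e0)[N _ HN] := H u v cu.
exact: (nb N (HN N (leqnn N))).
Qed.

Section symbol.
Context {R : realType} {d k : nat} {disp : measure_display}.
Context {Omega : measurableType disp}.
Context (P : 'rV[R]_d -> probability Omega R).
Context (F : 'rV[R]_k -> set (set Omega)).
Context (X : 'rV[R]_k -> Omega -> 'rV[R]_d).
Context (T : 'rV[R]_k -> ('rV[R]_d -> R) -> 'rV[R]_d -> R).
Context (pi12 : R -> R -> probability 'rV[R]_k R).
Context (p : R -> R -> 'rV[R]_d -> probability 'rV[R]_d R).
Context (c : 'rV[R]_k) (nu : {measure set 'rV[R]_k -> \bar R}) (t : R).
Hypothesis X_markov : homogeneous_markov P F X T.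
Hypothesis T_C0 : C0_semigroup T.
Hypothesis p_mixed : mixed_transition P X pi12 p.
Hypothesis t_ge0 : 0 <= t.
Hypothesis nu_levy : levy_measure nu.
Hypothesis Y_generator : forall f : 'rV[R]_d -> R, (forall j, gen_domain T j f) ->
  unif_cvg 0^'+ (right_quotient (evolution T pi12) t f) (subordinate_generator T c nu f).
Context (x : 'rV[R]_d).
Notation normc := ComplexField.Normc.normc.
Implicit Types (f g : 'rV[R]_d -> R) (h : R).

Let rq f h := right_quotient (evolution T pi12) t f h x.
Let G f := subordinate_generator T c nu f x.

Let rqE f h : 0 < h -> bounded_borel f ->
  rq f h = h^-1 * (\int[p t (t + h) x]_y f y - f x).
Proof.
move=> h0 bf; rewrite /rq /right_quotient.
rewrite (evolution_integral X_markov T_C0 x p_mixed)//.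
by rewrite lerDl ltW.
Qed.

Let rq_cvg f : bounded_borel f -> rq f h @[h --> 0^'+] --> G f.
Proof.
move=> bf; have gf j := bounded_borel_gen_domain X_markov T_C0 j bf.
apply/cvgrPdist_le => e e0; have := Y_generator gf e0.
by apply: filterS => h /(_ x); rewrite distrC.
Qed.

Let integrable_p f h : bounded_borel f -> (p t (t + h) x).-integrable setT (EFin \o f).
Proof.
move=> [mf [M fM]]; apply: (integrable_dom (g := fun=> M)) => //.
exact: finite_measure_integrable_cst.
Qed.

Let rq_linear (a : R) f g h : 0 < h -> bounded_borel f -> bounded_borel g ->
  rq (fun y => a * f y + g y) h = a * rq f h + rq g h.
Proof.
move=> h0 bf bg; rewrite !rqE//; last exact: bounded_borel_linear.
have i1 := integrable_p h bf; have i2 := integrableZl measurableT a i1.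
rewrite (RintegralD measurableT i2 (integrable_p h bg)) (RintegralZl _ measurableT i1).
by ring.
Qed.

(** Linearity is inherited from the quotients, whose limit [G] is; the generator formula stays
    folded. *)
Let G_linear (a : R) f g : bounded_borel f -> bounded_borel g ->
  G (fun y => a * f y + g y) = a * G f + G g.
Proof.
move=> bf bg; apply: (@cvg_unique _ _ (rq (fun y => a * f y + g y) h @[h --> 0^'+])).
- exact: norm_hausdorff.
- by apply: rq_cvg; exact: bounded_borel_linear.
- have : a * rq f h + rq g h @[h --> 0^'+] --> a * G f + G g.
    by apply: cvgD; [apply: cvgMr; exact: rq_cvg|exact: rq_cvg].
  apply: cvg_trans; apply: near_eq_cvg; near=> h; rewrite rq_linear//.
Unshelve. all: by end_near. Qed.

Let bounded_borel_cst (a : R) : bounded_borel (fun _ : 'rV[R]_d => a).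
Proof. by split; [exact: measurable_cst|exists `|a|]. Qed.

Let G_cst (a : R) : G (fun=> a) = 0.
Proof.
apply: (@cvg_unique _ _ (rq (fun=> a) h @[h --> 0^'+])).
- exact: norm_hausdorff.
- exact: rq_cvg.
- have : (0 : R) @[h --> (0 : R)^'+] --> (0 : R) by exact: cvg_cst.
  apply: cvg_trans; apply: near_eq_cvg; near=> h.
  by rewrite rqE// Rintegral_cst_probability subrr mulr0.
Unshelve. all: by end_near. Qed.

(** Positive maximum principle, at a minimum: since [f x = 0], each quotient is the integral of a
    nonnegative function divided by [h]. *)
Let G_ge0 f : bounded_borel f -> (forall y, 0 <= f y) -> f x = 0 -> 0 <= G f.
Proof.
move=> bf f0 fx; have := rq_cvg bf => /cvgr_to_ge; apply.
near=> h; rewrite rqE// fx subr0 mulr_ge0//; last exact: Rintegral_ge0.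
by rewrite invr_ge0 ltW.
Unshelve. all: by end_near. Qed.

Let bx : bounded_borel (\1_[set x] : 'rV[R]_d -> R).
Proof. exact: (bounded_borel_indic (measurable_set1_rV x)). Qed.

(** The integral of [f y - f x] is at most [2 * M] times the mass off [{x}], and that mass divided
    by [h] is minus the quotient of [\1_[set x]]. *)
Let rq_bound f M h : 0 < h -> bounded_borel f -> (forall y, `|f y| <= M) ->
  `|rq f h| <= 2 * M * `|rq \1_[set x] h|.
Proof.
move=> h0 bf fM; rewrite !rqE//.
have M0 : 0 <= M by exact: le_trans (normr_ge0 _) (fM x).
rewrite !normrM mulrCA ler_wpM2l//.
set Q := p t (t + h) x.
have -> : \int[Q]_y f y - f x = \int[Q]_y (f y - f x).
  by rewrite RintegralB ?Rintegral_cst_probability//; exact: integrable_p.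
have -> : \int[Q]_y \1_[set x] y - \1_[set x] x = - \int[Q]_y (1 - \1_[set x] y).
  rewrite RintegralB ?Rintegral_cst_probability//; first by rewrite indicE mem_set// opprB.
    exact: (integrable_p h (bounded_borel_cst 1)).
  exact: (integrable_p h bx).
rewrite normrN.
have b1 : bounded_borel (fun y => 1 - \1_[set x] y) by exact: bounded_borelB.
have i1 := integrable_p h b1.
apply: (@le_trans _ _ (\int[Q]_y (2 * M * (1 - \1_[set x] y)))).
  apply: le_normr_Rintegral_dom => //.
  - by apply: measurable_funB => //; exact: bf.1.
  - exact: integrableZl i1.
  - move=> y _; rewrite indicE; have [/set_mem ->|_] := boolP (y \in [set x]).
      by rewrite !subrr normr0 mulr0.
    by rewrite subr0 mulr1 (le_trans (ler_normB _ _))// mulrDl mul1r lerD.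
rewrite (RintegralZl _ measurableT i1) ler_wpM2l ?mulr_ge0//; exact: ler_norm.
Qed.

Let h_ (n : nat) : R := n.+1%:R^-1.

Let h_gt0 n : 0 < h_ n. Proof. by rewrite invr_gt0. Qed.

Let rq_seq f : bounded_borel f -> rq f (h_ n) @[n --> \oo] --> G f.
Proof.
move=> bf; have /cvg_at_rightP := rq_cvg bf; apply; split => //; exact: cvg_harmonic.
Qed.

(** The quotients of the single function [\1_[set x]] converge and are therefore bounded. By
    [rq_bound] they control all functions bounded by 1; for cosines and sines this is uniformity in
    [xi]. *)
Let rq_seq_bound : exists2 K : R, 0 <= K & forall f n, bounded_borel f ->
  (forall y, `|f y| <= 1) -> `|rq f (h_ n)| <= K.
Proof.
have /cvg_seq_bounded[M0 [_ HM]] := cvgP _ (rq_seq bx).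
have HM' : forall n, `|rq \1_[set x] (h_ n)| <= `|M0| + 1.
  by move=> n; apply: HM => //; rewrite ltr_pwDr// ler_norm.
exists (2 * 1 * (`|M0| + 1)); first by rewrite !mulr_ge0// addr_ge0.
move=> f n bf f1; apply: (le_trans (rq_bound (h_gt0 n) bf f1)).
by rewrite ler_wpM2l.
Qed.

Let G_bound : exists2 K : R, 0 <= K & forall f, bounded_borel f ->
  (forall y, `|f y| <= 1) -> `|G f| <= K.
Proof.
have [K K0 HK] := rq_seq_bound; exists K => // f bf f1.
apply: (cvgr_to_le (cvg_norm (rq_seq bf))).
by apply: nearW => n; exact: HK.
Qed.

Let cbounded (f : 'rV[R]_d -> R[i]) : Prop :=
  bounded_borel (fun y => complex.Re (f y)) /\ bounded_borel (fun y => complex.Im (f y)).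

Let CG (f : 'rV[R]_d -> R[i]) : R[i] :=
  (G (fun y => complex.Re (f y))) +i* (G (fun y => complex.Im (f y))).

Let cbounded_linear (a : R[i]) (f g : 'rV[R]_d -> R[i]) :
  cbounded f -> cbounded g -> cbounded (fun y => a * f y + g y).
Proof.
move=> [f1 f2] [g1 g2].
have E1 y : complex.Re (a * f y + g y) =
    complex.Re a * complex.Re (f y) + (- complex.Im a * complex.Im (f y) + complex.Re (g y)).
  by rewrite addrA mulNr -complex_ReM; case: (a * f y) (g y) => ? ? [].
have E2 y : complex.Im (a * f y + g y) =
    complex.Re a * complex.Im (f y) + (complex.Im a * complex.Re (f y) + complex.Im (g y)).
  by rewrite addrA -complex_ImM; case: (a * f y) (g y) => ? ? [].
split.
  by under eq_fun do rewrite E1; do 2 apply: bounded_borel_linear => //.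
by under eq_fun do rewrite E2; do 2 apply: bounded_borel_linear => //.
Qed.

Let CG_linear (a : R[i]) (f g : 'rV[R]_d -> R[i]) : cbounded f -> cbounded g ->
  CG (fun y => a * f y + g y) = a * CG f + CG g.
Proof.
move=> [f1 f2] [g1 g2].
have E1 y : complex.Re (a * f y + g y) =
    complex.Re a * complex.Re (f y) + (- complex.Im a * complex.Im (f y) + complex.Re (g y)).
  by rewrite addrA mulNr -complex_ReM; case: (a * f y) (g y) => ? ? [].
have E2 y : complex.Im (a * f y + g y) =
    complex.Re a * complex.Im (f y) + (complex.Im a * complex.Re (f y) + complex.Im (g y)).
  by rewrite addrA -complex_ImM; case: (a * f y) (g y) => ? ? [].
rewrite /CG; under eq_fun do rewrite E1.
under [X in _ +i* G X]eq_fun do rewrite E2.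
rewrite !G_linear//; try exact: bounded_borel_linear.
by apply: complex_eqP; case: a {E1 E2} => ? ? /=; rewrite ?mulNr addrA.
Qed.

Let cbounded_cst (a : R[i]) : cbounded (fun=> a).
Proof. by split; exact: bounded_borel_cst. Qed.

Let CG_cst (a : R[i]) : CG (fun=> a) = 0.
Proof. by rewrite /CG !G_cst. Qed.

Let chr (xi y : 'rV[R]_d) : R[i] := expi (dotp xi (y - x)).

Let measurable_phase (xi : 'rV[R]_d) : measurable_fun setT (fun y : 'rV[R]_d => dotp xi (y - x)).
Proof.
apply: measurable_sum => i; apply: measurable_funM => //.
under eq_fun do rewrite !mxE; apply: measurable_funB => //.
exact: measurable_rV_coord.
Qed.

Let bounded_cos xi : bounded_borel (fun y => cos (dotp xi (y - x))).
Proof.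
by split; [exact: (cmeasurable_expi (measurable_phase xi)).1|exists 1 => y; exact: cos_max].
Qed.

Let bounded_sin xi : bounded_borel (fun y => sin (dotp xi (y - x))).
Proof.
by split; [exact: (cmeasurable_expi (measurable_phase xi)).2|exists 1 => y; exact: sin_max].
Qed.

Let cbounded_chr xi : cbounded (chr xi).
Proof. by split; [exact: bounded_cos|exact: bounded_sin]. Qed.

Let dotpxx xi : dotp xi (x - x) = 0.
Proof. by rewrite /dotp big1// => i _; rewrite subrr mxE mulr0. Qed.

Let symbol_quotientE xi h : 0 < h ->
  symbol_quotient p t x xi h =
    (rq (fun y => cos (dotp xi (y - x))) h) +i* (rq (fun y => sin (dotp xi (y - x))) h).
Proof.
move=> h0; rewrite !rqE// dotpxx cos0 sin0 subr0.
by apply: complex_eqP; rewrite /symbol_quotient /=; ring.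
Qed.

Let symbol_quotient_cvg xi : symbol_quotient p t x xi h @[h --> 0^'+] --> (CG (chr xi) : R[i]^o).
Proof.
apply: complex_cvg.
  have := rq_cvg (bounded_cos xi); apply: cvg_trans; apply: near_eq_cvg.
  by near=> h; rewrite symbol_quotientE.
have := rq_cvg (bounded_sin xi); apply: cvg_trans; apply: near_eq_cvg.
by near=> h; rewrite symbol_quotientE.
Unshelve. all: by end_near. Qed.

Let symbolE xi : symbol p t x xi = - CG (chr xi).
Proof.
rewrite /symbol; congr (- _); apply: cvg_lim; last exact: symbol_quotient_cvg.
exact: norm_hausdorff.
Qed.

Lemma symbol_quotient_is_cvg xi : cvg (symbol_quotient p t x xi h @[h --> 0^'+]).
Proof. by apply/cvg_ex; exists (CG (chr xi)); exact: symbol_quotient_cvg. Qed.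

Let phase_cvg (u : nat -> 'rV[R]_d) (v y : 'rV[R]_d) :
  (forall i, u n ord0 i @[n --> \oo] --> v ord0 i) ->
  dotp (u n) (y - x) @[n --> \oo] --> dotp v (y - x).
Proof.
move=> uv; apply: cvg_big => [|i _]; first exact: add_continuous.
apply: cvgMl; exact: uv.
Qed.

Let symbol_Re_continuous : continuous (fun xi => G (fun y => cos (dotp xi (y - x)))).
Proof.
apply: seq_continuous_rV => u v uv.
apply: (subordinate_generator_sigma_cvg (f_ := fun n y => cos (dotp (u n) (y - x)))
  (M := 1) X_markov T_C0 nu_levy).
- by move=> n; have [] := bounded_cos (u n).
- by move=> n y; exact: cos_max.
- exact: bounded_cos.
- by move=> y; exact: cos_max.
- move=> y; apply: continuous_cvg; first exact: continuous_cos.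
  exact: phase_cvg.
Qed.

Let symbol_Im_continuous : continuous (fun xi => G (fun y => sin (dotp xi (y - x)))).
Proof.
apply: seq_continuous_rV => u v uv.
apply: (subordinate_generator_sigma_cvg (f_ := fun n y => sin (dotp (u n) (y - x)))
  (M := 1) X_markov T_C0 nu_levy).
- by move=> n; have [] := bounded_sin (u n).
- by move=> n y; exact: sin_max.
- exact: bounded_sin.
- by move=> y; exact: sin_max.
- move=> y; apply: continuous_cvg; first exact: continuous_sin.
  exact: phase_cvg.
Qed.

Lemma continuous_symbol : continuous (symbol p t x).
Proof.
have -> : symbol p t x = (fun xi => - CG (chr xi)) by apply/funext => xi; exact: symbolE.
move=> xi; apply: (@complex_cvg _ _ (nbhs xi) _).
  by apply: cvgN; exact: symbol_Re_continuous.
by apply: cvgN; exact: symbol_Im_continuous.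
Qed.

Let CG_sum (I : Type) (r : seq I) (a : I -> R[i]) (f : I -> 'rV[R]_d -> R[i]) :
  (forall i, cbounded (f i)) ->
  cbounded (fun y => \sum_(i <- r) a i * f i y) /\
  CG (fun y => \sum_(i <- r) a i * f i y) = \sum_(i <- r) a i * CG (f i).
Proof.
move=> bf; elim: r => [|i r [IH1 IH2]].
  under eq_fun do rewrite big_nil.
  by rewrite big_nil CG_cst; split => //; exact: cbounded_cst.
under eq_fun do rewrite big_cons.
by split; [exact: cbounded_linear|rewrite CG_linear// IH2 big_cons].
Qed.

Let cbounded_conj (f : 'rV[R]_d -> R[i]) : cbounded f -> cbounded (fun y => (f y)^*).
Proof.
move=> [b1 b2]; have b0 := bounded_borel_cst 0.
split.
  by rewrite (_ : (fun y => _) = fun y => complex.Re (f y))//; apply/funext => y; case: (f y).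
rewrite (_ : (fun y => _) = fun y => -1 * complex.Im (f y) + 0); first exact: bounded_borel_linear.
by apply/funext => y; rewrite mulN1r addr0; case: (f y).
Qed.

Let CG_conj (f : 'rV[R]_d -> R[i]) : cbounded f -> CG (fun y => (f y)^*) = (CG f)^*.
Proof.
move=> [b1 b2]; apply: complex_eqP => /=.
  by congr G; apply/funext => y; case: (f y).
rewrite (_ : (fun y => _) = fun y => -1 * complex.Im (f y) + 0).
  by rewrite (G_linear _ b2 (bounded_borel_cst 0)) G_cst addr0 mulN1r.
by apply/funext => y; rewrite mulN1r addr0; case: (f y).
Qed.

(** Since [chr (xi - eta)] is [chr xi] times the conjugate of [chr eta], the product expands into
    the three characters plus the constant 1, which [CG] kills. The matrix becomes sesquilinear in
    functions that vanish at [x]. *)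
Let symbol_matrixE xi eta :
  - CG (chr xi) + (- CG (chr eta))^* - - CG (chr (xi - eta)) =
  CG (fun y => (chr xi y - 1) * (chr eta y - 1)^*) /\
  cbounded (fun y => (chr xi y - 1) * (chr eta y - 1)^*).
Proof.
have E y : (chr xi y - 1) * (chr eta y - 1)^* =
    1 * chr (xi - eta) y + (-1 * chr xi y + (-1 * (chr eta y)^* + 1)).
  rewrite /chr dotpBl expiD -conj_expi rmorphB rmorph1; ring.
have c1 := cbounded_cst 1; have c2 := cbounded_conj (cbounded_chr eta).
have c3 := cbounded_linear (-1) c2 c1.
have c4 := cbounded_linear (-1) (cbounded_chr xi) c3.
rewrite (_ : (fun y => _) = fun y =>
  1 * chr (xi - eta) y + (-1 * chr xi y + (-1 * (chr eta y)^* + 1))); last exact/funext.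
split; last exact: cbounded_linear.
rewrite !CG_linear// CG_conj// CG_cst rmorphN; ring.
Qed.

Lemma symbol_negative_definite : negative_definite (symbol p t x).
Proof.
have -> : (symbol p t x : _ -> R[i]) = (fun xi => - CG (chr xi)).
  by apply/funext => xi; exact: symbolE.
move=> n xi; split=> [l m|v].
  rewrite !mxE.
  have [-> _] := symbol_matrixE (xi m) (xi l).
  have [-> b2] := symbol_matrixE (xi l) (xi m).
  rewrite -CG_conj//; congr CG; apply/funext => y.
  by apply: complex_eqP; case: (chr _ _ - 1) => ? ?; case: (chr _ _ - 1) => ? ? /=; ring.
pose f (lm : 'I_n * 'I_n) y := (chr (xi lm.1) y - 1) * (chr (xi lm.2) y - 1)^*.
have bf lm : cbounded (f lm) by have [] := symbol_matrixE (xi lm.1) (xi lm.2).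
pose w y := \sum_l v l * (chr (xi l) y - 1).
have wf y : w y * (w y)^* = \sum_(lm <- index_enum _) (v lm.1 * (v lm.2)^*) * f lm y.
  rewrite /w rmorph_sum big_distrlr pair_big /=; apply: eq_bigr => lm _.
  by rewrite /f rmorphM mulrACA.
have [b E] := CG_sum (index_enum _) (fun lm => v lm.1 * (v lm.2)^*) bf.
rewrite (_ : \sum_l _ = CG (fun y => w y * (w y)^*)); last first.
  rewrite pair_big /=; transitivity (\sum_lm (v lm.1 * (v lm.2)^*) * CG (f lm)).
    apply: eq_bigr => lm _; rewrite mxE mulrAC; congr (_ * _).
    by have [] := symbol_matrixE (xi lm.1) (xi lm.2).
  by rewrite -E; congr CG; apply/funext => y; rewrite wf.
have wE y : w y * (w y)^* = (complex.Re (w y) ^+ 2 + complex.Im (w y) ^+ 2)%:C.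
  by case: (w y) => a b'; apply: complex_eqP => /=; ring.
have bw : bounded_borel (fun y => complex.Re (w y) ^+ 2 + complex.Im (w y) ^+ 2).
  have [bR _] := b; congr bounded_borel: bR.
  by apply/funext => y; rewrite -wf wE.
(* In [R[i]], being nonnegative includes being real: the imaginary part is [G] of the zero
   function. *)
rewrite (_ : CG _ = (G (fun y => complex.Re (w y) ^+ 2 + complex.Im (w y) ^+ 2))%:C); last first.
  rewrite /CG; under eq_fun do rewrite wE.
  under [X in _ +i* G X]eq_fun do rewrite wE.
  by rewrite G_cst.
rewrite lecE eqxx /=; apply: G_ge0 => // [y|]; first by rewrite addr_ge0 ?sqr_ge0.
have -> : w x = 0.
  by rewrite /w big1// => l _; rewrite /chr dotpxx expi0 subrr mulr0.
by rewrite expr0n addr0.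
Qed.

Let symbol_bound : exists K : R, forall xi, normc (symbol p t x xi) <= K.
Proof.
have [K _ HK] := G_bound; exists (K + K) => xi; rewrite symbolE.
apply: (le_trans (normc_le _)); apply: lerD; rewrite normrN; apply: HK.
- exact: bounded_cos.
- by move=> y; exact: cos_max.
- exact: bounded_sin.
- by move=> y; exact: sin_max.
Qed.

Let symbol_quotient_bound : exists K : R, forall n xi, normc (symbol_quotient p t x xi (h_ n)) <= K.
Proof.
have [K _ HK] := rq_seq_bound; exists (K + K) => n xi; rewrite symbol_quotientE//.
apply: (le_trans (normc_le _)); apply: lerD; apply: HK.
- exact: bounded_cos.
- by move=> y; exact: cos_max.
- exact: bounded_sin.
- by move=> y; exact: sin_max.
Qed.

(** * Fourier representation of the right generator *)

Section fourier_representation.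
Context (f : 'rV[R]_d -> R).
Hypothesis f_schwartz : schwartz f.

Let f_bounded : bounded_borel f.
Proof.
have [cf _ /(_ (fun=> 0%N))[M fM]] := f_schwartz [::].
split; first exact: continuous_measurable_rV.
by exists M => y; have := fM y; rewrite big1 ?mul1r// => i _; rewrite expr0.
Qed.

Let fhat_integrable := fourier_integrable (schwartz_tame f_schwartz).

Let fhat_measurable : cmeasurable (fourier f) := cintegrable_measurable fhat_integrable.

Let fhat_normc_integrable := cintegrable_normc fhat_integrable.

Let expi_measurable y : cmeasurable (fun b : 'rV[R]_d => expi (dotp y b)).
Proof. by apply/cmeasurable_expi/measurable_dotp2 => //; exact: measurable_cst. Qed.

Let weighted_integrable (q : 'rV[R]_d -> R[i]) K : cmeasurable q ->
  (forall b, normc (q b) <= K) ->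
  cintegrable (lebesgue_rV d) setT (fun b => expi (dotp x b) * q b * fourier f b).
Proof.
move=> mq qK; apply: (cintegrable_dom (g := fun b => K * normc (fourier f b))).
- by apply: cmeasurableM => //; exact: cmeasurableM.
- exact: integrableZl fhat_normc_integrable.
- move=> b; rewrite ComplexField.Normc.normcM [X in X * _]ComplexField.Normc.normcM.
  rewrite normc_expi mul1r ler_wpM2r//.
  exact: (le_trans (normr_ge0 _) (normr_Re_le _)).
Qed.

Lemma symbol_fourier_integrable : cintegrable (lebesgue_rV d) setT
  (fun xi => expi (dotp x xi) * symbol p t x xi * fourier f xi).
Proof.
have [K HK] := symbol_bound; apply: (weighted_integrable _ HK); split.
  under eq_fun do rewrite symbolE /=; apply: measurableT_comp => //.
  exact: continuous_measurable_rV symbol_Re_continuous.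
under eq_fun do rewrite symbolE /=; apply: measurableT_comp => //.
exact: continuous_measurable_rV symbol_Im_continuous.
Qed.

(** Inversion is inserted under the transition probability. The measure [Q] is finite and the
    transform of [f] integrable, so the integrals commute, and [expi (dotp y b)] splits into its
    value at [x] and the character of the increment. *)
Let transition_fourier h : 0 < h ->
  (\int[p t (t + h) x]_y f y)%:C = (fourier_cst R d)%:C *
  cintegral (lebesgue_rV d) setT
    (fun b => expi (dotp x b) * cond_char_fun p t (t + h) x b * fourier f b).
Proof.
move=> h0; set Q := p t (t + h) x.
have [_ <-] := cintegral_real (integrable_p h f_bounded).
pose W y b := expi (dotp y b) * fourier f b.
have mW : cmeasurable (fun yb : 'rV[R]_d * 'rV[R]_d => W yb.1 yb.2).
  apply: cmeasurableM; first by apply/cmeasurable_expi/measurable_dotp2.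
  have [m1 m2] := fhat_measurable; split.
    exact: (measurableT_comp m1 measurable_snd).
  exact: (measurableT_comp m2 measurable_snd).
have iW : cintegrable (Q \x lebesgue_rV d)%E setT (fun yb => W yb.1 yb.2).
  apply: (cintegrable_prod_dom (g1 := fun=> 1) mW _ fhat_normc_integrable) => //.
    exact: finite_measure_integrable_cst.
  by move=> y b; rewrite mul1r ComplexField.Normc.normcM normc_expi mul1r.
transitivity (cintegral Q setT (fun y => (fourier_cst R d)%:C *
    cintegral (lebesgue_rV d) setT (fun b => W y b))).
  congr cintegral; apply/funext => y.
  exact: (fourier_inversion (schwartz_tame f_schwartz)).
rewrite (cintegralZl _ (cintegrable_fubini iW)).2 (cFubini iW); congr (_ * cintegral _ _ _).
apply/funext => b /=.
have mchr : cmeasurable (fun y : 'rV[R]_d => expi (dotp b (y - x))) by exact: cmeasurable_expi.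
have ichr : cintegrable Q setT (fun y : 'rV[R]_d => expi (dotp b (y - x))).
  apply: (@cintegrable_bounded _ _ _ _ _ 1) => // y; by rewrite normc_expi.
rewrite mulrAC /cond_char_fun -(cintegralZl (expi (dotp x b) * fourier f b) ichr).2.
congr cintegral; apply/funext => y; rewrite /W mulrAC -expiD; congr (expi _ * _).
rewrite /dotp -big_split /=; apply: eq_bigr => i _; rewrite !mxE; ring.
Qed.

(** Provides measurability in [xi] of the quotients, with [a] the cosine or the sine. *)
Let rq_continuous h (a : R -> R) : 0 < h -> continuous a -> (forall r, `|a r| <= 1) ->
  continuous (fun xi => rq (fun y => a (dotp xi (y - x))) h).
Proof.
move=> h0 ca a1.
have ma (xi : 'rV[R]_d) : measurable_fun setT (fun y : 'rV[R]_d => a (dotp xi (y - x))).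
  exact: measurableT_comp (continuous_measurable_fun ca) (measurable_phase xi).
have ba (xi : 'rV[R]_d) : bounded_borel (fun y : 'rV[R]_d => a (dotp xi (y - x))).
  by split => //; exists 1.
under eq_fun do rewrite rqE// dotpxx.
apply: seq_continuous_rV => u v uv; apply: cvgMr; apply: cvgB; last exact: cvg_cst.
apply: (Rdominated_cvg (g := fun=> 1)) => //.
- move=> y _; apply: continuous_cvg; first exact: ca.
  exact: phase_cvg.
- exact: finite_measure_integrable_cst.
Qed.

Let symbol_quotient_measurable h : 0 < h -> cmeasurable (symbol_quotient p t x ^~ h).
Proof.
move=> h0; split; under eq_fun do rewrite symbol_quotientE//=.
  exact: (continuous_measurable_rV (rq_continuous h0 (@continuous_cos R) (@cos_max R))).
exact: (continuous_measurable_rV (rq_continuous h0 (@continuous_sin R) (@sin_max R))).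
Qed.

(** The transition formula minus the inversion formula at [x], divided by [h]. The characteristic
    function is written as 1 plus [h] times the quotient, which leaves two separately integrable
    terms. *)
Let rq_fourier n : (rq f (h_ n))%:C = (fourier_cst R d)%:C *
  cintegral (lebesgue_rV d) setT
    (fun b => expi (dotp x b) * symbol_quotient p t x b (h_ n) * fourier f b).
Proof.
set h := h_ n; have h0 : 0 < h by exact: h_gt0.
pose A b := expi (dotp x b) * fourier f b.
have iA : cintegrable (lebesgue_rV d) setT A.
  have H (b : 'rV[R]_d) : normc (1 : R[i]) <= 1 by rewrite (normc_real 1) normr1.
  have := weighted_integrable (cmeasurable_cst 1) H.
  by congr cintegrable; apply/funext => b; rewrite mulr1.
pose C b := expi (dotp x b) * symbol_quotient p t x b h * fourier f b.
have hV : h%:C * (h^-1)%:C = 1 :> R[i] by rewrite -rmorphM /= mulfV ?gt_eqF.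
have BE b : expi (dotp x b) * cond_char_fun p t (t + h) x b * fourier f b =
    h%:C * C b + A b.
  rewrite /C /A /symbol_quotient; set z := cond_char_fun _ _ _ _ _.
  by rewrite -[z in LHS]mul1r -hV; ring: hV.
have iC : cintegrable (lebesgue_rV d) setT C.
  have [K HK] := symbol_quotient_bound; apply: (weighted_integrable _ (HK n)).
  exact: symbol_quotient_measurable.
have [ihC hCE] := cintegralZl h%:C iC.
have := transition_fourier h0.
rewrite (_ : (fun b => _) = (fun b => h%:C * C b + A b)); last exact/funext.
rewrite (cintegralD ihC iA).2 hCE => E.
rewrite rqE// rmorphM rmorphB /= E (fourier_inversion (schwartz_tame f_schwartz)) -/A.
by rewrite -[RHS]mul1r -hV; ring.
Qed.

Lemma right_generator_fourier :
  (right_generator (evolution T pi12) t f x)%:C = - ((fourier_cst R d)%:C *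
    cintegral (lebesgue_rV d) setT
      (fun xi => expi (dotp x xi) * symbol p t x xi * fourier f xi)).
Proof.
have -> : right_generator (evolution T pi12) t f x = G f.
  by apply: cvg_lim => //; exact: rq_cvg.
have [K HK] := symbol_quotient_bound.
pose q xi : R[i] := - symbol p t x xi.
have cq xi : complex.Re (symbol_quotient p t x xi (h_ n)) @[n --> \oo] --> complex.Re (q xi) /\
    complex.Im (symbol_quotient p t x xi (h_ n)) @[n --> \oo] --> complex.Im (q xi).
  rewrite /q symbolE opprK; split.
    rewrite (_ : (fun n => _) = fun n => rq (fun y => cos (dotp xi (y - x))) (h_ n)).
      exact: rq_seq (bounded_cos xi).
    by apply/funext => n; rewrite symbol_quotientE.
  rewrite (_ : (fun n => _) = fun n => rq (fun y => sin (dotp xi (y - x))) (h_ n)).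
    exact: rq_seq (bounded_sin xi).
  by apply/funext => n; rewrite symbol_quotientE.
pose D n b := expi (dotp x b) * symbol_quotient p t x b (h_ n) * fourier f b.
pose D' b := expi (dotp x b) * q b * fourier f b.
have cD b : complex.Re (D n b) @[n --> \oo] --> complex.Re (D' b) /\
    complex.Im (D n b) @[n --> \oo] --> complex.Im (D' b).
  have [c1 c2] := cq b; rewrite /D /D'; set u := expi _; set v := fourier f b.
  have uv (z : R[i]) : u * z * v = u * v * z by rewrite mulrAC.
  split.
    under eq_cvg do rewrite uv complex_ReM.
    by rewrite uv complex_ReM; apply: cvgB; apply: cvgMr.
  under eq_cvg do rewrite uv complex_ImM.
  by rewrite uv complex_ImM; apply: cvgD; apply: cvgMr.
have [cR cI] : complex.Re (cintegral (lebesgue_rV d) setT (D n)) @[n --> \oo] -->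
      complex.Re (cintegral (lebesgue_rV d) setT D') /\
    complex.Im (cintegral (lebesgue_rV d) setT (D n)) @[n --> \oo] -->
      complex.Im (cintegral (lebesgue_rV d) setT D').
  apply: (cdominated_cvg (g := fun b => K * normc (fourier f b))).
  - move=> n; apply: cmeasurableM => //; apply: cmeasurableM => //.
    exact: symbol_quotient_measurable.
  - by move=> b; have [] := cD b.
  - by move=> b; have [] := cD b.
  - exact: integrableZl fhat_normc_integrable.
  - move=> n b; rewrite ComplexField.Normc.normcM [X in X * _]ComplexField.Normc.normcM.
    rewrite normc_expi mul1r ler_wpM2r//.
    exact: (le_trans (normr_ge0 _) (normr_Re_le _)).
have D'E : cintegral (lebesgue_rV d) setT D' = - cintegral (lebesgue_rV d) setT
    (fun xi => expi (dotp x xi) * symbol p t x xi * fourier f xi).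
  rewrite -mulN1r -(cintegralZl (-1) symbol_fourier_integrable).2.
  by congr cintegral; apply/funext => b; rewrite /D' /q mulrN mulNr mulN1r.
rewrite -mulrN -D'E; apply: complex_eqP; rewrite ?complex_ReM ?complex_ImM /= mul0r.
  rewrite subr0; apply: (@cvg_unique _ _ (rq f (h_ n) @[n --> \oo])).
  - exact: norm_hausdorff.
  - exact: rq_seq.
  - rewrite (_ : (fun n => _) =
        fun n => fourier_cst R d * complex.Re (cintegral (lebesgue_rV d) setT (D n))).
      exact: cvgMr.
    apply/funext => n; have /(congr1 (@complex.Re R)) := rq_fourier n.
    by rewrite complex_ReM /= mul0r subr0.
(* The quotients of the real function [f] are real, so the imaginary parts of the Fourier integrals
   vanish for every [n], and so does their limit. *)
rewrite addr0; apply: (@cvg_unique _ _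
  ((fourier_cst R d * complex.Im (cintegral (lebesgue_rV d) setT (D n))) @[n --> \oo])).
- exact: norm_hausdorff.
- rewrite (_ : (fun n => _) = fun=> 0); first exact: cvg_cst.
  apply/funext => n; have /(congr1 (@complex.Im R)) := rq_fourier n.
  by rewrite complex_ImM /= mul0r addr0 => <-.
- exact: cvgMr.
Qed.

End fourier_representation.

End symbol.

Unset Implicit Arguments.

Theorem theorem3p3 (R : realType) (d k : nat) (disp : measure_display)
    (Omega : measurableType disp)
    (P : 'rV[R]_d -> probability Omega R)
    (F : 'rV[R]_k -> set (set Omega))
    (X : 'rV[R]_k -> Omega -> 'rV[R]_d)
    (T : 'rV[R]_k -> ('rV[R]_d -> R) -> 'rV[R]_d -> R)
    (S : R -> Omega -> 'rV[R]_k)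
    (c : R -> 'rV[R]_k)
    (nu : R -> {measure set 'rV[R]_k -> \bar R})
    (pi12 : R -> R -> probability 'rV[R]_k R)
    (p : R -> R -> 'rV[R]_d -> probability 'rV[R]_d R)
    (d_gt0 : (0 < d)%N) (k_gt0 : (0 < k)%N)
    (X_markov : homogeneous_markov P F X T)
    (T_C0 : C0_semigroup T)
    (S_additive : forall x, additive_subordinator (P x) S)
    (S_law : forall x t1 t2, 0 <= t1 -> t1 <= t2 ->
      increment_law (P x) S t1 t2 (pi12 t1 t2))
    (XS_indep : forall x,
      independent_processes (P x) orthant X [set t : R | 0 <= t] S)
    (cnu_regular : regular_characteristics c nu)
    (S_char : (forall x, pointwise_characteristics (P x) S c nu) \/
              (forall x, differential_characteristics (P x) S c nu))
    (p_mixed : mixed_transition P X pi12 p)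
    (Y_markov : inhomogeneous_markov P (subordinate X S) p)
    (Y_generator : forall (t : R) (f : 'rV[R]_d -> R), 0 <= t ->
      (forall j, gen_domain T j f) ->
      unif_cvg 0^'+ (right_quotient (evolution T pi12) t f)
        (subordinate_generator T (c t) (nu t) f)) :
  forall t : R, 0 <= t ->
    [/\ forall x xi, cvg (symbol_quotient p t x xi h @[h --> 0^'+]),
        forall (f : 'rV[R]_d -> R) (x : 'rV[R]_d),
          schwartz f -> (forall j, gen_domain T j f) ->
          cintegrable (lebesgue_rV d) setT
            (fun xi => expi (dotp x xi) * symbol p t x xi * fourier f xi) /\
          (right_generator (evolution T pi12) t f x)%:C =
            - ((fourier_cst R d)%:C *
               cintegral (lebesgue_rV d) setT
                 (fun xi => expi (dotp x xi) * symbol p t x xi * fourier f xi)),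
        forall x, continuous (symbol p t x) &
        forall x, negative_definite (symbol p t x)].
Proof.
move=> t t_ge0; have nu_levy := rc_levy cnu_regular t_ge0.
have gen f := Y_generator t f t_ge0.
split.
- by move=> x xi; exact: (symbol_quotient_is_cvg X_markov T_C0 p_mixed t_ge0 gen).
- move=> f x f_schwartz _; split.
    exact: (symbol_fourier_integrable X_markov T_C0 p_mixed t_ge0 nu_levy gen).
  exact: (right_generator_fourier X_markov T_C0 p_mixed t_ge0 nu_levy gen).
- by move=> x; exact: (continuous_symbol X_markov T_C0 p_mixed t_ge0 nu_levy gen).
- by move=> x; exact: (symbol_negative_definite X_markov T_C0 p_mixed t_ge0 gen).
Qed.
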